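(* Let $s\in(0,1)$, let $\Omega\subset\mathbb{H}^n$ be a bounded domain, and let $u\in H^s(\mathbb{H}^n)$ be a weak solution to $$(-\Delta_{\mathbb{H}^n})^su=0\ \text{ in }\Omega,\qquad u=g\ \text{ in }\mathbb{H}^n\smallsetminus\Omega,$$ such that $u\ge0$ in $B_R\equiv B_R(\xi_0)\subset\Omega$. Then, for any $B_r\equiv B_r(\xi_0)$ such that $B_{6r}\equiv B_{6r}(\xi_0)\subset B_R$, $$\sup_{B_r}u\ \le\ c\,\inf_{B_r}u+c\,(1-s)\left(\frac rR\right)^{2s}\mathrm{Tail}(u_-;\xi_0,R),$$ where $u_-:=\max\{-u,0\}$ and $c=c(n,s)$.
   Context: Heisenberg group: $\mathbb{H}^n$ is $\mathbb{R}^{2n+1}$ with points $\xi=(z,t)=(x_1,\dots,x_n,y_1,\dots,y_n,t)$, group law $\xi\circ\xi'=(x+x',\,y+y',\,t+t'+2\langle y,x'\rangle-2\langle x,y'\rangle)$, homogeneous dimension $Q=2n+2$, standard homogeneous norm $|\xi|_{\mathbb{H}^n}=(|z|^4+t^2)^{1/4}$, and $B_\rho(\xi_0)=\{\xi:|\xi_0^{-1}\circ\xi|_{\mathbb{H}^n}<\rho\}$; integrals are with respect to Lebesgue measure. $H^s(\mathbb{H}^n)=W^{s,2}(\mathbb{H}^n)$ is the set of $u\in L^2(\mathbb{H}^n)$ with $[u]^2=\int_{\mathbb{H}^n}\int_{\mathbb{H}^n}\frac{|u(\xi)-u(\eta)|^2}{|\eta^{-1}\circ\xi|_{\mathbb{H}^n}^{Q+2s}}\,d\xi\,d\eta<\infty$,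 with norm $(\|u\|_{L^2}^2+[u]^2)^{1/2}$; $W_0^{s,2}(\Omega)$ is the closure of $C_0^\infty(\Omega)$ in $H^s(\mathbb{H}^n)$. The boundary datum is $g\in H^s(\mathbb{H}^n)$. The fractional subLaplacian is $(-\Delta_{\mathbb{H}^n})^su(\xi)=C(n,s)\,\mathrm{P.V.}\int_{\mathbb{H}^n}\frac{u(\xi)-u(\eta)}{|\eta^{-1}\circ\xi|_{\mathbb{H}^n}^{Q+2s}}\,d\eta$, with $C(n,s)>0$ a normalizing constant depending only on $n,s$ (its value plays no role since the right-hand side is zero). Weak solutions: $u\in H^s(\mathbb{H}^n)$ with $(g-u)_-\in W_0^{s,2}(\Omega)$ (resp. $(g-u)_+\in W_0^{s,2}(\Omega)$) is a weak subsolution (resp. supersolution) if $$\int_{\mathbb{H}^n}\int_{\mathbb{H}^n}\frac{(u(\xi)-u(\eta))(\psi(\xi)-\psi(\eta))}{|\eta^{-1}\circ\xi|_{\mathbb{H}^n}^{Q+2s}}\,d\xi\,d\eta\ \le\ (\text{resp. }\ge)\ 0$$ for every nonnegative $\psi\in W_0^{s,2}(\Omega)$; a weak solution is both. Nonlocal tail ($p=2$): $\mathrm{Tail}(u;\xi_0,R)=R^{2s}\int_{\mathbb{H}^n\smallsetminus B_R(\xi_0)}|u(\eta)|\,|\eta^{-1}\circ\xi_0|_{\mathbb{H}^n}^{-Q-2s}\,d\eta$. Suprema and infima of $u$ are essential ones. *)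

(* Defs.v *)
From HB Require Import structures.
From mathcomp Require Import all_boot all_order all_algebra.
From mathcomp Require Import all_classical all_reals all_analysis.
From mathcomp Require Import measurable_realfun ess_sup_inf.
Import Order.TTheory GRing.Theory Num.Theory.
Import numFieldNormedType.Exports.

Set Implicit Arguments.
Unset Strict Implicit.
Unset Printing Implicit Defensive.

Local Open Scope classical_set_scope.
Local Open Scope ring_scope.

Definition measure_rV_display : measure_display.
Proof. exact: default_measure_display. Qed.

(* The sigma-algebra on row vectors is generated by the coordinates, as for
   tuples in MathComp-Analysis; it is the Borel sigma-algebra of R^n.         *)
Section measurable_rV.
Variables (R : realType) (n : nat).

Let coord (i : 'I_n) (v : 'rV[R]_n) : R := v ord0 i.

Let rV_set0 : g_sigma_preimage coord set0.
Proof. exact: sigma_algebra0. Qed.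

Let rV_setC A : g_sigma_preimage coord A -> g_sigma_preimage coord (~` A).
Proof. exact: sigma_algebraC. Qed.

Let rV_bigcup (F : _^nat) : (forall i, g_sigma_preimage coord (F i)) ->
  g_sigma_preimage coord (\bigcup_i (F i)).
Proof. exact: sigma_algebra_bigcup. Qed.

HB.instance Definition _ := @isMeasurable.Build measure_rV_display
  'rV[R]_n (g_sigma_preimage coord) rV_set0 rV_setC rV_bigcup.

Lemma measurable_rV_coord (i : 'I_n) :
  measurable_fun [set: 'rV[R]_n] (fun v => v ord0 i).
Proof.
move=> _ Y mY; rewrite setTI; apply: sub_sigma_algebra => /=.
rewrite -bigcup_seq/=; exists i => /=; first by rewrite mem_index_enum.
by exists Y => //; rewrite setTI.
Qed.

Lemma measurable_fun_rV d (T : measurableType d) (f : T -> 'rV[R]_n) :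
  (forall i, measurable_fun [set: T] (fun x => f x ord0 i)) ->
  measurable_fun [set: T] f.
Proof.
move=> mf; suff: g_sigma_preimage (fun i x => f x ord0 i) `<=` measurable.
  move=> h _ A mA; apply: h.
  rewrite -[X in g_sigma_preimage X]/(fun i => coord i \o f).
  by rewrite g_sigma_preimage_comp; exists A.
apply: smallest_sub; first exact: sigma_algebra_measurable.
rewrite -bigcup_seq; apply: bigcup_sub => i _ A [B mB <-]; exact: mf.
Qed.

End measurable_rV.

(* The canonical sigma-finite structure of a product measure only applies to
   subprobabilities.                                                          *)
Lemma product_measure_sigma_finite d1 d2 (T1 : measurableType d1)
    (T2 : measurableType d2) (R : realType)
    (m1 : {sigma_finite_measure set T1 -> \bar R})
    (m2 : {sigma_finite_measure set T2 -> \bar R}) :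
  sigma_finite setT (m1 \x m2)%E.
Proof.
have /sigma_finiteP[F [TF ndF Foo]] := sigma_finiteT m1.
have /sigma_finiteP[G [TG ndG Goo]] := sigma_finiteT m2.
exists (fun n => F n `*` G n).
  rewrite -setXTT TF TG predeqE => -[x y]; split.
    move=> [/= [n _ Fnx] [k _ Gky]]; exists (maxn n k) => //; split.
    - by move: x Fnx; exact/subsetPset/ndF/leq_maxl.
    - by move: y Gky; exact/subsetPset/ndG/leq_maxr.
  by move=> [n _ []/= ? ?]; split; exists n.
move=> k; have [? ?] := Foo k; have [? ?] := Goo k.
split; first exact: measurableX.
by rewrite product_measure1E// lte_mul_pinfty// ge0_fin_numE.
Qed.

Section lebesgue_rV.
Variable R : realType.

Definition cons_rV n (p : measurableTypeR R * 'rV[R]_n) : 'rV[R]_n.+1 :=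
  \row_i oapp (p.2 ord0) (p.1 : R) (unlift ord0 i).

Definition uncons_rV n (v : 'rV[R]_n.+1) : measurableTypeR R * 'rV[R]_n :=
  (v ord0 ord0, \row_i v ord0 (lift ord0 i)).

Lemma cons_rVK n : cancel (@cons_rV n) (@uncons_rV n).
Proof.
move=> [x v]; rewrite /uncons_rV /cons_rV mxE unlift_none; congr pair.
by apply/rowP => i; rewrite !mxE liftK.
Qed.

Lemma measurable_cons_rV n : measurable_fun setT (@cons_rV n).
Proof.
apply: measurable_fun_rV => i; under eq_fun do rewrite mxE.
case: (unliftP ord0 i) => [j _|_] /=; last exact: measurable_fst.
by apply: (measurableT_comp (measurable_rV_coord j)).
Qed.

Lemma measurable_uncons_rV n : measurable_fun setT (@uncons_rV n).
Proof.
apply/measurable_fun_pairP; split; first exact: measurable_rV_coord.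
apply: measurable_fun_rV => i; under eq_fun do rewrite /= mxE.
exact: measurable_rV_coord.
Qed.

Section lebesgue_cons.
Variables (n : nat) (m : {sigma_finite_measure set 'rV[R]_n -> \bar R}).

Definition lebesgue_cons : set 'rV[R]_n.+1 -> \bar R :=
  pushforward (@lebesgue_measure R \x m)%E (@cons_rV n).

Let mcons := @measurable_cons_rV n.

Let lebesgue_cons0 : lebesgue_cons set0 = 0%E.
Proof. exact: measure0. Qed.

Let lebesgue_cons_ge0 A : (0 <= lebesgue_cons A)%E.
Proof. exact: measure_ge0. Qed.

Let lebesgue_cons_sigma_additive : semi_sigma_additive lebesgue_cons.
Proof. exact: measure_semi_sigma_additive. Qed.

HB.instance Definition _ := isMeasure.Build _ _ _ lebesgue_cons
  lebesgue_cons0 lebesgue_cons_ge0 lebesgue_cons_sigma_additive.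

Let lebesgue_cons_sigma_finite : sigma_finite setT lebesgue_cons.
Proof.
have [F FT mF] : sigma_finite setT (@lebesgue_measure R \x m)%E.
  exact: product_measure_sigma_finite.
exists (fun k => @uncons_rV n @^-1` F k).
  by rewrite -preimage_bigcup -FT.
move=> k; have [mFk Fkoo] := mF k; split.
  by rewrite -[X in measurable X]setTI; exact: measurable_uncons_rV.
rewrite /lebesgue_cons /pushforward -comp_preimage.
by rewrite (_ : _ \o _ = id) ?preimage_id//; apply/funext; exact: cons_rVK.
Qed.

HB.instance Definition _ := Measure_isSigmaFinite.Build _ _ _ lebesgue_cons
  lebesgue_cons_sigma_finite.

End lebesgue_cons.

Fixpoint lebesgue_rV n : {sigma_finite_measure set 'rV[R]_n -> \bar R} :=
  match n with
  | 0 => \d_(0 : 'rV[R]_0)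
  | n'.+1 => lebesgue_cons (lebesgue_rV n')
  end.

Lemma measurable_rV_box n (A : 'I_n -> set R) : (forall i, measurable (A i)) ->
  measurable [set v : 'rV[R]_n | forall i, A i (v ord0 i)].
Proof.
move=> mA; rewrite (_ : [set _ | _] = \bigcap_(i in [set: 'I_n])
    ((fun v : 'rV[R]_n => v ord0 i) @^-1` A i)).
  apply: fin_bigcap_measurable => [|i _]; first exact: finite_finset.
  by rewrite -[X in measurable X]setTI; exact: measurable_rV_coord.
by apply/seteqP; split => v /= h i; [move=> _|]; exact: h.
Qed.

Lemma lebesgue_rV_box n (A : 'I_n -> set R) : (forall i, measurable (A i)) ->
  lebesgue_rV n [set v | forall i, A i (v ord0 i)] =
  (\prod_(i < n) @lebesgue_measure R (A i))%E.
Proof.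
elim: n A => [|n IHn] A mA; first by rewrite big_ord0 /= diracE mem_set// => -[].
rewrite big_ord_recl -IHn//= -product_measure1E; last 2 first.
- exact: mA.
- exact: (@measurable_rV_box _ (fun i => A (lift ord0 i))).
rewrite /lebesgue_cons/pushforward; congr (_ _).
apply/seteqP; split => -[x v] /=.
  move=> Axv; split; first by have := Axv ord0; rewrite mxE unlift_none.
  by move=> i; have := Axv (lift ord0 i); rewrite mxE liftK.
by move=> [Ax Av] i; rewrite mxE; case: unliftP => [j ->|->].
Qed.

End lebesgue_rV.

(* A point (x, y, t) of the Heisenberg group is the row vector
   (x_1, ..., x_n, y_1, ..., y_n, t) of R^(2n+1).                             *)
Notation heis R n := 'rV[R]_(n + n + 1).

Section heisenberg.
Variables (R : realType) (n : nat).
Local Notation H := (heis R n).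
Implicit Types (xi eta : H) (rho s : R).

Definition hpoint (x y : 'rV[R]_n) (t : R) : H := row_mx (row_mx x y) t%:M.
Definition hz xi : 'rV[R]_(n + n) := lsubmx xi.
Definition hx xi : 'rV[R]_n := lsubmx (hz xi).
Definition hy xi : 'rV[R]_n := rsubmx (hz xi).
Definition ht xi : R := rsubmx xi ord0 ord0.

Definition dotr m (v w : 'rV[R]_m) : R := \sum_(i < m) v ord0 i * w ord0 i.

Definition hmul xi eta : H :=
  hpoint (hx xi + hx eta) (hy xi + hy eta)
    (ht xi + ht eta + 2 * dotr (hy xi) (hx eta) - 2 * dotr (hx xi) (hy eta)).

Definition hinv xi : H := - xi.

Definition hdim : nat := 2 * n + 2.

(* dotr z z = |z|^2 for the Euclidean norm |z|; the library norm on row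
   vectors is the sup norm. *)
Definition hnorm xi : R :=
  ((dotr (hz xi) (hz xi)) ^+ 2 + ht xi ^+ 2) `^ (4^-1).

Definition hball (xi0 : H) rho : set H :=
  [set xi | hnorm (hmul (hinv xi0) xi) < rho].

Lemma hpointK xi : hpoint (hx xi) (hy xi) (ht xi) = xi.
Proof.
rewrite /hpoint /hx /hy hsubmxK -[RHS]hsubmxK; congr row_mx.
by apply/rowP => i; rewrite ord1 mxE eqxx.
Qed.

Lemma hx_hpoint x y t : hx (hpoint x y t) = x.
Proof. by rewrite /hx /hz !row_mxKl. Qed.

Lemma hy_hpoint x y t : hy (hpoint x y t) = y.
Proof. by rewrite /hy /hz row_mxKl row_mxKr. Qed.

Lemma ht_hpoint x y t : ht (hpoint x y t) = t.
Proof. by rewrite /ht row_mxKr mxE eqxx. Qed.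

Lemma hmulV xi : hmul (hinv xi) xi = 0.
Proof.
have dC v w : @dotr n v w = dotr w v by apply: eq_bigr => i _; rewrite mulrC.
have dN v w : @dotr n (- v) w = - dotr v w.
  by rewrite -sumrN; apply: eq_bigr => i _; rewrite mxE mulNr.
rewrite /hmul /hinv /hx /hy /hz /ht !linearN /= !mxE !addNr !dN dC.
by rewrite addrK /hpoint raddf0 !row_mx0.
Qed.

Lemma measurable_dotr d (T : measurableType d) m (v w : T -> 'rV[R]_m) :
  measurable_fun setT v -> measurable_fun setT w ->
  measurable_fun setT (fun x => dotr (v x) (w x)).
Proof.
by move=> mv mw; apply: measurable_sum => i; apply: measurable_funM;
  apply: (measurableT_comp (measurable_rV_coord i)).
Qed.

Lemma measurable_hz : measurable_fun setT hz.
Proof.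
apply: measurable_fun_rV => i; rewrite /hz; under eq_fun do rewrite mxE.
exact: measurable_rV_coord.
Qed.

Lemma measurable_hx : measurable_fun setT hx.
Proof.
apply: measurable_fun_rV => i; rewrite /hx; under eq_fun do rewrite mxE.
exact: (measurableT_comp (measurable_rV_coord _) measurable_hz).
Qed.

Lemma measurable_hy : measurable_fun setT hy.
Proof.
apply: measurable_fun_rV => i; rewrite /hy; under eq_fun do rewrite mxE.
exact: (measurableT_comp (measurable_rV_coord _) measurable_hz).
Qed.

Lemma measurable_ht : measurable_fun setT ht.
Proof.
by rewrite /ht; under eq_fun do rewrite mxE; exact: measurable_rV_coord.
Qed.

Lemma measurable_hnorm : measurable_fun setT hnorm.
Proof.
apply: (measurableT_comp (measurable_powR _)).
apply: measurable_funD; apply: measurable_funX; last exact: measurable_ht.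
by apply: measurable_dotr; exact: measurable_hz.
Qed.

Lemma measurable_row_mx d (T : measurableType d) m k
    (f : T -> 'rV[R]_m) (g : T -> 'rV[R]_k) :
  measurable_fun setT f -> measurable_fun setT g ->
  measurable_fun setT (fun x => row_mx (f x) (g x)).
Proof.
move=> mf mg; apply: measurable_fun_rV => i.
have [j ->|j ->] := split_ordP i.
  apply: (eq_measurable_fun (fun x => f x ord0 j)).
    by move=> x _; rewrite row_mxEl.
  exact: (measurableT_comp (measurable_rV_coord j)).
apply: (eq_measurable_fun (fun x => g x ord0 j)).
  by move=> x _; rewrite row_mxEr.
exact: (measurableT_comp (measurable_rV_coord j)).
Qed.

Let measurable_rV_D d (T : measurableType d) m (v : 'rV[R]_m) (f : T -> 'rV[R]_m) :
  measurable_fun setT f -> measurable_fun setT (fun x => v + f x).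
Proof.
move=> mf; apply: measurable_fun_rV => i; under eq_fun do rewrite mxE.
apply: measurable_funD => //.
exact: (measurableT_comp (measurable_rV_coord i)).
Qed.

Lemma measurable_hmull xi : measurable_fun setT (hmul xi).
Proof.
apply: measurable_row_mx.
  apply: measurable_row_mx; apply: measurable_rV_D.
    exact: measurable_hx.
  exact: measurable_hy.
apply: measurable_fun_rV => i; rewrite [i]ord1; under eq_fun do rewrite mxE eqxx mulr1n.
apply: measurable_funB; first apply: measurable_funD.
- by apply: measurable_funD => //; exact: measurable_ht.
- by apply: measurable_funM => //; apply: measurable_dotr => //; exact: measurable_hx.
- by apply: measurable_funM => //; apply: measurable_dotr => //; exact: measurable_hy.
Qed.

Lemma measurable_hball xi0 rho : measurable (hball xi0 rho).
Proof.
rewrite -[X in measurable X]setTI.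
apply: (@measurable_fun_ltr _ _ _ setT (fun xi => hnorm (hmul (hinv xi0) xi))
  (cst rho)) => //.
exact: (measurableT_comp measurable_hnorm (measurable_hmull _)).
Qed.

End heisenberg.

Section fractional_sobolev.
Variables (R : realType) (n : nat).
Local Notation H := (heis R n).
Local Notation leb := (lebesgue_rV R (n + n + 1)).
Implicit Types (s : R) (u v g psi phi : H -> R) (Omega : set H).

(* |eta^-1 o xi|^(Q + 2s) *)
Definition hkernel s (xi eta : H) : R :=
  hnorm (hmul (hinv eta) xi) `^ ((hdim n)%:R + 2 * s).

(* The square [u]^2 of the seminorm. On the diagonal the integrand reads
   0 / 0 = 0.                                                                 *)
Definition gagliardo2 s u : \bar R :=
  (\int[leb \x leb]_p ((u p.1 - u p.2) ^+ 2 / hkernel s p.1 p.2)%:E)%E.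

Definition Hs s : set (H -> R) :=
  [set u | u \in Lfun leb 2%:E /\ (gagliardo2 s u < +oo)%E].

Definition Hs_norm s u : \bar R :=
  (('N[leb]_2%:E[EFin \o u] ^+ 2 + gagliardo2 s u) `^ (2^-1))%E.

(* C^infinity: all iterated directional derivatives exist and are
   differentiable.                                                            *)
Definition smooth phi : Prop :=
  forall (vs : seq H) (xi : H),
    differentiable (foldr (fun (w : H) (f : H -> R) => 'D_w f) phi vs) xi.

Definition Cc_infty Omega : set (H -> R) :=
  [set phi | [/\ smooth phi,
                 compact (closure [set xi | phi xi != 0]) &
                 closure [set xi | phi xi != 0] `<=` Omega]].

Definition W0 s Omega : set (H -> R) :=
  [set v | Hs s v /\
    forall eps : R, 0 < eps ->
      exists2 phi, Cc_infty Omega phi & (Hs_norm s (v \- phi)%R < eps%:E)%E].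

Definition energy_form s u psi : \bar R :=
  (\int[leb \x leb]_p
     ((u p.1 - u p.2) * (psi p.1 - psi p.2) / hkernel s p.1 p.2)%:E)%E.

(* Elements of Hs and W0 are representatives of almost everywhere classes, so
   pointwise inequalities are understood almost everywhere.                   *)
Definition weak_subsolution s Omega g u : Prop :=
  [/\ Hs s u, W0 s Omega (g \- u)^\- &
    forall psi, W0 s Omega psi -> (\forall xi \ae leb, 0 <= psi xi) ->
      (energy_form s u psi <= 0)%E].

Definition weak_supersolution s Omega g u : Prop :=
  [/\ Hs s u, W0 s Omega (g \- u)^\+ &
    forall psi, W0 s Omega psi -> (\forall xi \ae leb, 0 <= psi xi) ->
      (0 <= energy_form s u psi)%E].

Definition weak_solution s Omega g u : Prop :=
  weak_subsolution s Omega g u /\ weak_supersolution s Omega g u.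

Definition Tail s u (xi0 : H) (rho : R) : \bar R :=
  ((rho `^ (2 * s))%:E *
   \int[leb]_(eta in ~` hball xi0 rho)
     (`|u eta| * hnorm (hmul (hinv eta) xi0) `^ (- (hdim n)%:R - 2 * s))%:E)%E.

Definition ess_sup_hball u (xi0 : H) (rho : R) : \bar R :=
  ess_sup (mrestr leb (measurable_hball xi0 rho)) (EFin \o u).

Definition ess_inf_hball u (xi0 : H) (rho : R) : \bar R :=
  ess_inf (mrestr leb (measurable_hball xi0 rho)) (EFin \o u).

Definition bounded_domain Omega : Prop :=
  [/\ open Omega, connected Omega, Omega !=set0 & bounded_set Omega].

End fractional_sobolev.

(* Main.v *)
Require Import Defs.
From mathcomp Require Import all_boot all_order all_algebra.
From mathcomp Require Import all_classical all_reals all_analysis.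
From mathcomp Require Import measurable_realfun ess_sup_inf ring lra.
Import Order.TTheory GRing.Theory Num.Theory.
Import numFieldNormedType.Exports.

Set Implicit Arguments.
Unset Strict Implicit.
Unset Printing Implicit Defensive.

Local Open Scope classical_set_scope.
Local Open Scope ring_scope.

(** The inequality is proved for smooth averages of the solution, by comparison with
    explicit barriers, and then carried over to the essential bounds of the solution
    itself. Regularity theory for weak solutions does not enter.

    Reduction. The similarity S y = xi0 . delta_r y carries the unit ball to the ball of
    radius r around xi0; put U = u o S. With a smooth bump b supported in
    |w| < eps, the mollification V x = \int U(y) b(x y^-1) dy is an average of the
    functions x |-> U(w^-1 x), that is, of left translates of U, and the energy is
    left invariant. So testing the equation against y |-> b(x y^-1), for |x| <= 2, and
    writing the two points of the energy as S(y k) and S y, one finds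

      \int |k|^-(Q + 2 s) (2 V(x) - V(x k) - V(x k^-1)) dk = 0          (moll_harmonic).

    Here V is bounded and continuous, and V >= 0 on |x| < 3. The integrand is integrable
    because it comes from the energy, so no second-order bound on V enters.

    The pointwise inequality. Let N = |.|^4, which is a polynomial, so the barrier
    1 - N / 16, positive exactly on |x| < 2, has increments that are explicitly
    O(|k|), and symmetric second increments that are O(|k|^2). Let J and T be the
    integrals of V_+ and of V_- against the kernel truncated at |k| = 1.
    - J <= C (V(y) + T) for |y| <= 1 (harnack_lower). Subtract from V the barrier times t,
      where t is slightly more than 2 V(y), so that the difference is negative at y. At
      a minimum point of the difference in the ball of radius 2, the equation bounds the
      integral of V_+ by that of V_- plus a multiple of t.
    - V(x) <= C J for |x| <= 1 (harnack_upper). At a maximum point x0 of V d^Q, where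
      d = 1 - N / 16, the function V is controlled by d^-Q from above, hence its second
      increments are controlled from below in a ball of radius proportional to d(x0).
      Integrating the equation there bounds V(x0) d(x0)^Q by J.
    Together, V(x) <= C (V(y) + T) on the unit ball (pointwise_harnack).

    Passage to the limit. Let c be the mass of b. The tail T of V is at most a constant
    times c times the tail of U (moll_neg_tail), and the latter is the tail of u by
    scaling (Tail_rescaled). If U > a on a subset A of positive measure of the unit ball,
    then, for a' < a and eps small, V > a' c at some point of A (moll_affine_superlevel):
    this rests on the convergence in measure of the translates h^-1 A to A as h tends
    to 0 (measurable_translation_continuous). Applied to sets where u is close to its
    essential supremum and to its essential infimum, the pointwise inequality for V
    becomes the inequality for u. The constant may depend on s, so the factor 1 - s in
    front of the tail is paid for by a factor 1 / (1 - s) in it. *)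

(** * Change of variables for triangular affine maps *)

(** The push-forward as a measure, the measurability of the map being an
    argument of the canonical structure. *)
Definition image_measure d1 d2 (T1 : measurableType d1) (T2 : measurableType d2)
    (R : realType) (m : {measure set T1 -> \bar R}) (f : T1 -> T2)
    (mf : measurable_fun setT f) : {measure set T2 -> \bar R} :=
  measure_function_pushforward__canonical__measure_function_Measure m mf.

Section change_of_variables.
Variable R : realType.
Local Notation leb1 := (@lebesgue_measure R).

Lemma measurable_affine (r c : R) :
  measurable_fun setT (fun x : measurableTypeR R => r * x + c : measurableTypeR R).
Proof. by apply: measurable_funD => //; apply: measurable_funM. Qed.

Lemma lebesgue_affine_gt0 (r c : R) (A : set (measurableTypeR R)) :
  0 < r -> measurable A ->
  (r%:E * leb1 ((fun x => r * x + c)%R @^-1` A))%E = leb1 A.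
Proof.
move=> r0 mA.
pose f := fun x : measurableTypeR R => r * x + c : measurableTypeR R.
have mf : measurable_fun setT f by exact: measurable_affine.
pose mu := mscale (NngNum (ltW r0)) (image_measure leb1 mf).
rewrite -[LHS]/(mu A); apply/esym/lebesgue_measure_unique => //= _ [[a b] _ <-].
rewrite /mu /mscale/= /pushforward.
rewrite (_ : _ @^-1` _ = `](a - c) / r, (b - c) / r]%classic); last first.
  apply/seteqP; split => x /=; rewrite !in_itv/= /f ltr_pdivrMr// ler_pdivlMr//;
    rewrite ltrBlDr lerBrDr [x * r]mulrC //.
rewrite !lebesgue_measure_itv/= !lte_fin ltr_pM2r ?invr_gt0// ltrD2r.
case: ifPn => ab; last by rewrite mule0.
by rewrite -!EFinB -EFinM; congr EFin; field; rewrite gt_eqF.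
Qed.

(** A negative slope is a positive one composed with the reflection, which
    preserves the measure. *)
Lemma lebesgue_affine (r c : R) (A : set (measurableTypeR R)) :
  r != 0 -> measurable A ->
  (`|r|%:E * leb1 ((fun x => r * x + c)%R @^-1` A))%E = leb1 A.
Proof.
move=> r0 mA; have [rpos|rneg|/eqP] := ltrgt0P r; last by rewrite (negbTE r0).
  by rewrite lebesgue_affine_gt0.
have mr : 0 < - r by rewrite oppr_gt0.
rewrite -[RHS](lebesgue_affine_gt0 c mr mA); congr (_ * _)%E.
rewrite -[in RHS]lebesgue_measureN; last first.
  by rewrite -[X in measurable X]setTI; exact: measurable_affine.
rewrite /pushforward -comp_preimage; congr (leb1 _); apply/seteqP.
by split => x /=; rewrite mulrNN.
Qed.

(** Group translations are of this kind: they shift the vertical coordinate, the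
    last one, by a function of the horizontal ones, and these by constants. *)
Definition triangular m (f : 'I_m -> 'rV[R]_m -> R) :=
  forall (i : 'I_m) (v w : 'rV[R]_m), (forall j : 'I_m, (j < i)%N -> v ord0 j = w ord0 j) ->
  f i v = f i w.

Definition triangular_map m (r : 'I_m -> R) (f : 'I_m -> 'rV[R]_m -> R)
  (v : 'rV[R]_m) : 'rV[R]_m := \row_i (r i * v ord0 i + f i v).

Lemma measurable_triangular m (r : 'I_m -> R) (f : 'I_m -> 'rV[R]_m -> R) :
  (forall i, measurable_fun setT (f i)) ->
  measurable_fun setT (triangular_map r f).
Proof.
move=> mf; apply: measurable_fun_rV => i; under eq_fun do rewrite mxE.
apply: measurable_funD => //; apply: measurable_funM => //.
exact: measurable_rV_coord.
Qed.

(** Tonelli, one coordinate at a time: with the first coordinate fixed, the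
    remaining ones undergo a triangular map of dimension one less, and the first
    one an affine map of the line. *)
Lemma lebesgue_triangular m (r : 'I_m -> R) (f : 'I_m -> 'rV[R]_m -> R) (A : set 'rV[R]_m) :
  (forall i, r i != 0) -> (forall i, measurable_fun setT (f i)) ->
  triangular f -> measurable A ->
  ((\prod_i `|r i|)%:E *
   lebesgue_rV R m (triangular_map r f @^-1` A))%E
  = lebesgue_rV R m A.
Proof.
elim: m r f A => [|m IH] r f A r0 mf tf mA.
  rewrite big_ord0 mul1e; congr (lebesgue_rV R 0 _).
  have E v : triangular_map r f v = v by rewrite [LHS]thinmx0 [RHS]thinmx0.
  by apply/seteqP; split => v /=; rewrite E.
have mc := @measurable_cons_rV R m.
pose T := triangular_map r f.
have mT : measurable_fun setT T by exact: measurable_triangular.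
rewrite big_ord_recl /= /lebesgue_cons /pushforward.
have mA' : measurable (@cons_rV R m @^-1` A).
  by rewrite -[X in measurable X]setTI; exact: mc.
have mTA : measurable (@cons_rV R m @^-1` (T @^-1` A)).
  rewrite -[X in measurable X]setTI; apply: mc => //.
  by rewrite -[X in measurable X]setTI; exact: mT.
rewrite /product_measure1.
pose c := f ord0 0.
have fE v : f ord0 v = c by apply: tf.
pose g x := (lebesgue_rV R m (xsection (@cons_rV R m @^-1` A) x)).
have mg : measurable_fun setT g.
  exact: measurable_fun_xsection.
have g0 x : (0 <= g x)%E by exact: measure_ge0.
pose P := (\prod_(i < m) `|r (lift ord0 i)|).
have P0 : 0 <= P by apply: prodr_ge0.
have key x : (P%:E * lebesgue_rV R m (xsection (@cons_rV R m @^-1` (T @^-1` A)) x))%E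
   = g (r ord0 * x + c)%R.
  pose fx (i : 'I_m) (w : 'rV[R]_m) := f (lift ord0 i) (cons_rV (x : measurableTypeR R, w)).
  have mfx i : measurable_fun setT (fx i).
    apply: (measurableT_comp (mf _)); apply: (measurableT_comp mc).
    exact: pair1_measurable.
  have tfx : triangular fx.
    move=> i v w vw; apply: tf => j; rewrite !mxE.
    by case: (unliftP ord0 j) => [k ->|->] //= /ltnSE jk; apply: vw.
  have mX : measurable (xsection (@cons_rV R m @^-1` A) (r ord0 * x + c : measurableTypeR R)).
    exact: measurable_xsection.
  rewrite /g -[RHS](IH (fun i => r (lift ord0 i)) fx _ (fun i => r0 (lift ord0 i)) mfx tfx mX).
  have TE w : T (cons_rV (x : measurableTypeR R, w)) =
    cons_rV ((r ord0 * x + c : measurableTypeR R),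
      triangular_map (fun i => r (lift ord0 i)) fx w).
    apply/rowP => i; rewrite !mxE; case: (unliftP ord0 i) => [k ->|->] /=.
      by rewrite mxE.
    by rewrite fE.
  apply: (congr1 (fun B => _ * lebesgue_rV R m B)%E).
  by apply/seteqP; split => w; rewrite /xsection /= !inE /= TE.
have mh : measurable_fun setT (lebesgue_rV R m \o xsection (@cons_rV R m @^-1` (T @^-1` A))).
  exact: measurable_fun_xsection.
rewrite EFinM -muleA -ge0_integralZl_EFin//.
under eq_integral do rewrite /= key.
have mf0 := @measurable_affine (r ord0) c.
transitivity (\int[mscale (NngNum (normr_ge0 (r ord0)))
  (image_measure leb1 mf0)]_x g x)%E.
  rewrite ge0_integral_mscale//= ge0_integral_pushforward//.
apply: eq_measure_integral => B mB _.
rewrite /mscale/= /pushforward/=.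
exact: lebesgue_affine.
Qed.

End change_of_variables.

(** * The Heisenberg group and its norm *)

Section heisenberg_group.
Variables (R : realType) (n : nat).
Local Notation H := (heis R n).
Implicit Types (x y a b k : H) (r t : R).

Lemma heis_eq x y : hx x = hx y -> hy x = hy y -> ht x = ht y -> x = y.
Proof. by move=> e1 e2 e3; rewrite -(hpointK x) e1 e2 e3 hpointK. Qed.

Lemma dotrC m (v w : 'rV[R]_m) : dotr v w = dotr w v.
Proof. by apply: eq_bigr => i _; rewrite mulrC. Qed.
Lemma dotrDl m (u v w : 'rV[R]_m) : dotr (u + v) w = dotr u w + dotr v w.
Proof. by rewrite -big_split; apply: eq_bigr => i _; rewrite mxE mulrDl. Qed.
Lemma dotrDr m (u v w : 'rV[R]_m) : dotr w (u + v) = dotr w u + dotr w v.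
Proof. by rewrite dotrC dotrDl !(dotrC w). Qed.
Lemma dotrZl m r (v w : 'rV[R]_m) : dotr (r *: v) w = r * dotr v w.
Proof. by rewrite mulr_sumr; apply: eq_bigr => i _; rewrite mxE mulrA. Qed.
Lemma dotrZr m r (v w : 'rV[R]_m) : dotr w (r *: v) = r * dotr w v.
Proof. by rewrite dotrC dotrZl dotrC. Qed.
Lemma dotrNl m (v w : 'rV[R]_m) : dotr (- v) w = - dotr v w.
Proof. by rewrite -scaleN1r dotrZl mulN1r. Qed.
Lemma dotrNr m (v w : 'rV[R]_m) : dotr w (- v) = - dotr w v.
Proof. by rewrite dotrC dotrNl dotrC. Qed.
Lemma dotr_ge0 m (v : 'rV[R]_m) : 0 <= dotr v v.
Proof. by apply: sumr_ge0 => i _; rewrite -expr2 sqr_ge0. Qed.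
Lemma dotr_coord m (v : 'rV[R]_m) i : v ord0 i ^+ 2 <= dotr v v.
Proof.
rewrite /dotr (bigD1 i)//= expr2 lerDl; apply: sumr_ge0 => j _.
by rewrite -expr2 sqr_ge0.
Qed.
Lemma dotr0 m (w : 'rV[R]_m) : dotr 0 w = 0.
Proof. by rewrite -(scale0r 0) dotrZl mul0r. Qed.

Lemma hxD x y : hx (x + y) = hx x + hx y. Proof. by rewrite /hx /hz !linearD. Qed.
Lemma hyD x y : hy (x + y) = hy x + hy y. Proof. by rewrite /hy /hz !linearD. Qed.
Lemma hxZ r x : hx (r *: x) = r *: hx x. Proof. by rewrite /hx /hz !linearZ. Qed.
Lemma hyZ r x : hy (r *: x) = r *: hy x. Proof. by rewrite /hy /hz !linearZ. Qed.
Lemma htZ r x : ht (r *: x) = r * ht x. Proof. by rewrite /ht linearZ mxE. Qed.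
Lemma hxN x : hx (- x) = - hx x. Proof. by rewrite -scaleN1r hxZ scaleN1r. Qed.
Lemma hyN x : hy (- x) = - hy x. Proof. by rewrite -scaleN1r hyZ scaleN1r. Qed.
Lemma htN x : ht (- x) = - ht x. Proof. by rewrite -scaleN1r htZ mulN1r. Qed.
Lemma hx0 : hx (0 : H) = 0. Proof. by rewrite -(scale0r 0) hxZ scale0r. Qed.
Lemma hy0 : hy (0 : H) = 0. Proof. by rewrite -(scale0r 0) hyZ scale0r. Qed.
Lemma ht0 : ht (0 : H) = 0. Proof. by rewrite -(scale0r 0) htZ mul0r. Qed.

Definition hprod := (hx_hpoint, hy_hpoint, ht_hpoint).

Lemma hxM x y : hx (hmul x y) = hx x + hx y. Proof. by rewrite hprod. Qed.
Lemma hyM x y : hy (hmul x y) = hy x + hy y. Proof. by rewrite hprod. Qed.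

(** hdot + i hsymp is the Hermitian product of the horizontal parts, seen in
    C^n, and 2 hsymp is the cocycle of the group law. *)
Definition hsymp x y : R := dotr (hy x) (hx y) - dotr (hx x) (hy y).
Definition hdot x y : R := dotr (hx x) (hx y) + dotr (hy x) (hy y).

Lemma htM x y : ht (hmul x y) = ht x + ht y + 2 * hsymp x y.
Proof. by rewrite hprod /hsymp mulrBr addrA. Qed.

Lemma hmulA x y a : hmul x (hmul y a) = hmul (hmul x y) a.
Proof.
apply: heis_eq; rewrite ?hxM ?hyM ?htM ?addrA//.
by rewrite /hsymp !(hxM, hyM, dotrDl, dotrDr); ring.
Qed.

Lemma hmul0 x : hmul x 0 = x.
Proof.
apply: heis_eq; rewrite ?hxM ?hyM ?htM ?hx0 ?hy0 ?ht0 ?addr0//.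
by rewrite /hsymp hx0 hy0 !(dotrC _ 0) !dotr0; ring.
Qed.

Lemma hmul0l x : hmul 0 x = x.
Proof.
apply: heis_eq; rewrite ?hxM ?hyM ?htM ?hx0 ?hy0 ?ht0 ?add0r//.
by rewrite /hsymp hx0 hy0 !dotr0; ring.
Qed.

Lemma hinvK x : hinv (hinv x) = x. Proof. exact: opprK. Qed.
Lemma hmulVr x : hmul x (hinv x) = 0.
Proof. by rewrite -{1}(hinvK x) hmulV. Qed.
Lemma hmulKl x y : hmul (hinv x) (hmul x y) = y.
Proof. by rewrite hmulA hmulV hmul0l. Qed.
Lemma hmulVKl x y : hmul x (hmul (hinv x) y) = y.
Proof. by rewrite hmulA hmulVr hmul0l. Qed.
Lemma hmulKr x y : hmul (hmul y x) (hinv x) = y.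
Proof. by rewrite -hmulA hmulVr hmul0. Qed.
Lemma hmulVKr x y : hmul (hmul y (hinv x)) x = y.
Proof. by rewrite -hmulA hmulV hmul0. Qed.

Lemma hinvM x y : hinv (hmul x y) = hmul (hinv y) (hinv x).
Proof.
by rewrite -[RHS](hmulKr (hmul x y)) hmulA hmulVKr hmulV hmul0l.
Qed.

Lemma hinv0 : hinv (0 : H) = 0. Proof. exact: oppr0. Qed.

Definition hdil r x : H := hpoint (r *: hx x) (r *: hy x) (r ^+ 2 * ht x).

Lemma hdilM r x y : hdil r (hmul x y) = hmul (hdil r x) (hdil r y).
Proof.
apply: heis_eq; rewrite ?hxM ?hyM ?htM ?hprod ?hxM ?hyM ?htM ?scalerDr//.
by rewrite /hsymp !hprod !(dotrZl, dotrZr); ring.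
Qed.

Lemma hdilA r t x : hdil r (hdil t x) = hdil (r * t) x.
Proof.
apply: heis_eq; rewrite !hprod ?scalerA//; ring.
Qed.

Lemma hdil1 x : hdil 1 x = x.
Proof. by apply: heis_eq; rewrite !hprod ?scale1r// expr1n mul1r. Qed.

Definition hzsq x : R := hdot x x.

Lemma hzsq_ge0 x : 0 <= hzsq x.
Proof. by rewrite addr_ge0 ?dotr_ge0. Qed.

Lemma hzsq_comb r t x y :
  hzsq (r *: x + t *: y) = r ^+ 2 * hzsq x + 2 * r * t * hdot x y + t ^+ 2 * hzsq y.
Proof.
rewrite /hzsq /hdot !(hxD, hyD, hxZ, hyZ, dotrDl, dotrDr, dotrZl, dotrZr).
by rewrite (dotrC (hx y) (hx x)) (dotrC (hy y) (hy x)); ring.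
Qed.

(** Cauchy-Schwarz, by evaluating the nonnegative square of a combination of x
    and y. *)
Lemma hdot_le x y : hdot x y ^+ 2 <= hzsq x * hzsq y.
Proof.
have [y0|y0] := eqVneq (hzsq y) 0.
  rewrite y0 mulr0; have [->|d0] := eqVneq (hdot x y) 0; first by rewrite expr0n.
  have := hzsq_ge0 (1 *: x + (- (hzsq x + 1) / (2 * hdot x y)) *: y).
  rewrite hzsq_comb y0 mulr0 addr0.
  have -> : 1 ^+ 2 * hzsq x + 2 * 1 * (- (hzsq x + 1) / (2 * hdot x y)) * hdot x y
    = -1 by field.
  by rewrite ler0N1.
have y1 : 0 < hzsq y by rewrite lt_neqAle eq_sym y0 hzsq_ge0.
have := hzsq_ge0 (hzsq y *: x + (- hdot x y) *: y).
rewrite hzsq_comb => h; rewrite -subr_ge0 -(pmulr_rge0 _ y1).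
by apply: le_trans h _; rewrite le_eqVlt; apply/orP; left; apply/eqP; ring.
Qed.

(** Multiplication by i on the horizontal part; it turns hsymp into hdot. *)
Let hJ x : H := hpoint (- hy x) (hx x) 0.

(** Cauchy-Schwarz for the Hermitian product hdot + i hsymp: the bound for hdot
    is applied to x and to the combination of y and i y with coefficients hdot x
    y and hsymp x y. *)
Lemma hdot_hsymp_le x y : hdot x y ^+ 2 + hsymp x y ^+ 2 <= hzsq x * hzsq y.
Proof.
have [e0|e0] := eqVneq (hdot x y ^+ 2 + hsymp x y ^+ 2) 0.
  by rewrite e0 mulr_ge0 ?hzsq_ge0.
have e1 : 0 < hdot x y ^+ 2 + hsymp x y ^+ 2.
  by rewrite lt_neqAle eq_sym e0 addr_ge0 ?sqr_ge0.
rewrite -(ler_pM2r e1).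
have := hdot_le x (hdot x y *: y + hsymp x y *: hJ y).
rewrite hzsq_comb.
have -> : hdot y (hJ y) = 0.
  by rewrite /hdot !hprod dotrNr dotrC subrr0 || rewrite /hdot !hprod dotrNr dotrC addNr.
have -> : hzsq (hJ y) = hzsq y.
  by rewrite /hzsq /hdot !hprod dotrNl dotrNr opprK addrC.
have -> : hdot x (hdot x y *: y + hsymp x y *: hJ y) = hdot x y ^+ 2 + hsymp x y ^+ 2.
  rewrite {1}/hdot !(hxD, hyD, hxZ, hyZ, hprod, dotrDr, dotrZr, dotrNr).
  by rewrite /hdot /hsymp; ring.
move=> h; rewrite -expr2; apply: le_trans h _.
by rewrite le_eqVlt; apply/orP; left; apply/eqP; ring.
Qed.

Lemma hzsqM x y : hzsq (hmul x y) = hzsq x + 2 * hdot x y + hzsq y.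
Proof.
rewrite /hzsq /hdot !(hxM, hyM, dotrDl, dotrDr).
by rewrite (dotrC (hx y) (hx x)) (dotrC (hy y) (hy x)); ring.
Qed.

(** Unlike the norm, its fourth power is a polynomial; all comparisons of norms
    are made on it. *)
Definition hnorm4 x : R := hzsq x ^+ 2 + ht x ^+ 2.

Lemma hnorm4_ge0 x : 0 <= hnorm4 x.
Proof. by rewrite addr_ge0 ?sqr_ge0. Qed.

Lemma dotr_hz x : dotr (hz x) (hz x) = hzsq x.
Proof.
rewrite /hzsq /hdot /hx /hy -{1 2}(hsubmxK (hz x)) /dotr big_split_ord /=.
by congr (_ + _); apply: eq_bigr => i _; rewrite ?row_mxEl ?row_mxEr.
Qed.

Lemma hnormE x : hnorm x = hnorm4 x `^ 4^-1.
Proof. by rewrite /hnorm dotr_hz. Qed.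

Lemma hnorm_ge0 x : 0 <= hnorm x.
Proof. exact: powR_ge0. Qed.

Lemma hnorm_exp4 x : hnorm x ^+ 4 = hnorm4 x.
Proof.
by rewrite hnormE -powR_mulrn ?powR_ge0// -powRrM mulVf// powRr1// hnorm4_ge0.
Qed.

Lemma hnorm_le r x : 0 <= r -> (hnorm x <= r) = (hnorm4 x <= r ^+ 4).
Proof. by move=> r0; rewrite -hnorm_exp4 ler_pXn2r// nnegrE// hnorm_ge0. Qed.

Lemma hnorm_lt r x : 0 <= r -> (hnorm x < r) = (hnorm4 x < r ^+ 4).
Proof. by move=> r0; rewrite -hnorm_exp4 ltr_pXn2r// nnegrE// hnorm_ge0. Qed.

Lemma hnormV x : hnorm (hinv x) = hnorm x.
Proof.
by rewrite !hnormE /hnorm4 /hzsq /hdot /hinv !(hxN, hyN, htN, dotrNl, dotrNr, opprK, sqrrN).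
Qed.

Lemma hnorm4V x : hnorm4 (hinv x) = hnorm4 x.
Proof. by rewrite -!hnorm_exp4 hnormV. Qed.

Lemma hzsq_hdil r x : hzsq (hdil r x) = r ^+ 2 * hzsq x.
Proof. by rewrite /hzsq /hdot !hprod !(dotrZl, dotrZr); ring. Qed.

Lemma hnorm4_hdil r x : hnorm4 (hdil r x) = r ^+ 4 * hnorm4 x.
Proof. by rewrite /hnorm4 hzsq_hdil !hprod; ring. Qed.

Lemma hnorm_hdil r x : 0 <= r -> hnorm (hdil r x) = r * hnorm x.
Proof.
move=> r0; apply/eqP; rewrite -(@eqrXn2 _ 4)// ?hnorm_ge0 ?mulr_ge0 ?hnorm_ge0//.
by rewrite exprMn !hnorm_exp4 hnorm4_hdil.
Qed.

Lemma hzsq_le x : hzsq x <= hnorm x ^+ 2.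
Proof.
rewrite -(@ler_pXn2r _ 2) ?nnegrE ?hzsq_ge0 ?sqr_ge0//.
by rewrite -exprM hnorm_exp4 lerDl sqr_ge0.
Qed.

Lemma ht_le x : `|ht x| <= hnorm x ^+ 2.
Proof.
rewrite -(@ler_pXn2r _ 2) ?nnegrE ?sqr_ge0//.
by rewrite real_normK ?num_real// -exprM hnorm_exp4 lerDr sqr_ge0.
Qed.

Lemma hnorm0 : hnorm (0 : H) = 0.
Proof.
rewrite hnormE (_ : hnorm4 _ = 0) ?powR0 ?invr_eq0//.
by rewrite /hnorm4 /hzsq /hdot hx0 hy0 ht0 !dotr0 addr0 expr0n addr0.
Qed.

Lemma dotr_eq0 m (v : 'rV[R]_m) : dotr v v <= 0 -> v = 0.
Proof.
move=> h; apply/rowP => i; rewrite mxE; apply/eqP.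
by rewrite -sqrf_eq0 eq_le sqr_ge0 andbT (le_trans (dotr_coord _ _) h).
Qed.

Lemma hnorm_eq0 x : hnorm x = 0 -> x = 0.
Proof.
move=> h; have z0 := hzsq_le x; have t0 := ht_le x.
rewrite h expr0n /= in z0 t0.
have zx := dotr_ge0 (hx x); have zy := dotr_ge0 (hy x).
apply: heis_eq; rewrite ?hx0 ?hy0 ?ht0.
- by apply: dotr_eq0; apply: le_trans z0; rewrite lerDl.
- by apply: dotr_eq0; apply: le_trans z0; rewrite lerDr.
- by apply/eqP; rewrite -normr_le0.
Qed.

(** Cygan's inequality. Expanding |x y|^4, the mixed terms are bounded by
    Cauchy-Schwarz for complex numbers |z|^2 + i t of modulus |x|^2 and for hdot
    + i hsymp, and the bounds add up to the expansion of (|x| + |y|)^4. *)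
Lemma hnorm_triangle x y : hnorm (hmul x y) <= hnorm x + hnorm y.
Proof.
have nx := hnorm_ge0 x; have ny := hnorm_ge0 y.
rewrite hnorm_le ?addr_ge0// /hnorm4 hzsqM htM.
have ex := hnorm_exp4 x; have ey := hnorm_exp4 y.
have zx := hzsq_le x; have zy := hzsq_le y.
have cs := hdot_hsymp_le x y.
have [x0 y0] := (hzsq_ge0 x, hzsq_ge0 y).
rewrite /hnorm4 in ex ey.
set X := hnorm x in ex zx nx *; set Y := hnorm y in ey zy ny *.
set p := hzsq x in ex zx cs x0 *; set q := hzsq y in ey zy cs y0 *.
set u := ht x in ex *; set v := ht y in ey *.
set d := hdot x y in cs *; set w := hsymp x y in cs *.
(* X^4 = p^2 + u^2 is the square of the modulus of p + i u *)
have c1 : (p * q + u * v) <= X ^+ 2 * Y ^+ 2.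
  rewrite (le_trans (ler_norm _))//.
  rewrite -(@ler_pXn2r _ 2) ?nnegrE ?mulr_ge0 ?sqr_ge0//.
  rewrite real_normK ?num_real// exprMn -!exprM ex ey.
  have := sqr_ge0 (p * v - q * u); nra.
have c2 : p * d + u * w <= X ^+ 2 * (X * Y).
  rewrite (le_trans (ler_norm _))//.
  rewrite -(@ler_pXn2r _ 2) ?nnegrE ?mulr_ge0 ?sqr_ge0//.
  rewrite real_normK ?num_real// exprMn -!exprM ex exprMn.
  apply: (@le_trans _ _ ((p ^+ 2 + u ^+ 2) * (d ^+ 2 + w ^+ 2))).
    have := sqr_ge0 (p * w - d * u); nra.
  apply: ler_wpM2l; first by rewrite addr_ge0 ?sqr_ge0.
  by apply: le_trans cs _; apply: ler_pM.
have c3 : q * d + v * w <= Y ^+ 2 * (X * Y).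
  rewrite (le_trans (ler_norm _))//.
  rewrite -(@ler_pXn2r _ 2) ?nnegrE ?mulr_ge0 ?sqr_ge0//.
  rewrite real_normK ?num_real// exprMn -!exprM ey exprMn.
  apply: (@le_trans _ _ ((q ^+ 2 + v ^+ 2) * (d ^+ 2 + w ^+ 2))).
    have := sqr_ge0 (q * w - d * v); nra.
  apply: ler_wpM2l; first by rewrite addr_ge0 ?sqr_ge0.
  by apply: le_trans cs _; apply: ler_pM.
have c4 : d ^+ 2 + w ^+ 2 <= X ^+ 2 * Y ^+ 2.
  by apply: le_trans cs _; apply: ler_pM.
have -> : (p + 2 * d + q) ^+ 2 + (u + v + 2 * w) ^+ 2 =
  (p ^+ 2 + u ^+ 2) + (q ^+ 2 + v ^+ 2) + 2 * (p * q + u * v)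
  + 4 * (p * d + u * w) + 4 * (q * d + v * w) + 4 * (d ^+ 2 + w ^+ 2) by ring.
rewrite -ex -ey.
have -> : (X + Y) ^+ 4 = X ^+ 4 + Y ^+ 4 + 2 * (X ^+ 2 * Y ^+ 2)
  + 4 * (X ^+ 2 * (X * Y)) + 4 * (Y ^+ 2 * (X * Y)) + 4 * (X ^+ 2 * Y ^+ 2) by ring.
lra.
Qed.

End heisenberg_group.

(** * Invariance of Lebesgue measure *)

Section heisenberg_measurability.
Variables (R : realType) (n : nat).
Local Notation H := (heis R n).
Context d (T : measurableType d).
Implicit Types (f g : T -> H) (h : T -> R).

Lemma measurable_heis f :
  measurable_fun setT (fun x => hx (f x)) -> measurable_fun setT (fun x => hy (f x)) ->
  measurable_fun setT (fun x => ht (f x)) -> measurable_fun setT f.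
Proof.
move=> m1 m2 m3; rewrite (_ : f = fun x => hpoint (hx (f x)) (hy (f x)) (ht (f x))).
  apply: measurable_row_mx; first exact: measurable_row_mx.
  by apply: measurable_fun_rV => i; rewrite [i]ord1; under eq_fun do rewrite mxE eqxx mulr1n.
by apply/funext => x; rewrite hpointK.
Qed.

Lemma measurable_rV_add m (f g : T -> 'rV[R]_m) :
  measurable_fun setT f -> measurable_fun setT g -> measurable_fun setT (fun x => f x + g x).
Proof.
move=> mf mg; apply: measurable_fun_rV => i; under eq_fun do rewrite mxE.
by apply: measurable_funD; apply: (measurableT_comp (measurable_rV_coord i)).
Qed.

Lemma measurable_rV_scale m (c : R) (f : T -> 'rV[R]_m) :
  measurable_fun setT f -> measurable_fun setT (fun x => c *: f x).
Proof.
move=> mf; apply: measurable_fun_rV => i; under eq_fun do rewrite mxE.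
by apply: measurable_funM => //; apply: (measurableT_comp (measurable_rV_coord i)).
Qed.

Lemma measurable_hmul f g : measurable_fun setT f -> measurable_fun setT g ->
  measurable_fun setT (fun x => hmul (f x) (g x)).
Proof.
move=> mf mg; have mhx := @measurable_hx R n; have mhy := @measurable_hy R n.
have mht := @measurable_ht R n.
have mc (k : H -> 'rV[R]_n) : measurable_fun setT k ->
   measurable_fun setT (fun x => k (f x)) /\ measurable_fun setT (fun x => k (g x)).
  by move=> mk; split; apply: (measurableT_comp mk).
have [? ?] := mc _ mhx; have [? ?] := mc _ mhy.
apply: measurable_heis.
- by under eq_fun do rewrite hxM; exact: measurable_rV_add.
- by under eq_fun do rewrite hyM; exact: measurable_rV_add.
- under eq_fun do rewrite htM; apply: measurable_funD.
    by apply: measurable_funD; apply: (measurableT_comp mht).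
  by apply: measurable_funM => //; apply: measurable_funB; apply: measurable_dotr.
Qed.

Lemma measurable_hinv f : measurable_fun setT f -> measurable_fun setT (fun x => hinv (f x)).
Proof.
move=> mf; under eq_fun do rewrite /hinv -scaleN1r; exact: measurable_rV_scale.
Qed.

Lemma measurable_hdil r f : measurable_fun setT f -> measurable_fun setT (fun x => hdil r (f x)).
Proof.
move=> mf; apply: measurable_heis.
- under eq_fun do rewrite hx_hpoint; apply: measurable_rV_scale.
  exact: (measurableT_comp (@measurable_hx R n)).
- under eq_fun do rewrite hy_hpoint; apply: measurable_rV_scale.
  exact: (measurableT_comp (@measurable_hy R n)).
- under eq_fun do rewrite ht_hpoint; apply: measurable_funM => //.
  exact: (measurableT_comp (@measurable_ht R n)).
Qed.

Lemma measurable_hnorm_comp f : measurable_fun setT f ->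
  measurable_fun setT (fun x => hnorm (f x)).
Proof. exact: (measurableT_comp (@measurable_hnorm R n)). Qed.

Lemma measurable_hnorm4 f : measurable_fun setT f ->
  measurable_fun setT (fun x => hnorm4 (f x)).
Proof.
move=> mf; under eq_fun do rewrite -hnorm_exp4.
by apply: measurable_funX; exact: measurable_hnorm_comp.
Qed.

End heisenberg_measurability.

Section haar.
Variables (R : realType) (n : nat).
Local Notation H := (heis R n).
Local Notation leb := (lebesgue_rV R (n + n + 1)).

(** Translations, inversion and dilations are of this kind, and so are their
    compositions; every substitution below is one of these. *)
Definition scales_leb (J : R) (T : H -> H) :=
  [/\ 0 < J, measurable_fun setT T &
    forall A, measurable A -> (J%:E * leb (T @^-1` A))%E = leb A].

(** Such a map is triangular, the vertical coordinate being the last one. *)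
Lemma scales_leb_affine (a b : R) (c : 'rV[R]_(n + n)) (g : 'rV[R]_(n + n) -> R)
    (T : H -> H) :
  a != 0 -> b != 0 -> measurable_fun setT T ->
  (forall x, hz (T x) = a *: hz x + c) -> (forall x, ht (T x) = b * ht x + g (hz x)) ->
  scales_leb (`|a| ^+ (n + n) * `|b|) T.
Proof.
move=> a0 b0 mT Tz Tt.
split=> //; first by rewrite mulr_gt0 ?exprn_gt0 ?normr_gt0.
move=> A mA.
pose r (i : 'I_(n + n + 1)) := if (i < n + n)%N then a else b.
pose f (i : 'I_(n + n + 1)) (v : H) := T v ord0 i - r i * v ord0 i.
have mf i : measurable_fun setT (f i).
  apply: measurable_funB; first exact: (measurableT_comp (measurable_rV_coord i)).
  by apply: measurable_funM => //; exact: measurable_rV_coord.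
have fl (j : 'I_(n + n)) v : f (lshift 1 j) v = c ord0 j.
  have := congr1 (fun w : 'rV_(n + n) => w ord0 j) (Tz v).
  by rewrite /hz !mxE /f /r /= ltn_ord => ->; rewrite addrAC subrr add0r.
have fr (j : 'I_1) v : f (rshift (n + n) j) v = g (hz v).
  have := Tt v; rewrite /ht !mxE /f /r /= (ord1 j) => ->.
  by rewrite ltnNge leq_addr /= addrAC subrr add0r.
have tf : triangular f.
  move=> i; have [j ->|j ->] := split_ordP i => v w vw; first by rewrite !fl.
  rewrite !fr; congr g; apply/rowP => k; rewrite /hz !mxE; apply: vw => /=.
  by rewrite ltn_addr.
have r0 i : r i != 0 by rewrite /r; case: ifP.
have := lebesgue_triangular r0 mf tf mA.
have -> : triangular_map r f = T.
  by apply/funext => v; apply/rowP => i; rewrite mxE /f addrC subrK.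
suff -> : \prod_i `|r i| = `|a| ^+ (n + n) * `|b| by [].
rewrite big_split_ord /= big_ord1; congr (_ * _).
  rewrite (eq_bigr (fun=> `|a|)) ?prodr_const ?card_ord// => i _.
  by rewrite /r /= ltn_ord.
by rewrite /r /= ltnNge leq_addr.
Qed.

Lemma hz_hpoint (x y : 'rV[R]_n) (t : R) : hz (hpoint x y t) = row_mx x y.
Proof. by rewrite /hz row_mxKl. Qed.

Lemma hzE (x : H) : hz x = row_mx (hx x) (hy x).
Proof. by rewrite -{1}(hpointK x) hz_hpoint. Qed.

Lemma scales_hmull (a : H) : scales_leb 1 (hmul a).
Proof.
have -> : (1 : R) = `|1| ^+ (n + n) * `|1| by rewrite normr1 expr1n mulr1.
apply: (@scales_leb_affine 1 1 (hz a)
   (fun z => ht a + 2 * (dotr (hy a) (lsubmx z) - dotr (hx a) (rsubmx z)))) => //.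
- exact: (@measurable_hmul _ _ _ _ (cst a) id).
- by move=> x; rewrite scale1r hz_hpoint !hzE add_row_mx addrC [hy _ + _]addrC.
- by move=> x; rewrite htM mul1r /hsymp /hx /hy [ht a + _]addrC -addrA.
Qed.

Lemma scales_hmulr (a : H) : scales_leb 1 (fun x => hmul x a).
Proof.
have -> : (1 : R) = `|1| ^+ (n + n) * `|1| by rewrite normr1 expr1n mulr1.
apply: (@scales_leb_affine 1 1 (hz a)
   (fun z => ht a + 2 * (dotr (rsubmx z) (hx a) - dotr (lsubmx z) (hy a)))) => //.
- exact: (@measurable_hmul _ _ _ _ id (cst a)).
- by move=> x; rewrite scale1r hz_hpoint !hzE add_row_mx.
- by move=> x; rewrite htM mul1r /hsymp /hx /hy addrA.
Qed.

Lemma scales_hinv : scales_leb 1 (@hinv R n).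
Proof.
have -> : (1 : R) = `|-1| ^+ (n + n) * `|-1| by rewrite normrN1 expr1n mulr1.
apply: (@scales_leb_affine (-1) (-1) 0 (fun=> 0)); rewrite ?oppr_eq0//.
- exact: (@measurable_hinv _ _ _ _ id).
- by move=> x; rewrite addr0 scaleN1r /hz linearN.
- by move=> x; rewrite addr0 mulN1r /hinv htN.
Qed.

Lemma scales_hdil r : 0 < r -> scales_leb (r ^+ hdim n) (@hdil R n r).
Proof.
move=> r0.
have -> : r ^+ hdim n = `|r| ^+ (n + n) * `|r ^+ 2|.
  by rewrite !gtr0_norm ?exprn_gt0// -exprD /hdim mul2n addnn.
apply: (@scales_leb_affine _ _ 0 (fun=> 0)); rewrite ?expf_eq0 ?gt_eqF//.
- exact: (@measurable_hdil _ _ _ _ _ id).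
- by move=> x; rewrite addr0 hz_hpoint hzE scale_row_mx.
- by move=> x; rewrite addr0 ht_hpoint.
Qed.

Lemma scales_comp J1 J2 T1 T2 :
  scales_leb J1 T1 -> scales_leb J2 T2 -> scales_leb (J1 * J2) (T1 \o T2).
Proof.
move=> [j1 m1 h1] [j2 m2 h2]; split; first exact: mulr_gt0.
  exact: (measurableT_comp m1).
move=> A mA; rewrite comp_preimage EFinM -muleA h2 ?h1//.
by rewrite -[X in measurable X]setTI; exact: m1.
Qed.

Lemma ge0_integral_scales J T (f : H -> \bar R) : scales_leb J T ->
  measurable_fun setT f -> (forall x, 0 <= f x)%E ->
  (\int[leb]_x f x = J%:E * \int[leb]_x f (T x))%E.
Proof.
move=> [J0 mT h] mf f0.
transitivity (\int[mscale (NngNum (ltW J0)) (image_measure leb mT)]_x f x)%E.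
  by apply: eq_measure_integral => A mA _; exact/esym/h.
by rewrite ge0_integral_mscale//= ge0_integral_pushforward.
Qed.

Lemma integrable_scales J T (f : H -> R) : scales_leb J T ->
  leb.-integrable setT (EFin \o f) -> leb.-integrable setT (EFin \o (f \o T)).
Proof.
move=> sT /integrableP[mf fi].
have [J0 mT h] := sT; apply/integrableP; split.
  exact: (measurableT_comp mf).
have mabs : measurable_fun setT (abse \o (EFin \o f)) by exact: measurableT_comp.
have E := ge0_integral_scales sT mabs (fun=> abse_ge0 _).
rewrite /= in E fi *; rewrite E in fi.
by case: (\int[_]_x _)%E fi => [r|//|] ;rewrite ?ltry ?gt0_muley ?lte_fin.
Qed.

End haar.

(** * The kernel and its truncation *)

Lemma integral_indicM d (T : measurableType d) (R : realType)
    (mu : {measure set T -> \bar R}) (A : set T) (f : T -> R) :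
  (\int[mu]_(x in A) (f x)%:E = \int[mu]_x (f x * \1_A x)%:E)%E.
Proof.
rewrite integral_mkcond; apply: eq_integral => x _; rewrite patchE indicE.
by case: ifPn; rewrite (mulr1, mulr0).
Qed.

Section homogeneous_kernels.
Variables (R : realType) (n : nat).
Local Notation H := (heis R n).
Local Notation leb := (lebesgue_rV R (n + n + 1)).
Local Notation Q := (hdim n).

(** A function homogeneous under the dilation by lam has integrals over
    successive shells in geometric progression of ratio q. The sets D j exhaust
    the domain, and D j.+1 is covered by one shell A and the dilate of D j, so
    the bound K / (1 - q) is stable under j. *)
Lemma integral_homogeneous_le (f : H -> R) (lam q K : R) (A : set H) (D : (set H)^nat) :
  measurable_fun setT f -> (forall k, 0 <= f k) -> 0 < lam -> 0 <= q < 1 ->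
  (forall k, lam ^+ Q * f (hdil lam k) = q * f k) ->
  measurable A -> (forall j, measurable (D j)) -> D 0%N = set0 ->
  nondecreasing_seq D ->
  (forall j k, D j.+1 k -> A k \/ D j (hdil lam^-1 k)) ->
  (\int[leb]_(k in A) (f k)%:E <= K%:E)%E ->
  (\int[leb]_(k in \bigcup_j D j) (f k)%:E <= (K / (1 - q))%:E)%E.
Proof.
move=> mf f0 lam0 /andP[q0 q1] hf mA mD D0 ndD DS intA.
have K0 : 0 <= K.
  by rewrite -lee_fin (le_trans _ intA)// integral_ge0// => k _; rewrite lee_fin.
have mfD B : measurable B -> measurable_fun setT (fun k => (f k * \1_B k)%:E).
  by move=> mB; apply/measurable_EFinP; apply: measurable_funM.
have step j : (\int[leb]_(k in D j) (f k)%:E <= (K / (1 - q))%:E)%E.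
  elim: j => [|j IH]; first by rewrite D0 integral_set0 lee_fin divr_ge0// subr_ge0 ltW.
  pose g k := f k * \1_(D j) (hdil lam^-1 k).
  have mg : measurable_fun setT (fun k => (g k)%:E).
    apply/measurable_EFinP; apply: measurable_funM => //.
    apply: (measurableT_comp (measurable_indic (mD j))).
    exact: (@measurable_hdil _ _ _ _ _ id).
  have g0 k : 0 <= g k by rewrite mulr_ge0.
  have -> : (K / (1 - q))%:E = (K%:E + q%:E * (K / (1 - q))%:E)%E.
    by rewrite -EFinM -EFinD; congr EFin; field; rewrite gt_eqF// subr_gt0.
  rewrite integral_indicM.
  apply: (@le_trans _ _ (\int[leb]_k ((f k * \1_A k)%:E + (g k)%:E))%E).
    apply: ge0_le_integral => //.
    - by move=> k _; rewrite lee_fin mulr_ge0.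
    - exact: mfD.
    - by apply: emeasurable_funD => //; exact: mfD.
    - move=> k _; rewrite -EFinD lee_fin /g !indicE -mulrDr ler_wpM2l//.
      have [kD|] := boolP (k \in D j.+1); last by rewrite addr_ge0.
      move: kD; rewrite inE => /DS[kA|kD].
        by rewrite mem_set//= lerDl.
      by rewrite (mem_set kD) lerDr.
  rewrite ge0_integralD//=; try exact: mfD; try by move=> k _; rewrite lee_fin ?mulr_ge0.
  rewrite -integral_indicM leeD//.
  rewrite (ge0_integral_scales (scales_hdil n lam0))//;
    try by move=> k; rewrite lee_fin.
  have mgd : measurable_fun setT (fun k => (g (hdil lam k))%:E).
    by apply: (measurableT_comp mg); exact: (@measurable_hdil _ _ _ _ _ id).
  rewrite -ge0_integralZl_EFin ?exprn_ge0 ?(ltW lam0)//=;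
    try by move=> k _; rewrite lee_fin.
  rewrite (eq_integral (fun k => q%:E * (f k * \1_(D j) k)%:E)%E).
    rewrite ge0_integralZl_EFin//; try by move=> k _; rewrite lee_fin mulr_ge0.
      by rewrite -integral_indicM lee_wpmul2l// lee_fin.
    exact: mfD.
  move=> k _; rewrite -!EFinM /g hdilA mulVf ?gt_eqF// hdil1 mulrA hf.
  by rewrite mulrA.
have cv : (\int[leb]_(k in D j) (f k)%:E)%E @[j --> \oo] -->
    (\int[leb]_(k in \bigcup_j D j) (f k)%:E)%E.
  apply: ge0_nondecreasing_set_cvg_integral => // [j|j x _].
    by apply/measurable_EFinP; exact: measurable_funTS.
  by rewrite lee_fin.
rewrite -(cvg_lim _ cv)//; apply: lime_le; first exact: cvgP cv.
by near=> j; exact: step.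
Unshelve. all: by end_near.
Qed.


(** Horizontal coordinates are at most r, which r >= 1 turns into the bound r^2
    of the vertical one. *)
Lemma hcoord_le (x : H) (r : R) i : 1 <= r -> hnorm x <= r -> `|x ord0 i| <= r ^+ 2.
Proof.
move=> r1 xr; have r0 : 0 <= r by apply: le_trans r1.
have xr2 : hnorm x ^+ 2 <= r ^+ 2 by rewrite ler_pXn2r ?nnegrE ?hnorm_ge0.
have [j ->|j ->] := split_ordP i; last first.
  have -> : x ord0 (rshift (n + n) j) = ht x by rewrite /ht mxE (ord1 j).
  exact: le_trans (ht_le x) xr2.
have -> : x ord0 (lshift 1 j) = hz x ord0 j by rewrite /hz mxE.
rewrite (@le_trans _ _ r)//; last by rewrite expr2 ler_peMl.
rewrite -(@ler_pXn2r _ 2) ?nnegrE// real_normK ?num_real//.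
rewrite (le_trans (dotr_coord _ _))// dotr_hz (le_trans (hzsq_le x))//.
Qed.

Definition hb (a : R) : set H := [set k | hnorm k < a].

Lemma measurable_hb a : measurable (hb a).
Proof.
rewrite -[X in measurable X]setTI; apply: (@measurable_fun_ltr _ _ _ setT _ (cst a)) => //.
exact: (@measurable_hnorm R n).
Qed.

Lemma hb_scale a : 0 < a -> leb (hb a) = ((a ^+ Q)%:E * leb (hb 1))%E.
Proof.
move=> a0; have [_ _ h] := scales_hdil n a0.
rewrite -(h _ (measurable_hb a)); congr (_ * leb _)%E.
apply/seteqP; split => k; rewrite /hb/= hnorm_hdil ?(ltW a0)//.
  by rewrite -{2}(mulr1 a) ltr_pM2l.
by move=> k1; rewrite -{2}(mulr1 a) ltr_pM2l.
Qed.

Lemma hb1_lty : (leb (hb 1) < +oo)%E.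
Proof.
pose A (i : 'I_(n + n + 1)) : set R := `[(-1), 1]%classic.
have mA i : measurable (A i) by exact: measurable_itv.
apply: (@le_lt_trans _ _ (leb [set v | forall i, A i (v ord0 i)])).
  apply: le_measure; rewrite ?inE; [exact: measurable_hb|exact: measurable_rV_box|].
  move=> k /ltW k1 i; have := hcoord_le i (lexx 1) k1.
  by rewrite expr1n ler_norml /A /= in_itv.
rewrite lebesgue_rV_box//.
rewrite (eq_bigr (fun=> 2%:E)); last first.
  move=> i _; rewrite /A lebesgue_measure_itv/= lte_fin ifT ?ltrNl; last by lra.
  by rewrite -EFinB opprK.
have /fin_numPlt/andP[]// : (\prod_(i < n + n + 1) 2%:E)%E \is a @fin_num R.
by elim/big_ind : _ => // x y; exact: fin_numM.
Qed.

(** The unit ball contains a small cube. *)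
Lemma hb1_gt0 : (0 < leb (hb 1))%E.
Proof.
pose e : R := (2 * n%:R + 2)^-1.
have n0 : 0 <= n%:R :> R by [].
have e0 : 0 < e by rewrite invr_gt0; lra.
have ee : 2 * n%:R * e ^+ 2 <= e /\ e < 1.
  have E : e * (2 * n%:R + 2) = 1 by rewrite mulVf// gt_eqF//; lra.
  split; last by nra.
  by nra.
pose A (i : 'I_(n + n + 1)) : set R := `[(- e), e]%classic.
have mA i : measurable (A i) by exact: measurable_itv.
apply: (@lt_le_trans _ _ (leb [set v | forall i, A i (v ord0 i)])); last first.
  apply: le_measure; rewrite ?inE; [exact: measurable_rV_box|exact: measurable_hb|].
  move=> v vA; have {}vA i : v ord0 i ^+ 2 <= e ^+ 2.
    rewrite -real_normK ?num_real// ler_pXn2r ?nnegrE ?(ltW e0)//.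
    by have := vA i; rewrite /A/= in_itv ler_norml.
  rewrite /hb/= hnorm_lt// expr1n /hnorm4.
  have zle : hzsq v <= e.
    rewrite -dotr_hz /dotr; case: ee => + _; apply: le_trans.
    apply: (@le_trans _ _ (\sum_(i < n + n) e ^+ 2)).
      by apply: ler_sum => i _; rewrite -expr2 /hz mxE.
    by rewrite sumr_const card_ord -[leLHS]mulr_natl addnn -mul2n natrM.
  have tle : ht v ^+ 2 <= e ^+ 2 by rewrite /ht mxE.
  have z0 := hzsq_ge0 v.
  have e2 : e <= 2^-1 by rewrite /e lef_pV2 ?posrE; lra.
  by nra.
rewrite lebesgue_rV_box//.
elim/big_ind : _ => [|x y x0 y0|i _]; rewrite ?lte01//; last first.
  rewrite /A lebesgue_measure_itv/= lte_fin ifT; last by lra.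
  by rewrite -EFinB lte_fin; lra.
by rewrite mule_gt0.
Qed.

Definition hvol : R := fine (leb (hb 1)).

Lemma hvol_gt0 : 0 < hvol.
Proof. by rewrite fine_gt0// hb1_gt0 hb1_lty. Qed.

Lemma leb_hb a : 0 < a -> leb (hb a) = (a ^+ Q * hvol)%:E.
Proof.
move=> a0; rewrite hb_scale// EFinM fineK// ge0_fin_numE ?hb1_lty//.
Qed.

Lemma integral_bounded_hb (f : H -> R) (A : set H) (C a : R) :
  measurable_fun setT f -> (forall k, 0 <= f k) ->
  measurable A -> A `<=` hb a -> 0 < a -> (forall k, A k -> f k <= C) -> 0 <= C ->
  (\int[leb]_(k in A) (f k)%:E <= (C * (a ^+ Q * hvol))%:E)%E.
Proof.
move=> mf f0 mA Aa a0 fC C0.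
rewrite EFinM -leb_hb// -integral_cst; last exact: measurable_hb.
apply: (@le_trans _ _ (\int[leb]_(k in A) C%:E)%E).
  apply: ge0_le_integral => //.
  - by move=> k _; rewrite lee_fin.
  - by apply/measurable_EFinP; exact: measurable_funTS.
by apply: ge0_subset_integral => //; exact: measurable_hb.
Qed.

Section kernel.
Variable s : R.
Hypothesis s01 : 0 < s < 1.

Definition hexp : R := Q%:R + 2 * s.
Definition kap (k : H) : R := hnorm k `^ (- hexp).
(** The truncated kernel is integrable, and agrees with the kernel outside the
    unit ball, where tails are computed. *)
Definition kap1 (k : H) : R := Num.max 1 (hnorm k) `^ (- hexp).

Lemma hexp_gt0 : 0 < hexp.
Proof.
by case/andP: s01 => s0 _; rewrite ltr_wpDl// mulr_gt0.
Qed.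

Lemma kap_ge0 k : 0 <= kap k. Proof. exact: powR_ge0. Qed.
Lemma kap1_ge0 k : 0 <= kap1 k. Proof. exact: powR_ge0. Qed.

Lemma kap0 : kap 0 = 0.
Proof. by rewrite /kap hnorm0 powR0// oppr_eq0 gt_eqF// hexp_gt0. Qed.

Lemma kapV k : kap (hinv k) = kap k. Proof. by rewrite /kap hnormV. Qed.
Lemma kap1V k : kap1 (hinv k) = kap1 k. Proof. by rewrite /kap1 hnormV. Qed.

Lemma powR_le_hexp (x y : R) : 0 <= x -> x <= y -> x `^ hexp <= y `^ hexp.
Proof.
by move=> x0 xy; apply: ge0_ler_powR; rewrite ?nnegrE ?(ltW hexp_gt0)// (le_trans x0).
Qed.

Lemma measurable_kap : measurable_fun setT kap.
Proof.
by apply: (measurableT_comp (measurable_powR _)); exact: (@measurable_hnorm R n).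
Qed.

Lemma measurable_kap1 : measurable_fun setT kap1.
Proof.
apply: (measurableT_comp (measurable_powR _)); apply: measurable_maxr => //.
exact: (@measurable_hnorm R n).
Qed.

(** The two homogeneous functions integrated below are m = 0 and m = 2. *)
Let hker m k := hnorm k ^+ m * kap k.

Let hker_ge0 m k : 0 <= hker m k.
Proof. by rewrite mulr_ge0 ?exprn_ge0 ?hnorm_ge0 ?kap_ge0. Qed.

Let measurable_hker m : measurable_fun setT (hker m).
Proof.
apply: measurable_funM; last exact: measurable_kap.
by apply: measurable_funX; exact: (@measurable_hnorm R n).
Qed.

Lemma hker_hdil m lam k : 0 < lam ->
  lam ^+ Q * (hnorm (hdil lam k) ^+ m * kap (hdil lam k)) =
  lam `^ (m%:R - 2 * s) * (hnorm k ^+ m * kap k).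
Proof.
move=> l0; have l0' := ltW l0.
rewrite /kap hnorm_hdil// powRM ?hnorm_ge0// exprMn.
rewrite (_ : lam `^ (m%:R - 2 * s) = lam ^+ Q * (lam ^+ m * lam `^ (- hexp))); first by ring.
rewrite -!powR_mulrn// -!powRD ?(gt_eqF l0) ?implybT//.
by congr powR; rewrite /hexp; ring.
Qed.

Lemma powR_lt1 (x y : R) : 0 < x -> x < 1 -> 0 < y -> x `^ y < 1.
Proof.
move=> x0 x1 y0; rewrite [ltRHS](_ : 1 = 1 `^ y); last by rewrite powR1.
by apply: gt0_ltr_powR; rewrite ?nnegrE ?(ltW x0).
Qed.

Lemma powR_gt1 (x y : R) : 1 < x -> 0 < y -> 1 < x `^ y.
Proof.
move=> x1 y0; rewrite [ltLHS](_ : 1 = 1 `^ y); last by rewrite powR1.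
by apply: gt0_ltr_powR; rewrite ?nnegrE// (ltW (lt_trans _ x1)).
Qed.

(** On the complement of the unit ball, the dilation by 2 multiplies the
    integral over a shell by 2^(-2 s) < 1. *)
Lemma kap_tail_lty : (\int[leb]_(k in ~` hb 1) (kap k)%:E < +oo)%E.
Proof.
case/andP: s01 => s0 s1.
pose D j := [set k : H | 1 <= hnorm k < 2 ^+ j].
have mD j : measurable (D j).
  rewrite (_ : D j = hb (2 ^+ j) `\` hb 1).
    by apply: measurableD; exact: measurable_hb.
  apply/seteqP; split => k /=; rewrite /D/= /hb/=.
    by move=> /andP[k1 k2]; split => //; apply/negP; rewrite -leNgt.
  by move=> [-> /negP]; rewrite -leNgt => ->.
have -> : ~` hb 1 = \bigcup_j D j.
  apply/seteqP; split => k /=; rewrite /hb/=.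
    move=> /negP; rewrite -leNgt => k1; exists (Num.bound (hnorm k)) => //.
    rewrite /D /= k1 upper_nthrootP//.
  by move=> [j _ /andP[k1 _]]; apply/negP; rewrite -leNgt.
have hd := @hker_hdil 0 2.
pose q : R := 2 `^ (0%:R - 2 * s).
have q1 : q < 1.
  by rewrite /q sub0r powRN invf_lt1 ?powR_gt0// powR_gt1 ?ltr1n// mulr_gt0.
have DS j : D j.+1 `<=` D 1%N `|` [set k | D j (hdil 2^-1 k)].
  move=> k; rewrite /D/= hnorm_hdil ?invr_ge0// exprS expr1 => /andP[k1 kj].
  have [k2|k2] := ltP (hnorm k) 2; [by left; rewrite k1|right].
  by rewrite mulrC ler_pdivlMr// mul1r k2/= ltr_pdivrMr// mulrC.
have D0 : D 0%N = set0.
  by apply/seteqP; split => k //=; rewrite /D/= expr0 => /andP[/le_lt_trans h /h]; rewrite ltxx.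
have ndD : nondecreasing_seq D.
  move=> i j ij; rewrite subsetEset => k /andP[k1 ki]; rewrite /D/= k1/=.
  by apply: lt_le_trans ki _; rewrite ler_eXn2l// ltr1n.
have D12 : D 1%N `<=` hb 2 by move=> k /andP[_]; rewrite expr1.
have kap_le1 k : D 1%N k -> hker 0 k <= 1.
  move=> /andP[k1 _]; rewrite /hker expr0 mul1r /kap powRN invf_le1.
    by rewrite -[leLHS](powRr0 (hnorm k)) ler_powR// ltW// hexp_gt0.
  by rewrite powR_gt0// (lt_le_trans _ k1).
have hK := @integral_bounded_hb (hker 0) _ 1 2 (measurable_hker 0) (hker_ge0 0)
  (mD 1%N) D12 (ltr0n _ 2) kap_le1 ler01.
have q01 : 0 <= q < 1 by rewrite powR_ge0.
have := integral_homogeneous_le (measurable_hker 0) (hker_ge0 0) (ltr0n _ 2) q01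
  (fun k => hd k (ltr0n _ 2)) (mD 1%N) mD D0 ndD DS hK.
move=> /le_lt_trans -/(_ _ (ltry _)).
by under eq_integral do rewrite /hker expr0 mul1r.
Qed.

(** Inside the unit ball, the factor |k|^2 makes the dilation by 1/2 multiply
    the integral over a shell by 2^(2 s - 2) < 1. *)
Lemma kap_near_lty : (\int[leb]_(k in hb 1) (hnorm k ^+ 2 * kap k)%:E < +oo)%E.
Proof.
case/andP: s01 => s0 s1.
pose D j := [set k : H | hnorm k < 1 /\ 1 <= hnorm k * 2 ^+ j].
have mD j : measurable (D j).
  rewrite (_ : D j = hb 1 `\` hb ((2 ^+ j)^-1)).
    by apply: measurableD; exact: measurable_hb.
  apply/seteqP; split => k /=; rewrite /D/= /hb/= => -[k1 k2]; split => //.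
    by apply/negP; rewrite -leNgt -div1r ler_pdivrMr// exprn_gt0.
  by move/negP : k2; rewrite -leNgt -div1r ler_pdivrMr// exprn_gt0.
pose B0 : set H := hb 1 `\ (0 : H).
have hU : B0 = \bigcup_j D j.
  apply/seteqP; split => k /=; last first.
    move=> [j _ [k1 k2]]; split => // k0; move: k2.
    by rewrite k0 hnorm0 mul0r ler10.
  move=> [k1 k0].
  have k2 : 0 < hnorm k.
    rewrite lt_neqAle hnorm_ge0 andbT eq_sym; apply/eqP => /hnorm_eq0; exact: k0.
  exists (Num.bound (hnorm k)^-1) => //; split => //.
  by rewrite -ler_pdivrMl// mulr1; apply/ltW/upper_nthrootP.
have hE : (\int[leb]_(k in hb 1) (hnorm k ^+ 2 * kap k)%:E =
           \int[leb]_(k in B0) (hker 2 k)%:E)%E.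
  rewrite [LHS]integral_indicM [RHS]integral_indicM.
  apply: eq_integral => k _; rewrite !indicE /hker.
  have [->|/eqP k0] := eqVneq k 0; first by rewrite hnorm0 expr0n /= !mul0r.
  congr (_ * _%:R)%:E; congr nat_of_bool; apply/idP/idP; rewrite !inE => //.
  by move=> -[].
have hd := @hker_hdil 2 2^-1.
pose q : R := 2^-1 `^ (2%:R - 2 * s).
have q01 : 0 <= q < 1.
  rewrite powR_ge0 powR_lt1//; last lra.
  by rewrite invf_lt1// ltr1n.
have DS j : D j.+1 `<=` D 1%N `|` [set k | D j (hdil (2^-1)^-1 k)].
  move=> k; rewrite /D/= invrK hnorm_hdil// exprS expr1 mulrA [2 * _]mulrC => -[k1 kj].
  have [k2|k2] := leP 1 (hnorm k * 2); [by left|right].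
  by [].
have D0 : D 0%N = set0.
  apply/seteqP; split => k //=; rewrite /D/= expr0 mulr1 => -[h1 h2].
  by have := lt_le_trans h1 h2; rewrite ltxx.
have ndD : nondecreasing_seq D.
  move=> i j ij; rewrite subsetEset => k [k1 ki]; split => //.
  by apply: le_trans ki _; rewrite ler_wpM2l ?hnorm_ge0// ler_eXn2l// ltr1n.
have D12 : D 1%N `<=` hb 1 by move=> k [].
have kap_le1 k : D 1%N k -> hker 2 k <= 2 `^ hexp.
  move=> [k1 k2]; rewrite /hker.
  have k0 : 2^-1 <= hnorm k by rewrite -div1r ler_pdivrMr.
  rewrite -[leRHS]mul1r ler_pM ?exprn_ge0 ?hnorm_ge0 ?kap_ge0//.
    by rewrite exprn_ile1 ?hnorm_ge0// ltW.
  rewrite /kap powRN -[2 in leRHS]invrK -(@powR_inv1 _ 2^-1)// -powRrM mulN1r powRN.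
  have k3 : 0 < hnorm k by apply: lt_le_trans k0; rewrite invr_gt0.
  rewrite lef_pV2 ?posrE; first exact: powR_le_hexp.
    exact: powR_gt0.
  by rewrite powR_gt0// invr_gt0.
have hK := @integral_bounded_hb (hker 2) _ _ 1 (measurable_hker 2) (hker_ge0 2)
  (mD 1%N) D12 ltr01 kap_le1 (powR_ge0 _ _).
have h2 : 0 < 2^-1 :> R by [].
apply: le_lt_trans (ltry _); rewrite hE hU.
exact: (integral_homogeneous_le (measurable_hker 2) (hker_ge0 2) h2 q01
  (fun k => hd k h2) (mD 1%N) mD D0 ndD DS hK).
Qed.

(** Near the origin, second increments of the barriers are O(|k|^2); multiplied
    by the kernel they are at most a multiple of this integrable function. *)
Definition knear (a : R) (k : H) : R := hnorm k ^+ 2 * kap k * \1_(hb a) k.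

Lemma knear_ge0 a k : 0 <= knear a k.
Proof. by rewrite mulr_ge0// hker_ge0. Qed.

Lemma measurable_knear a : measurable_fun setT (knear a).
Proof.
apply: measurable_funM; first exact: measurable_hker.
exact: measurable_indic (measurable_hb a).
Qed.

Lemma knear_hdil a k : 0 < a ->
  a ^+ Q * knear a (hdil a k) = a `^ (2 - 2 * s) * knear 1 k.
Proof.
move=> a0; rewrite /knear [LHS]mulrA [RHS]mulrA.
have -> : \1_(hb a) (hdil a k) = \1_(hb 1) k :> R.
  rewrite !indicE; congr (_%:R); congr nat_of_bool.
  by apply/idP/idP; rewrite !inE /hb/= hnorm_hdil ?(ltW a0)// -{2}(mulr1 a) ltr_pM2l.
by rewrite (@hker_hdil 2 a k a0).
Qed.

Lemma integral_knear_lty : (\int[leb]_k (knear 1 k)%:E < +oo)%E.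
Proof. by rewrite -integral_indicM kap_near_lty. Qed.

Lemma integrable_knear a : 0 < a -> leb.-integrable setT (EFin \o knear a).
Proof.
move=> a0; apply/integrableP; split; first by (apply/measurable_EFinP; exact: measurable_knear).
under eq_integral do rewrite /= ger0_norm ?knear_ge0//.
have mk := measurable_knear a.
rewrite (ge0_integral_scales (scales_hdil n a0)); last 2 first.
- exact/measurable_EFinP.
- by move=> k; rewrite lee_fin knear_ge0.
rewrite -ge0_integralZl_EFin ?exprn_ge0 ?(ltW a0)//; last 2 first.
- by move=> k _; rewrite lee_fin knear_ge0.
- apply/measurable_EFinP; apply: (measurableT_comp mk).
  exact: (@measurable_hdil _ _ _ _ _ id).
under eq_integral do rewrite -EFinM knear_hdil// EFinM.
rewrite ge0_integralZl_EFin ?powR_ge0//; last 2 first.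
- by move=> k _; rewrite lee_fin knear_ge0.
- (apply/measurable_EFinP; exact: measurable_knear).
by rewrite lte_mul_pinfty ?lee_fin ?powR_ge0// integral_knear_lty.
Qed.

Definition cnear : R := \int[leb]_k knear 1 k.

Lemma cnear_ge0 : 0 <= cnear.
Proof. by apply: Rintegral_ge0 => k _; exact: knear_ge0. Qed.

Lemma Rintegral_knear a : 0 < a -> \int[leb]_k knear a k = a `^ (2 - 2 * s) * cnear.
Proof.
move=> a0; have mk := measurable_knear a.
rewrite -RintegralZl//; last exact: integrable_knear.
rewrite /Rintegral; congr fine.
rewrite (ge0_integral_scales (scales_hdil n a0)); last 2 first.
- exact/measurable_EFinP.
- by move=> k; rewrite lee_fin knear_ge0.
rewrite -ge0_integralZl_EFin ?exprn_ge0 ?(ltW a0)//; last 2 first.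
- by move=> k _; rewrite lee_fin knear_ge0.
- apply/measurable_EFinP; apply: (measurableT_comp mk).
  exact: (@measurable_hdil _ _ _ _ _ id).
by apply: eq_integral => k _; rewrite -EFinM knear_hdil.
Qed.

Lemma kap1_near k : hb 1 k -> kap1 k = 1.
Proof. by move=> /ltW k1; rewrite /kap1 max_l// powR1. Qed.

Lemma kap1_far k : 1 <= hnorm k -> kap1 k = kap k.
Proof. by move=> k1; rewrite /kap1 max_r. Qed.

Lemma kap1_le1 k : kap1 k <= 1.
Proof.
rewrite /kap1 powRN invf_le1.
  rewrite -[leLHS](powRr0 (Num.max 1 (hnorm k))) ler_powR ?(ltW hexp_gt0)//.
  by rewrite le_max lexx.
by rewrite powR_gt0// lt_max ltr01.
Qed.

Lemma kap1_le_kap k : k != 0 -> kap1 k <= kap k.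
Proof.
move=> k0; have k1 : 0 < hnorm k.
  by rewrite lt_neqAle hnorm_ge0 andbT eq_sym; apply: contra k0 => /eqP/hnorm_eq0 ->.
rewrite /kap1 /kap !powRN lef_pV2 ?posrE; last 2 first.
- by apply: powR_gt0; rewrite lt_max ltr01.
- exact: powR_gt0.
by apply: powR_le_hexp; rewrite ?hnorm_ge0// le_max lexx orbT.
Qed.

Lemma kap_le_kap1 a k : 0 < a <= 1 -> a <= hnorm k -> kap k <= a `^ (- hexp) * kap1 k.
Proof.
move=> /andP[a0 a1] ak; have a2 : 1 <= a `^ (- hexp).
  rewrite powRN invf_ge1 ?powR_gt0//.
  have := @powR_le_hexp a 1 (ltW a0) a1; by rewrite powR1.
have [k1|k1] := leP 1 (hnorm k).
  by rewrite kap1_far// ler_peMl ?kap_ge0.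
rewrite kap1_near// mulr1 /kap !powRN lef_pV2 ?posrE; last 2 first.
- by apply: powR_gt0; exact: lt_le_trans ak.
- exact: powR_gt0.
by apply: powR_le_hexp => //; exact: ltW.
Qed.

(** Since max(1, |y|) <= 3 max(1, |x|), translating by a bounded element changes
    the weight by a bounded factor; this is how integrals centred at different
    points of the ball of radius 2 are compared. *)
Lemma kap1_compare (x y : H) : hnorm y <= hnorm x + 2 -> kap1 x <= 3 `^ hexp * kap1 y.
Proof.
move=> xy; have mx1 : 1 <= Num.max 1 (hnorm x) by rewrite le_max lexx.
have mx2 : hnorm x <= Num.max 1 (hnorm x) by rewrite le_max lexx orbT.
have x0 : 0 < Num.max 1 (hnorm x) by apply: lt_le_trans mx1.
have y0 : 0 < Num.max 1 (hnorm y) by rewrite lt_max ltr01.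
rewrite /kap1 !powRN ler_pdivlMr ?powR_gt0// mulrC ler_pdivrMr ?powR_gt0//.
rewrite -powRM ?(ltW x0)//; apply: powR_le_hexp; first exact: ltW.
by rewrite ge_max; apply/andP; split; lra.
Qed.

Lemma integrable_kap1 : leb.-integrable setT (EFin \o kap1).
Proof.
apply/integrableP; split; first by (apply/measurable_EFinP; exact: measurable_kap1).
under eq_integral do rewrite /= ger0_norm ?kap1_ge0//.
have mh := measurable_hb 1.
apply: (@le_lt_trans _ _ (\int[leb]_k ((\1_(hb 1) k)%:E + (kap k * \1_(~` hb 1) k)%:E))%E).
  apply: ge0_le_integral => //.
  - by move=> k _; rewrite lee_fin kap1_ge0.
  - (apply/measurable_EFinP; exact: measurable_kap1).
  - apply: emeasurable_funD; first by apply/measurable_EFinP.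
    apply/measurable_EFinP; apply: measurable_funM; first exact: measurable_kap.
    exact: measurable_indic (measurableC mh).
  - move=> k _; rewrite -EFinD lee_fin !indicE.
    have [k1|k1] := boolP (k \in hb 1).
      by rewrite kap1_near; [rewrite lerDl mulr_ge0 ?kap_ge0|rewrite inE in k1].
    rewrite add0r mem_set ?mulr1.
      rewrite kap1_far// leNgt; apply: contra k1 => k1; exact: mem_set.
    by move=> kk; move: k1; rewrite mem_set.
have mg : measurable_fun setT (fun k => (kap k * \1_(~` hb 1) k)%:E).
  apply/measurable_EFinP; apply: measurable_funM; first exact: measurable_kap.
  exact: measurable_indic (measurableC mh).
rewrite ge0_integralD//=;
  try (by apply/measurable_EFinP; exact: measurable_indic);
  try (by move=> k _; rewrite lee_fin ?mulr_ge0 ?kap_ge0).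
rewrite integral_indic// setIT -integral_indicM lte_add_pinfty ?kap_tail_lty//.
  exact: hb1_lty.
Qed.



End kernel.

End homogeneous_kernels.

(** * Smooth functions and compact balls *)

Section flat.
Variable R : realType.

(** The functions t^-k exp(-1/t) for t > 0, extended by 0. Their span is stable
    under derivation, which makes all of them smooth; flat 0 is the usual
    building block of bump functions. *)
Definition flat (k : nat) (t : R) : R :=
  if 0 < t then t^-1 ^+ k * expR (- t^-1) else 0.

Lemma flat_ge0 k t : 0 <= flat k t.
Proof.
by rewrite /flat; case: ifP => // t0; rewrite mulr_ge0 ?expR_ge0// exprn_ge0// invr_ge0 ltW.
Qed.

Lemma flat_gt0 k t : 0 < t -> 0 < flat k t.
Proof. by move=> t0; rewrite /flat t0 mulr_gt0 ?expR_gt0// exprn_gt0// invr_gt0. Qed.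

Lemma flat_le0 k t : t <= 0 -> flat k t = 0.
Proof. by move=> t0; rewrite /flat ltNge t0. Qed.

(** A term of the exponential series of 1/t bounds exp(-1/t) by any power of t. *)
Lemma flat_le k m t : 0 < t -> flat k t <= m.+1`!%:R * t ^+ m.+1 * t^-1 ^+ k.
Proof.
move=> t0; rewrite /flat t0 mulrC ler_wpM2r ?exprn_ge0 ?invr_ge0 ?(ltW t0)//.
rewrite expRN -[leLHS]div1r ler_pdivrMr ?expR_gt0//.
have ti : 0 <= t^-1 by rewrite invr_ge0 ltW.
have := expR_ge1Dxn m ti => h.
rewrite -ler_pdivrMl; last by rewrite mulr_gt0 ?exprn_gt0 ?ltr0n ?fact_gt0.
apply: le_trans h; rewrite mulr1 invfM -exprVn mulrC; lra.
Qed.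

Lemma flat_le_sqr k t : `|flat k t| <= k.+2`!%:R * t ^+ 2.
Proof.
rewrite ger0_norm ?flat_ge0//.
have [t0|t0] := ltP 0 t; last by rewrite flat_le0// mulr_ge0 ?sqr_ge0.
apply: le_trans (flat_le k k.+1 t0) _.
rewrite -mulrA ler_wpM2l// -addn2 exprD mulrC mulrA -exprMn mulVf ?gt_eqF//.
by rewrite expr1n mul1r.
Qed.

Lemma flat_bounded k : exists2 C, 0 < C & forall t, `|flat k t| <= C.
Proof.
exists (k.+1`!%:R); first by rewrite ltr0n fact_gt0.
move=> t; rewrite ger0_norm ?flat_ge0//.
have [t0|t0] := ltP 0 t; last by rewrite flat_le0.
have [t1|t1] := leP 1 t.
  rewrite /flat t0 (@le_trans _ _ 1)//; last by rewrite ler1n fact_gt0.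
  rewrite mulr_ile1 ?expR_ge0 ?exprn_ge0 ?invr_ge0 ?(ltW t0)//.
    by rewrite exprn_ile1 ?invr_ge0 ?(ltW t0)// invf_le1.
  by rewrite expR_le1 oppr_le0 invr_ge0 ltW.
apply: le_trans (flat_le k k t0) _; rewrite -mulrA -[leRHS]mulr1 ler_wpM2l//.
by rewrite exprS -mulrA -exprMn mulfV ?gt_eqF// expr1n mulr1 ltW.
Qed.

(** At t = 0 the difference quotient is O(t) by flat_le_sqr. *)
Lemma is_derive_flat k (t : R) :
  is_derive t 1 (flat k) (flat k.+2 t - k%:R * flat k.+1 t).
Proof.
have [t0|t0|->] := ltgtP t 0.
- rewrite !(flat_le0 _ (ltW t0)) mulr0 subr0.
  apply: (@near_eq_is_derive _ _ _ (cst 0)).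
  near=> u; rewrite flat_le0//; near: u; exact: lt_le_nbhsl.
- apply: (@near_eq_is_derive _ _ _ (fun u : R => u^-1 ^+ k * expR (- u^-1))).
    by near=> u; rewrite /flat ifT//; near: u; exact: lt_nbhsr.
  rewrite /flat t0.
  have tn0 : t != 0 by rewrite gt_eqF.
  have d1 : is_derive t 1 (fun u : R => u^-1) (- t^-1 ^+ 2).
    have := @is_deriveV _ id t 1 1 tn0 (is_derive_id _ _).
    by rewrite exprVn /GRing.scale/= mulr1.
  have d2 := is_deriveX k d1.
  have d3 : is_derive t 1 (fun u : R => expR (- u^-1)) (t^-1 ^+ 2 * expR (- t^-1)).
    have dN := is_deriveN d1; rewrite opprK in dN.
    have := @is_derive1_comp _ expR (fun u => - u^-1) t _ _ (is_derive_expR _) dN.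
    by rewrite mulrC.
  have d4 := is_deriveM d2 d3.
  have -> : (fun u : R => u^-1 ^+ k * expR (- u^-1)) =
      (fun u : R => u^-1) ^+ k * (fun u : R => expR (- u^-1)).
    by apply/funext => u; rewrite !fctE.
  apply: (is_derive_eq d4); rewrite /GRing.scale/= ?fctE.
  case: k d2 d4 => [|k] d2 d4 /=; first by rewrite !expr0; ring.
  by rewrite !exprS; ring.
- rewrite !flat_le0// mulr0 subr0.
  have h : h^-1 *: ((flat k \o shift 0) (h *: 1) - flat k 0) @[h --> 0^'] --> (0 : R).
    apply/cvgrPdist_lt => e e0; have C0 : 0 < k.+2`!%:R :> R by rewrite ltr0n fact_gt0.
    near=> h; have h0 : h != 0 by near: h; exact: nbhs_dnbhs_neq.
    rewrite /= addr0 (flat_le0 k (lexx 0)) subr0 sub0r normrN /GRing.scale/= mulr1.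
    rewrite normrM normfV (@le_lt_trans _ _ (`|h|^-1 * (k.+2`!%:R * h ^+ 2)))//.
      by rewrite ler_wpM2l ?invr_ge0// flat_le_sqr.
    rewrite -(real_normK (num_real h)) expr2 mulrCA mulKf ?normr_eq0//.
    rewrite -ltr_pdivlMl//; near: h.
    have : \forall h \near (0 : R), `|h| < k.+2`!%:R^-1 * e.
      have e1 : 0 < k.+2`!%:R^-1 * e by rewrite mulr_gt0 ?invr_gt0.
      near=> h; rewrite -[h]subr0 distrC; near: h.
      exact: (@cvgr_dist_lt _ _ _ _ _ id 0).
    exact: nbhs_dnbhs.
  by apply: DeriveDef; [apply/cvg_ex; exists 0|exact: cvg_lim h].
Unshelve. all: by end_near.
Qed.

Lemma differentiable_flat k t : differentiable (flat k) t.
Proof. by apply/derivable1_diffP; have [] := is_derive_flat k t. Qed.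

Lemma derive1_flat k t : derive1 (flat k) t = flat k.+2 t - k%:R * flat k.+1 t.
Proof. by rewrite derive1E; have [] := is_derive_flat k t. Qed.

Lemma flat0_lipschitz : exists2 C, 0 < C &
  forall a b, `|flat 0 a - flat 0 b| <= C * `|a - b|.
Proof.
have [C C0 hC] := flat_bounded 2; exists C => //.
have key a b : a < b -> `|flat 0 b - flat 0 a| <= C * `|b - a|.
  move=> ab; have [c _ ->] := @MVT _ _ _ _ _ ab (fun x _ => is_derive_flat 0 x)
    (continuous_subspaceT (fun x => differentiable_continuous (differentiable_flat 0 x))).
  by rewrite mul0r subr0 normrM ler_wpM2r.
move=> a b; have [ab|ab|->] := ltgtP a b; last by rewrite !subrr normr0 mulr0.
- by rewrite distrC [`|a - b|]distrC key.
- exact: key.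
Qed.

End flat.

Section smooth_class.
Variables (R : realType) (m : nat).
Local Notation V := 'rV[R]_m.

(** A syntactic class of functions that contains the polynomials and the bumps
    and is stable under directional derivatives. Smoothness in the sense of all
    iterated derivatives then needs no more than differentiability of its
    members. *)
Inductive elementary : (V -> R) -> Prop :=
| elementary_cst c : elementary (cst c)
| elementary_coord i : elementary (fun x => x ord0 i)
| elementary_add f g : elementary f -> elementary g -> elementary (fun x => f x + g x)
| elementary_mul f g : elementary f -> elementary g -> elementary (fun x => f x * g x)
| elementary_flat k f : elementary f -> elementary (fun x => flat k (f x)).

Lemma elementary_differentiable f : elementary f -> forall x, differentiable f x.
Proof.
elim=> {f} [c|i|f g _ df _ dg|f g _ df _ dg|k f _ df] x.
- exact: differentiable_cst.
- exact: differentiable_coord.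
- exact: differentiableD.
- exact: differentiableM.
- by apply: (@differentiable_comp _ _ _ _ f (flat k)) => //; exact: differentiable_flat.
Qed.

Lemma elementary_derive f w : elementary f -> elementary ('D_w f).
Proof.
elim=> {f} [c|i|f g ef IHf eg IHg|f g ef IHf eg IHg|k f ef IHf].
- rewrite (_ : 'D_w _ = cst 0); first exact: elementary_cst.
  by apply/funext => x; rewrite derive_cst.
- rewrite (_ : 'D_w _ = cst (w ord0 i)); first exact: elementary_cst.
  apply/funext => x; rewrite /derive; apply/cvg_lim => //; apply: cvg_near_cst.
  near=> h; have h0 : h != 0 by near: h; exact: nbhs_dnbhs_neq.
  by rewrite /= !mxE addrK /GRing.scale/= mulKf.
- rewrite (_ : 'D_w _ = fun x => 'D_w f x + 'D_w g x); first exact: elementary_add.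
  apply/funext => x; rewrite deriveD//; apply: diff_derivable; exact: elementary_differentiable.
- rewrite (_ : 'D_w _ = fun x => f x * 'D_w g x + g x * 'D_w f x).
    by apply: elementary_add; exact: elementary_mul.
  apply/funext => x; rewrite deriveM//; apply: diff_derivable; exact: elementary_differentiable.
- rewrite (_ : 'D_w _ = fun x => (flat k.+2 (f x) + - k%:R * flat k.+1 (f x)) * 'D_w f x).
    apply: elementary_mul => //; apply: elementary_add; first exact: elementary_flat.
    by apply: elementary_mul; [exact: (elementary_cst (- k%:R))|exact: elementary_flat].
  apply/funext => x; have dfx := elementary_differentiable ef x.
  rewrite deriveE; last by apply: (@differentiable_comp _ _ _ _ f (flat k)) => //; exact: differentiable_flat.
  rewrite (@diff_comp _ _ _ _ f (flat k)) //; last exact: differentiable_flat.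
  rewrite /= deriv1E; last by apply/derivable1_diffP; exact: differentiable_flat.
  rewrite derive1_flat deriveE// mulNr /GRing.scale/= mulrC.
Unshelve. all: by end_near.
Qed.

Lemma elementary_smooth f : elementary f ->
  forall (vs : seq V) x, differentiable (foldr (fun w f => 'D_w f) f vs) x.
Proof.
move=> ef vs; apply: elementary_differentiable.
by elim: vs => //= w vs; exact: elementary_derive.
Qed.

Lemma elementary_continuous f : elementary f -> continuous f.
Proof. by move=> ef x; apply: differentiable_continuous; exact: elementary_differentiable. Qed.

Lemma elementary_eq f g : elementary f -> f =1 g -> elementary g.
Proof. by move=> ef /funext <-. Qed.

Lemma elementary_sum I (r : seq I) (F : I -> V -> R) :
  (forall i, elementary (F i)) -> elementary (fun x => \sum_(i <- r) F i x).
Proof.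
move=> eF; elim: r => [|i r IH].
  by apply: (elementary_eq (elementary_cst 0)) => x; rewrite big_nil.
by apply: (elementary_eq (elementary_add (eF i) IH)) => x; rewrite big_cons.
Qed.

End smooth_class.
Arguments elementary_cst {R m} c.
Arguments elementary_coord {R m} i.

Section elementary_heis.
Variables (R : realType) (n m : nat).
Local Notation H := (heis R n).
Local Notation V := 'rV[R]_m.

Definition elementary_map k (F : V -> 'rV[R]_k) :=
  forall i, elementary (fun x => F x ord0 i).

Lemma elementary_opp (f : V -> R) : elementary f -> elementary (fun x => - f x).
Proof.
move=> ef; apply: (elementary_eq (elementary_mul (elementary_cst (-1)) ef)) => x.
by rewrite mulN1r.
Qed.

Lemma elementary_dotr k (F G : V -> 'rV[R]_k) : elementary_map F -> elementary_map G ->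
  elementary (fun x => dotr (F x) (G x)).
Proof. by move=> eF eG; apply: elementary_sum => i; exact: elementary_mul. Qed.

Lemma elementary_map_hx (F : V -> H) : elementary_map F -> elementary_map (fun x => hx (F x)).
Proof.
move=> eF i; apply: (elementary_eq (eF (lshift 1 (lshift n i)))) => x.
by rewrite /hx /hz !mxE.
Qed.

Lemma elementary_map_hy (F : V -> H) : elementary_map F -> elementary_map (fun x => hy (F x)).
Proof.
move=> eF i; apply: (elementary_eq (eF (lshift 1 (rshift n i)))) => x.
by rewrite /hy /hz !mxE.
Qed.

Lemma elementary_ht (F : V -> H) : elementary_map F -> elementary (fun x => ht (F x)).
Proof.
by move=> eF; apply: (elementary_eq (eF (rshift (n + n) ord0))) => x; rewrite /ht mxE.
Qed.

Lemma elementary_hpoint (F G : V -> 'rV[R]_n) (f : V -> R) :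
  elementary_map F -> elementary_map G -> elementary f ->
  elementary_map (fun x => hpoint (F x) (G x) (f x)).
Proof.
move=> eF eG ef i; have [j ->|j ->] := split_ordP i; last first.
  by apply: (elementary_eq ef) => x; rewrite /hpoint row_mxEr mxE (ord1 j) eqxx mulr1n.
have [k ->|k ->] := split_ordP j.
  by apply: (elementary_eq (eF k)) => x; rewrite /hpoint !row_mxEl.
by apply: (elementary_eq (eG k)) => x; rewrite /hpoint row_mxEl row_mxEr.
Qed.

Lemma elementary_map_add k (F G : V -> 'rV[R]_k) : elementary_map F -> elementary_map G ->
  elementary_map (fun x => F x + G x).
Proof.
by move=> eF eG i; apply: (elementary_eq (elementary_add (eF i) (eG i))) => x; rewrite mxE.
Qed.

Lemma elementary_map_scale k c (F : V -> 'rV[R]_k) : elementary_map F ->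
  elementary_map (fun x => c *: F x).
Proof.
by move=> eF i; apply: (elementary_eq (elementary_mul (elementary_cst c) (eF i))) => x; rewrite mxE.
Qed.

Lemma elementary_hmul (F G : V -> H) : elementary_map F -> elementary_map G ->
  elementary_map (fun x => hmul (F x) (G x)).
Proof.
move=> eF eG; apply: elementary_hpoint.
- by apply: elementary_map_add; exact: elementary_map_hx.
- by apply: elementary_map_add; exact: elementary_map_hy.
- apply: elementary_add.
    apply: elementary_add; first by apply: elementary_add; exact: elementary_ht.
    apply: elementary_mul; first exact: (elementary_cst 2).
    by apply: elementary_dotr; [exact: elementary_map_hy|exact: elementary_map_hx].
  apply/elementary_opp/elementary_mul; first exact: (elementary_cst 2).
  by apply: elementary_dotr; [exact: elementary_map_hx|exact: elementary_map_hy].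
Qed.

Lemma elementary_hinv (F : V -> H) : elementary_map F -> elementary_map (fun x => hinv (F x)).
Proof.
by move=> eF i; apply: (elementary_eq (elementary_opp (eF i))) => x; rewrite mxE.
Qed.

Lemma elementary_hdil c (F : V -> H) : elementary_map F -> elementary_map (fun x => hdil c (F x)).
Proof.
move=> eF; apply: elementary_hpoint.
- exact/elementary_map_scale/elementary_map_hx.
- exact/elementary_map_scale/elementary_map_hy.
- apply: elementary_mul; [exact: (elementary_cst (c ^+ 2))|exact: elementary_ht].
Qed.

Lemma elementary_hnorm4 (F : V -> H) : elementary_map F -> elementary (fun x => hnorm4 (F x)).
Proof.
move=> eF; have ez : elementary (fun x => hzsq (F x)).
  apply: elementary_add; apply: elementary_dotr;
    by [exact: elementary_map_hx|exact: elementary_map_hy].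
apply: (elementary_eq (elementary_add (elementary_mul ez ez)
  (elementary_mul (elementary_ht eF) (elementary_ht eF)))) => x.
by rewrite /hnorm4 !expr2.
Qed.

Lemma elementary_map_cst k (c : 'rV[R]_k) : elementary_map (fun _ : V => c).
Proof. by move=> i; exact: elementary_cst. Qed.

Lemma elementary_map_id : elementary_map (fun x : V => x).
Proof. by move=> i; exact: elementary_coord. Qed.

End elementary_heis.

Section closed_balls.
Variables (R : realType) (n : nat).
Local Notation H := (heis R n).

Lemma continuous_hnorm4 (a : H) : continuous (fun x => hnorm4 (hmul a x)).
Proof.
apply: elementary_continuous; apply: elementary_hnorm4; apply: elementary_hmul.
  exact: elementary_map_cst.
exact: elementary_map_id.
Qed.

Lemma closed_hnorm4_le (f : H -> R) (c : R) : continuous f -> closed [set x | f x <= c].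
Proof.
move=> cf; apply: (@preimage_closed _ _ f [set y | y <= c]); last exact: closed_le.
by move=> x _; exact: cf.
Qed.

(** The norm of row vectors is the sup norm. *)
Lemma bounded_coord_set (A : set H) (c : R) :
  (forall x i, A x -> `|x ord0 i| <= c) -> bounded_set A.
Proof.
move=> Ac; exists (Num.max 0 c); split; first exact: num_real.
move=> M; rewrite gt_max => /andP[M0 /ltW cM] x /= Ax.
rewrite [leLHS]mx_normrE; apply: bigmax_le => [|[i j] _ /=]; first exact: ltW.
by rewrite (ord1 i) (le_trans (Ac _ j Ax)).
Qed.

Lemma compact_hnorm_le (r : R) : 0 <= r -> compact [set x : H | hnorm x <= r].
Proof.
move=> r0; apply: bounded_closed_compact.
  apply: (@bounded_coord_set _ ((r + 1) ^+ 2)) => x i xr.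
  by apply: hcoord_le; [lra|apply: le_trans xr _; lra].
rewrite (_ : [set _ | _] = [set x | hnorm4 (hmul 0 x) <= r ^+ 4]).
  exact/closed_hnorm4_le/continuous_hnorm4.
by apply/seteqP; split => x /=; rewrite hmul0l hnorm_le.
Qed.

End closed_balls.

(** * Increments of the barrier *)

Section barrier_algebra.
Variables (R : realType) (n : nat).
Local Notation H := (heis R n).
Implicit Types x k : H.

Lemma hdotNr x k : hdot x (hinv k) = - hdot x k.
Proof. by rewrite /hdot /hinv hxN hyN !dotrNr opprD. Qed.
Lemma hsympNr x k : hsymp x (hinv k) = - hsymp x k.
Proof. by rewrite /hsymp /hinv hxN hyN !dotrNr opprB opprK addrC. Qed.
Lemma hzsqV k : hzsq (hinv k) = hzsq k.
Proof. by rewrite /hzsq /hdot /hinv hxN hyN !dotrNl !dotrNr !opprK. Qed.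

Lemma hnorm4M x k : hnorm4 (hmul x k) =
  (hzsq x + 2 * hdot x k + hzsq k) ^+ 2 + (ht x + (ht k + 2 * hsymp x k)) ^+ 2.
Proof. by rewrite /hnorm4 hzsqM htM -[ht x + ht k + _]addrA. Qed.

Lemma hnorm4MV x k : hnorm4 (hmul x (hinv k)) =
  (hzsq x - 2 * hdot x k + hzsq k) ^+ 2 + (ht x - (ht k + 2 * hsymp x k)) ^+ 2.
Proof.
by rewrite hnorm4M hdotNr hsympNr hzsqV /hinv htN; congr (_ ^+ 2 + _ ^+ 2); ring.
Qed.

(** In the sum over k and k^-1 the terms of first order in k cancel, both the
    horizontal 2 hdot x k and the vertical ht k + 2 hsymp x k. *)
Lemma hnorm4_second_difference x k : hnorm x <= 2 -> hnorm k <= 1 ->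
  hnorm4 (hmul x k) + hnorm4 (hmul x (hinv k)) - 2 * hnorm4 x <= 118 * hnorm k ^+ 2.
Proof.
move=> x2 k1; have k0 := hnorm_ge0 k.
have zx : hzsq x <= 4.
  rewrite (le_trans (hzsq_le x))// (_ : 4 = 2 ^+ 2); last by ring.
  by rewrite ler_pXn2r ?nnegrE ?hnorm_ge0.
have zk := hzsq_le k; have tk := ht_le k.
have [zx0 zk0] := (hzsq_ge0 x, hzsq_ge0 k).
have cs := hdot_hsymp_le x k.
rewrite hnorm4M hnorm4MV /hnorm4.
set a := hzsq x in zx zx0 cs *; set b := hzsq k in zk zk0 cs *.
set q := hnorm k ^+ 2 in zk tk *.
have q1 : 0 <= q <= 1 by rewrite /q sqr_ge0 exprn_ile1.
case/andP: q1 => q0 q1.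
have tk2 : ht k ^+ 2 <= q.
  rewrite -real_normK ?num_real// (@le_trans _ _ (q ^+ 2))//.
    by rewrite ler_pXn2r ?nnegrE.
  by rewrite expr2 ler_piMl.
set u := ht x; set v := ht k in tk2 *; set d := hdot x k in cs *; set w := hsymp x k in cs *.
have ab : a * b <= 4 * q by apply: ler_pM.
have b2 : b ^+ 2 <= q by rewrite expr2 (le_trans _ zk)// ler_piMl//; lra.
have vw : (v + 2 * w) ^+ 2 <= 2 * v ^+ 2 + 8 * w ^+ 2 by have := sqr_ge0 (v - 2 * w); nra.
have -> : (a + 2 * d + b) ^+ 2 + (u + (v + 2 * w)) ^+ 2 +
  ((a - 2 * d + b) ^+ 2 + (u - (v + 2 * w)) ^+ 2) - 2 * (a ^+ 2 + u ^+ 2) =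
  4 * (a * b) + 2 * b ^+ 2 + 8 * d ^+ 2 + 2 * (v + 2 * w) ^+ 2 by ring.
have := sqr_ge0 d; have := sqr_ge0 w; lra.
Qed.

Lemma hnorm4_first_difference x k : hnorm x <= 2 -> hnorm k <= 1 ->
  `|hnorm4 (hmul x k) - hnorm4 x| <= 130 * hnorm k.
Proof.
move=> x2 k1; have k0 := hnorm_ge0 k; have x0 := hnorm_ge0 x.
have x4 : hnorm x ^+ 2 <= 4.
  by rewrite (_ : 4 = 2 ^+ 2) ?ler_pXn2r ?nnegrE//; ring.
have zx : hzsq x <= 4 by rewrite (le_trans (hzsq_le x)).
have tx : `|ht x| <= 4 by rewrite (le_trans (ht_le x)).
have kk : hnorm k ^+ 2 <= hnorm k by rewrite expr2 ler_piMl.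
have zk : hzsq k <= hnorm k by rewrite (le_trans (hzsq_le k)).
have tk : `|ht k| <= hnorm k by rewrite (le_trans (ht_le k)).
have [zx0 zk0] := (hzsq_ge0 x, hzsq_ge0 k).
have cs : hdot x k ^+ 2 + hsymp x k ^+ 2 <= (2 * hnorm k) ^+ 2.
  rewrite (le_trans (hdot_hsymp_le x k))// exprMn (_ : 2 ^+ 2 = 4); last by ring.
  by apply: ler_pM => //; exact: hzsq_le.
have dk : `|hdot x k| <= 2 * hnorm k.
  rewrite -(@ler_pXn2r _ 2) ?nnegrE ?mulr_ge0// real_normK ?num_real//.
  by have := sqr_ge0 (hsymp x k); lra.
have wk : `|hsymp x k| <= 2 * hnorm k.
  rewrite -(@ler_pXn2r _ 2) ?nnegrE ?mulr_ge0// real_normK ?num_real//.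
  by have := sqr_ge0 (hdot x k); lra.
rewrite hnorm4M /hnorm4.
set a := hzsq x in zx zx0 *; set b := hzsq k in zk zk0 *.
set u := ht x in tx *; set v := ht k in tk *; set d := hdot x k in dk *; set w := hsymp x k in wk *.
have -> : (a + 2 * d + b) ^+ 2 + (u + (v + 2 * w)) ^+ 2 - (a ^+ 2 + u ^+ 2)
  = (b + 2 * d) * (2 * a + b + 2 * d) + (v + 2 * w) * (2 * u + (v + 2 * w)) by ring.
have [d1 d2] := ler_normlP _ _ dk; have [w1 w2] := ler_normlP _ _ wk.
have [v1 v2] := ler_normlP _ _ tk; have [u1 u2] := ler_normlP _ _ tx.
have e1 : `|b + 2 * d| <= 5 * hnorm k by apply/ler_normlP; split; lra.
have e2 : `|2 * a + b + 2 * d| <= 13 by apply/ler_normlP; split; lra.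
have e3 : `|v + 2 * w| <= 5 * hnorm k by apply/ler_normlP; split; lra.
have e4 : `|2 * u + (v + 2 * w)| <= 13 by apply/ler_normlP; split; lra.
have f1 := ler_pM (normr_ge0 _) (normr_ge0 _) e1 e2.
have f2 := ler_pM (normr_ge0 _) (normr_ge0 _) e3 e4.
rewrite (le_trans (ler_normD _ _))// !normrM; lra.
Qed.

(** Induction on m from 1/e = 1 - (e - 1) + (e - 1)^2 / e, where 1/e <= 2. *)
Lemma exprV_taylor m : exists2 C : R, 0 <= C & forall e, 2^-1 <= e ->
  (e ^+ m)^-1 <= 1 - m%:R * (e - 1) + C * (e - 1) ^+ 2.
Proof.
elim: m => [|m [C C0 IH]].
  by exists 0 => // e _; rewrite expr0 invr1 mul0r subr0 mul0r addr0.
exists (2 + 2 * m%:R + 2 * C); first by rewrite !addr_ge0// mulr_ge0.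
move=> e e2; have e0 : 0 < e by apply: lt_le_trans e2; rewrite invr_gt0.
set x := e - 1; have ex : e = 1 + x by rewrite /x; ring.
have y0 : 0 <= e^-1 by rewrite invr_ge0 ltW.
have y2 : e^-1 <= 2 by rewrite -[2]invrK lef_pV2 ?posrE ?invr_gt0.
have yE : e^-1 = 1 - x + x ^+ 2 * e^-1.
  by rewrite /x; field; rewrite gt_eqF.
have xy : x * e^-1 = x - x ^+ 2 * e^-1.
  by rewrite /x; field; rewrite gt_eqF.
rewrite exprS invfM mulrC.
apply: (le_trans (ler_wpM2r y0 (IH e e2))); rewrite -/x.
have -> : (1 - m%:R * x + C * x ^+ 2) * e^-1 =
  e^-1 - m%:R * (x * e^-1) + C * (x ^+ 2 * e^-1) by ring.
have x2y : x ^+ 2 * e^-1 <= 2 * x ^+ 2.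
  by rewrite mulrC ler_wpM2r// sqr_ge0.
rewrite xy [X in X - _ + _]yE.
have m0 : 0 <= m%:R :> R by [].
have h1 := ler_wpM2l m0 x2y; have h2 := ler_wpM2l C0 x2y.
rewrite -natr1; lra.
Qed.

End barrier_algebra.

(** * A pointwise Harnack inequality *)

Section continuity.
Variables (R : realType) (n : nat).
Local Notation H := (heis R n).
Implicit Types f g : H -> R.

Lemma continuous_subr f g : continuous f -> continuous g -> continuous (fun x => f x - g x).
Proof. by move=> cf cg x; exact: (cvgB (cf x) (cg x)). Qed.

Lemma continuous_mulr f g : continuous f -> continuous g -> continuous (fun x => f x * g x).
Proof. by move=> cf cg x; exact: (cvgM (cf x) (cg x)). Qed.

Lemma continuous_barrier : continuous (fun x : H => 1 - hnorm4 x / 16).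
Proof.
apply: continuous_subr; first exact: (elementary_continuous (elementary_cst 1)).
apply: continuous_mulr; last exact: (elementary_continuous (elementary_cst _)).
rewrite (_ : @hnorm4 R n = fun x => hnorm4 (hmul 0 x)); first exact: continuous_hnorm4.
by apply/funext => x; rewrite hmul0l.
Qed.

End continuity.
Arguments continuous_barrier {R} n.

Section integral_tools.
Variables (R : realType) (n : nat).
Local Notation H := (heis R n).
Local Notation leb := (lebesgue_rV R (n + n + 1)).
Implicit Types f g : H -> R.

Lemma Rintegral_scales1 (T : H -> H) f : scales_leb 1 T -> measurable_fun setT f ->
  (forall x, 0 <= f x) -> \int[leb]_x f (T x) = \int[leb]_x f x.
Proof.
move=> sT mf f0; rewrite /Rintegral; congr fine.
rewrite [RHS](ge0_integral_scales sT) ?mul1e//; exact/measurable_EFinP.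
Qed.

Lemma integrable_addr f g : leb.-integrable setT (EFin \o f) -> leb.-integrable setT (EFin \o g) ->
  leb.-integrable setT (EFin \o (fun x => f x + g x)).
Proof. by move=> fi gi; exact: (integrableD measurableT fi gi). Qed.

Lemma integrable_scaler c f : leb.-integrable setT (EFin \o f) ->
  leb.-integrable setT (EFin \o (fun x => c * f x)).
Proof. by move=> fi; exact: (integrableZl measurableT c fi). Qed.

Lemma integrable_oppr f : leb.-integrable setT (EFin \o f) ->
  leb.-integrable setT (EFin \o (fun x => - f x)).
Proof.
move=> fi; rewrite (_ : (fun x => - f x) = (fun x => -1 * f x)); first exact: integrable_scaler.
by apply/funext => x; rewrite mulN1r.
Qed.

Lemma Rintegral_addr f g : leb.-integrable setT (EFin \o f) -> leb.-integrable setT (EFin \o g) ->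
  \int[leb]_x (f x + g x) = \int[leb]_x f x + \int[leb]_x g x.
Proof. exact: RintegralD. Qed.

Lemma Rintegral_scaler c f : leb.-integrable setT (EFin \o f) ->
  \int[leb]_x (c * f x) = c * \int[leb]_x f x.
Proof. exact: RintegralZl. Qed.

Lemma Rintegral_oppr f : leb.-integrable setT (EFin \o f) ->
  \int[leb]_x (- f x) = - \int[leb]_x f x.
Proof.
move=> fi; rewrite -mulN1r -Rintegral_scaler//.
by apply: eq_Rintegral => x _; rewrite mulN1r.
Qed.

Variable s : R.
Hypothesis s01 : 0 < s < 1.

Lemma integrable_kap1M g C : measurable_fun setT g -> (forall k, `|g k| <= C) ->
  leb.-integrable setT (EFin \o (fun k => kap1 s k * g k)).
Proof.
move=> mg gC; apply: (le_integrable measurableT) (integrableZl measurableT C (integrable_kap1 n s01)).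
  by apply/measurable_EFinP; apply: measurable_funM => //; exact: measurable_kap1.
move=> k _ /=; rewrite lee_fin normrM mulrC [leRHS]normrM ler_wpM2r//.
exact: le_trans (ler_norm _).
Qed.

(** A substitution by x0, after which the two weights differ by a bounded factor
    because |x0| <= 2. *)
Lemma Rintegral_kap1_translate (W : H -> R) C x0 : measurable_fun setT W ->
  (forall x, 0 <= W x <= C) -> hnorm x0 <= 2 ->
  \int[leb]_k (kap1 s k * W (hmul x0 k)) <= 3 `^ hexp n s * \int[leb]_x (kap1 s x * W x) /\
  \int[leb]_x (kap1 s x * W x) <= 3 `^ hexp n s * \int[leb]_k (kap1 s k * W (hmul x0 k)).
Proof.
move=> mW WC x02.
have W0 x : 0 <= W x by case/andP: (WC x).
have mT : measurable_fun setT (fun k => hmul x0 k).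
  exact: (@measurable_hmul _ _ _ _ (cst x0) id).
have mWT : measurable_fun setT (fun k => W (hmul x0 k)) by exact: measurableT_comp.
have bW x : `|W x| <= C by rewrite ger0_norm//; case/andP: (WC x).
have i1 := integrable_kap1M mWT (fun k => bW (hmul x0 k)).
have i2 := integrable_kap1M mW bW.
have m1 := @measurable_kap1 R n s.
have i3 : leb.-integrable setT (EFin \o (fun k => kap1 s (hmul x0 k) * W (hmul x0 k))).
  exact: (@integrable_scales _ _ _ _ _ (scales_hmull x0) i2).
have trE : \int[leb]_x (kap1 s x * W x) = \int[leb]_k (kap1 s (hmul x0 k) * W (hmul x0 k)).
  apply/esym/(@Rintegral_scales1 (hmul x0) (fun x => kap1 s x * W x)).
  - exact: scales_hmull.
  - exact: measurable_funM.
  - by move=> x; rewrite mulr_ge0// kap1_ge0.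
rewrite trE; split.
- apply: (@le_trans _ _ (\int[leb]_k (3 `^ hexp n s * (kap1 s (hmul x0 k) * W (hmul x0 k))))).
    apply: (le_Rintegral measurableT i1 (integrable_scaler _ i3)) => k _.
    rewrite mulrA ler_wpM2r//; apply: kap1_compare => //.
    by rewrite (le_trans (hnorm_triangle _ _))// addrC lerD2l.
  by rewrite (Rintegral_scaler (3 `^ hexp n s) i3).
- apply: (@le_trans _ _ (\int[leb]_k (3 `^ hexp n s * (kap1 s k * W (hmul x0 k))))).
    apply: (le_Rintegral measurableT i3 (integrable_scaler _ i1)) => k _.
    rewrite mulrA ler_wpM2r//; apply: kap1_compare => //.
    by rewrite -{1}(hmulKl x0 k) (le_trans (hnorm_triangle _ _))// hnormV addrC lerD2l.
  by rewrite (Rintegral_scaler (3 `^ hexp n s) i1).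
Qed.

End integral_tools.

Section pointwise_harnack.
Variables (R : realType) (n : nat) (s : R).
Hypothesis s01 : 0 < s < 1.
Local Notation H := (heis R n).
Local Notation leb := (lebesgue_rV R (n + n + 1)).
Local Notation Q := (hdim n).
Local Notation p := (hexp n s).

(** Symmetric second increments replace principal values: the equation is an
    absolutely convergent integral of them. *)
Definition diff2 (V : H -> R) x k := 2 * V x - V (hmul x k) - V (hmul x (hinv k)).

Variables (V : H -> R) (C0 : R).
Hypotheses (mV : measurable_fun setT V) (bV : forall x, `|V x| <= C0)
  (cV : continuous V) (V0 : forall x, hnorm x < 3 -> 0 <= V x)
  (iV : forall x, hnorm x <= 2 ->
    leb.-integrable setT (EFin \o (fun k => kap s k * diff2 V x k)))
  (eV : forall x, hnorm x <= 2 -> \int[leb]_k (kap s k * diff2 V x k) = 0).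

Let Vp x := Num.max (V x) 0.
Let Vm x := Num.max (- V x) 0.

Let VpE x : V x = Vp x - Vm x.
Proof. by rewrite /Vp /Vm; case: (leP (V x) 0); case: (leP (- V x) 0); lra. Qed.
Let Vp_ge0 x : 0 <= Vp x. Proof. by rewrite /Vp le_max lexx orbT. Qed.
Let Vm_ge0 x : 0 <= Vm x. Proof. by rewrite /Vm le_max lexx orbT. Qed.
Let C0_ge0 : 0 <= C0. Proof. exact: le_trans (bV 0). Qed.
Let Vp_le x : 0 <= Vp x <= C0.
Proof.
rewrite Vp_ge0 /Vp ge_max C0_ge0 andbT; exact: le_trans (ler_norm _) (bV x).
Qed.
Let Vm_le x : 0 <= Vm x <= C0.
Proof.
rewrite Vm_ge0 /Vm ge_max C0_ge0 andbT (le_trans (ler_norm _))// normrN; exact: bV.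
Qed.
Let mVp : measurable_fun setT Vp. Proof. exact: measurable_maxr. Qed.
Let mVm : measurable_fun setT Vm.
Proof. by apply: measurable_maxr => //; exact: measurable_funN. Qed.
Let Vm0 x : hnorm x < 3 -> Vm x = 0.
Proof. by move=> x3; rewrite /Vm max_r// oppr_le0 V0. Qed.

Let mtrans x0 : measurable_fun setT (fun k : H => hmul x0 k).
Proof. exact: (@measurable_hmul _ _ _ _ (cst x0) id). Qed.
Let mtransV x0 : measurable_fun setT (fun k : H => hmul x0 (hinv k)).
Proof.
by apply: (@measurable_hmul _ _ _ _ (cst x0)) => //; exact: (@measurable_hinv _ _ _ _ id).
Qed.

(** The inversion k |-> k^-1 preserves both the weight and the measure. *)
Let RintV (W : H -> R) x0 : measurable_fun setT W -> (forall x, 0 <= W x <= C0) ->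
  \int[leb]_k (kap1 s k * (W (hmul x0 k) + W (hmul x0 (hinv k)))) =
  2 * \int[leb]_k (kap1 s k * W (hmul x0 k)) /\
  leb.-integrable setT (EFin \o (fun k => kap1 s k * (W (hmul x0 k) + W (hmul x0 (hinv k))))).
Proof.
move=> mW WC.
have W0 x : 0 <= W x by case/andP: (WC x).
have bW x : `|W x| <= C0 by rewrite ger0_norm//; case/andP: (WC x).
have m1 : measurable_fun setT (fun k => W (hmul x0 k)) by exact: measurableT_comp.
have m2 : measurable_fun setT (fun k => W (hmul x0 (hinv k))).
  exact: (measurableT_comp mW (mtransV x0)).
have i1 := integrable_kap1M s01 m1 (fun k => bW _).
have i2 := integrable_kap1M s01 m2 (fun k => bW _).
have e k : kap1 s k * (W (hmul x0 k) + W (hmul x0 (hinv k))) =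
  kap1 s k * W (hmul x0 k) + kap1 s k * W (hmul x0 (hinv k)) by rewrite mulrDr.
rewrite (funext e); split; last exact: (integrable_addr i1 i2).
rewrite (Rintegral_addr i1 i2).
have e2 : \int[leb]_k (kap1 s k * W (hmul x0 (hinv k))) =
    \int[leb]_k (kap1 s k * W (hmul x0 k)).
  transitivity (\int[leb]_k (kap1 s (hinv k) * W (hmul x0 (hinv k)))).
    by apply: eq_Rintegral => k _; rewrite kap1V.
  apply: (@Rintegral_scales1 _ _ (@hinv R n) (fun k => kap1 s k * W (hmul x0 k))).
  - exact: scales_hinv.
  - by apply: measurable_funM => //; exact: measurable_kap1.
  - by move=> x; rewrite mulr_ge0// kap1_ge0.
apply: (etrans (congr1 (fun z => _ + z) e2)).
by rewrite mulr_natl mulr2n.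
Qed.

Let J := \int[leb]_x (kap1 s x * Vp x).
Let T := \int[leb]_x (kap1 s x * Vm x).
Let A1 := \int[leb]_k kap1 (n := n) s k.
Let A2 := cnear n s.

(** At a minimum point x0 of V - t phi over the ball of radius 2, with t large
    enough for the minimum to be negative, x0 lies where the barrier phi is
    positive. The increments Z k of V - t phi at x0 are then nonnegative after
    adding the negative part of V, so that they have a larger integral against
    the singular kernel than against its truncation; and the integral of Z k + Z
    k^-1 against the kernel is at most that of t diff2 phi, because the equation
    kills the contribution of V. The slack delta makes t positive when V
    vanishes at x1. *)
Lemma harnack_lower_delta x1 delta : hnorm x1 <= 1 -> 0 < delta ->
  exists2 x0 : H, hnorm x0 <= 2 &
  \int[leb]_k (kap1 s k * Vp (hmul x0 k)) <=
  (4 * A2 + 5 * A1) * (2 * V x1 + delta) + \int[leb]_k (kap1 s k * Vm (hmul x0 k)).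
Proof.
move=> x11 d0.
have V10 : 0 <= V x1 by apply: V0; apply: le_lt_trans x11 _; rewrite ltr1n.
(* phi x1 >= 15/16 > 1/2, so V - t phi is negative at x1 *)
set t := 2 * V x1 + delta; have t0 : 0 < t by rewrite /t; lra.
pose P (x : H) := 1 - hnorm4 x / 16.
pose phi x := Num.max (P x) 0.
have phi_le1 x : phi x <= 1.
  by rewrite /phi /P ge_max ler01 andbT; have := hnorm4_ge0 x; lra.
have phi_ge0 x : 0 <= phi x by rewrite /phi le_max lexx orbT.
have phi_P x : P x <= phi x by rewrite /phi le_max lexx.
have hn4 x : hnorm x <= 2 -> hnorm4 x <= 16.
  by rewrite hnorm_le// => h; apply: le_trans h _; lra.
have phiE x : hnorm x <= 2 -> phi x = P x.
  by move=> /hn4 h; rewrite /phi max_l// /P; lra.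
have phi_out x : 2 < hnorm x -> phi x = 0.
  move=> h; rewrite /phi max_r// /P.
  have : ~~ (hnorm4 x <= 2 ^+ 4) by rewrite -hnorm_le// -ltNge.
  by rewrite -ltNge; lra.
have cW : continuous (fun x => V x - t * P x).
  apply: continuous_subr => //.
  apply: (@continuous_mulr R n (cst t) P) (continuous_barrier n).
  exact: (elementary_continuous (elementary_cst t)).
have [||x0] := @EVT_min_rV R _ (fun x => V x - t * P x) [set x : H | hnorm x <= 2] _ (@compact_hnorm_le R n 2 (ler0n _ 2)).
- by exists 0; rewrite /= hnorm0.
- exact: continuous_subspaceT.
rewrite inE /= => x02 x0min.
exists x0 => //.
have x0min' y : hnorm y <= 2 -> V x0 - t * phi x0 <= V y - t * phi y.
  by move=> y2; rewrite !phiE//; apply: x0min; rewrite inE.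
have W0 : V x0 - t * phi x0 < 0.
  have h1 : hnorm x1 <= 2 by apply: le_trans x11 _; rewrite ler1n.
  apply: le_lt_trans (x0min' _ h1) _; rewrite phiE// /P.
  have : hnorm4 x1 <= 1 ^+ 4 by rewrite -hnorm_le.
  by rewrite expr1n /t; nra.
have Vx0 : 0 <= V x0 by apply: V0; apply: le_lt_trans x02 _; rewrite ltr_nat.
have Px0 : 0 < phi x0 by rewrite -(pmulr_rgt0 _ t0); lra.
pose Z k := (V (hmul x0 k) - t * phi (hmul x0 k)) - (V x0 - t * phi x0).
have Zm k : 0 <= Z k + Vm (hmul x0 k).
  rewrite /Z; have [h|h] := leP (hnorm (hmul x0 k)) 2.
    by have := x0min' _ h; have := Vm_ge0 (hmul x0 k); lra.
  by rewrite phi_out// VpE; have := Vp_ge0 (hmul x0 k); lra.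
have Zp k : Vp (hmul x0 k) <= Z k + Vm (hmul x0 k) + t.
  rewrite /Z VpE; have := phi_le1 (hmul x0 k); have := phi_ge0 (hmul x0 k); nra.
(* V is nonnegative in the ball of radius 3, so only |k| >= 1 matters *)
have VmE k : kap s k * Vm (hmul x0 k) = kap1 s k * Vm (hmul x0 k).
  have [k1|k1] := leP 1 (hnorm k); first by rewrite kap1_far.
  rewrite Vm0 ?mulr0// (le_lt_trans (hnorm_triangle _ _))//.
  have -> : (3 : R) = 2 + 1 by ring.
  by apply: ler_ltD.
(* the quantity of Zm is nonnegative, hence may be multiplied by kap instead of kap1 *)
have one k : kap1 s k * Vp (hmul x0 k) <=
   kap s k * Z k + kap1 s k * Vm (hmul x0 k) + t * kap1 s k.
  have [->|k0] := eqVneq k 0.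
    rewrite kap0// mul0r add0r hmul0 -[leLHS]add0r lerD ?mulr_ge0 ?kap1_ge0//.
    rewrite mulrC ler_wpM2r ?kap1_ge0//.
    by have := Zp 0; rewrite hmul0 /Z hmul0 subrr add0r Vm0 ?add0r// (le_lt_trans x02)// ltr_nat.
  have h1 := ler_wpM2l (kap1_ge0 s k) (Zp k).
  have h2 := ler_wpM2r (Zm k) (kap1_le_kap s01 k0).
  by have h3 := VmE k; lra.
have Z2 k : Z k + Z (hinv k) = t * diff2 phi x0 k - diff2 V x0 k.
  by rewrite /Z /diff2; ring.
have D2 k : kap s k * diff2 phi x0 k <= 8 * (knear s 1 k + kap1 s k).
  have [k1|k1] := leP 1 (hnorm k).
    rewrite kap1_far// mulrC (@le_trans _ _ (2 * kap s k))//.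
      apply: ler_wpM2r; first exact: kap_ge0.
      rewrite /diff2; have := phi_le1 x0; have := phi_ge0 (hmul x0 k).
      by have := phi_ge0 (hmul x0 (hinv k)); lra.
    by have := knear_ge0 s 1 k; have := kap_ge0 s k; lra.
  have kn : knear s 1 k = hnorm k ^+ 2 * kap s k.
    by rewrite /knear indicE mem_set ?mulr1.
  have := hnorm4_second_difference x02 (ltW k1) => h.
  have : diff2 phi x0 k <= 8 * hnorm k ^+ 2.
    rewrite /diff2 phiE//; have := phi_P (hmul x0 k); have := phi_P (hmul x0 (hinv k)).
    by rewrite /P; have := sqr_ge0 (hnorm k); lra.
  move=> /(ler_wpM2l (kap_ge0 s k)); rewrite kn.
  by have := kap1_ge0 s k; lra.
have main k : kap1 s k * (Vp (hmul x0 k) + Vp (hmul x0 (hinv k))) <=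
  (8 * t) * (knear s 1 k + kap1 s k) + - (kap s k * diff2 V x0 k)
  + (kap1 s k * (Vm (hmul x0 k) + Vm (hmul x0 (hinv k))) + (2 * t) * kap1 s k).
  have h1 := one k; have h2 := one (hinv k); rewrite kapV kap1V in h2.
  have h3 := congr1 (fun z => kap s k * z) (Z2 k); rewrite /= in h3.
  have h4 := ler_wpM2l (ltW t0) (D2 k).
  lra.
have [ep ip] := RintV x0 mVp Vp_le; have [em im] := RintV x0 mVm Vm_le.
have ik := integrable_knear n s01 ltr01; have ik1 := integrable_kap1 n s01.
have iV0 := iV x02.
have i1 := integrable_scaler (8 * t) (integrable_addr ik ik1).
have i2 := integrable_addr i1 (integrable_oppr iV0).
have i3 := integrable_addr im (integrable_scaler (2 * t) ik1).
have := le_Rintegral measurableT ip (integrable_addr i2 i3) (fun k _ => main k).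
rewrite ep (Rintegral_addr i2 i3) (Rintegral_addr i1 (integrable_oppr iV0)) Rintegral_scaler; last exact: integrable_addr.
rewrite Rintegral_addr// Rintegral_oppr// eV// Rintegral_addr//; last exact: integrable_scaler.
rewrite em Rintegral_scaler// Rintegral_knear// powR1 mul1r -/A2 -/A1.
by rewrite oppr0 addr0; lra.
Qed.

Let K3 := 3 `^ p.
Let K3_ge0 : 0 <= K3. Proof. exact: powR_ge0. Qed.
Let A1_ge0 : 0 <= A1. Proof. by apply: Rintegral_ge0 => k _; exact: kap1_ge0. Qed.
Let A2_ge0 : 0 <= A2. Proof. exact: cnear_ge0. Qed.

(** The bound at x0 is translated to the origin, and delta tends to 0. *)
Lemma harnack_lower x1 : hnorm x1 <= 1 ->
  J <= K3 * (8 * A2 + 10 * A1) * V x1 + K3 ^+ 2 * T.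
Proof.
move=> x11; set B := 4 * A2 + 5 * A1.
have B0 : 0 <= B by rewrite addr_ge0 ?mulr_ge0.
apply/ler_addgt0Pr => e e0.
have d0 : 0 < e / (K3 * B + 1) by rewrite divr_gt0// ltr_wpDl// mulr_ge0.
have [x0 x02 h] := harnack_lower_delta x11 d0.
have [_ h1] := Rintegral_kap1_translate s01 mVp Vp_le x02.
have [h2 _] := Rintegral_kap1_translate s01 mVm Vm_le x02.
rewrite -/K3 -/J -/T -/B in h h1 h2.
apply: le_trans h1 _; apply: le_trans (ler_wpM2l K3_ge0 h) _.
have h3 := ler_wpM2l K3_ge0 h2.
have h4 : K3 * B * (e / (K3 * B + 1)) <= e.
  rewrite mulrA ler_pdivrMr ?ltr_wpDl ?mulr_ge0//; nra.
rewrite /B in h4 *; lra.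
Qed.

Lemma integrable_indic_hb a : 0 < a ->
  leb.-integrable setT (EFin \o (\1_(hb a) : H -> R)) /\
  \int[leb]_k (\1_(hb a) k : R) = a ^+ Q * hvol R n.
Proof.
move=> a0; have mh := @measurable_hb R n a.
have e : (\int[leb]_k (\1_(hb a) k)%:E = (a ^+ Q * hvol R n)%:E)%E.
  by rewrite integral_indic// setIT; exact: leb_hb.
split; last by rewrite /Rintegral e.
apply/integrableP; split; first by apply/measurable_EFinP; exact: measurable_indic.
by under eq_integral do rewrite /= indicE ger0_norm // -indicE; rewrite e ltry.
Qed.

Variable CT : R.
Hypothesis CT0 : 0 <= CT.
Hypothesis taylor : forall e : R, 2^-1 <= e ->
  (e ^+ Q)^-1 <= 1 - Q%:R * (e - 1) + CT * (e - 1) ^+ 2.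

(** The constant of the lower bound of second increments at a maximum of V d^Q:
    8 Q comes from the second increments of d, 162 = 2 . 81 from the squares of
    its first increments. *)
Let CU : R := 8 * Q%:R + 162 * CT.
(** The radius of the ball around the maximum point is theta d(x0): small enough
    for d to vary by a factor at most 2 there, and for the error term CU to be
    absorbed by the measure of the ball. *)
Let theta : R := (18 + CU * A2 / hvol R n)^-1.

Let CU_ge0 : 0 <= CU. Proof. by rewrite addr_ge0 ?mulr_ge0. Qed.

Let theta_bounds : [/\ 0 < theta, 18 * theta <= 1 & CU * theta ^+ 2 * A2 <= hvol R n].
Proof.
have v0 := hvol_gt0 R n; set X := CU * A2 / hvol R n.
have X0 : 0 <= X by rewrite divr_ge0 ?mulr_ge0 ?(ltW v0).
have t0 : 0 < 18 + X by lra.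
have th0 : 0 < theta by rewrite invr_gt0.
have E : theta * (18 + X) = 1 by rewrite mulVf// gt_eqF.
have th18 : 18 * theta <= 1 by nra.
split => //.
have -> : CU * theta ^+ 2 * A2 = (X * theta) * theta * hvol R n.
  by rewrite /X; field; rewrite gt_eqF.
have Xt : X * theta <= 1 by lra.
have t1 : theta <= 1 by lra.
by rewrite ler_piMl ?(ltW v0)// mulr_ile1// ?(ltW th0)// mulr_ge0// ltW.
Qed.

(** At a maximum point x0 of V d^Q, V x <= V x0 (d x0 / d x)^Q near x0, and the
    Taylor bound for e^-Q gives diff2 V x0 k >= - c |k|^2 for |k| < a. There the
    kernel is at least a^-p, so the equation, where only the positive part of V
    can contribute with the wrong sign, bounds a^-p a^Q V x0 by a^-p J. The
    power a^Q is the Q in V d^Q. *)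
Lemma harnack_upper x : hnorm x <= 1 ->
  V x <= (16 / 15) ^+ Q * (2 * (theta ^+ Q)^-1 * K3 / hvol R n) * J.
Proof.
move=> x1; have v0 := hvol_gt0 R n; have [th0 th1 th2] := theta_bounds.
have J0 : 0 <= J by apply: Rintegral_ge0 => k _; rewrite mulr_ge0 ?kap1_ge0.
have [Vx0|Vx0] := leP (V x) 0.
  apply: le_trans Vx0 _; apply: mulr_ge0 => //; apply: mulr_ge0.
    by rewrite exprn_ge0// divr_ge0.
  by rewrite !mulr_ge0 ?invr_ge0 ?exprn_ge0 ?(ltW th0) ?(ltW v0).
pose d (y : H) := 1 - hnorm4 y / 16.
have cd : continuous (fun y => V y * d y ^+ Q).
  apply: continuous_mulr => //.
  elim: (Q) => [|m IH]; first exact: (elementary_continuous (elementary_cst 1)).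
  rewrite (_ : (fun y => _) = fun y => d y * d y ^+ m); last first.
    by apply/funext => y; rewrite exprS.
  exact: (continuous_mulr (continuous_barrier n) IH).
have [||x0] := @EVT_max_rV R _ (fun y => V y * d y ^+ Q) [set y : H | hnorm y <= 2] _
    (@compact_hnorm_le R n 2 (ler0n _ 2)).
- by exists 0; rewrite /= hnorm0.
- exact: continuous_subspaceT.
rewrite inE /= => x02 x0max'.
have x0max y : hnorm y <= 2 -> V y * d y ^+ Q <= V x0 * d x0 ^+ Q.
  by move=> y2; apply: x0max'; rewrite inE.
have dpos y : hnorm y <= 2 -> 0 <= d y.
  by rewrite hnorm_le// /d => h; lra.
have dneg y : 0 < d y -> hnorm y <= 2.
  by rewrite hnorm_le// /d => h; lra.
have dx : 15 / 16 <= d x.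
  by move: x1; rewrite hnorm_le// expr1n /d; lra.
have x2 : hnorm x <= 2 by apply: le_trans x1 _; rewrite ler1n.
have Mx : 0 < V x0 * d x0 ^+ Q.
  apply: lt_le_trans (x0max _ x2); rewrite mulr_gt0// exprn_gt0//; lra.
have V0x0 : 0 <= V x0 by apply: V0; apply: le_lt_trans x02 _; rewrite ltr_nat.
have Vx00 : 0 < V x0.
  by rewrite lt_neqAle V0x0 andbT eq_sym; apply/eqP => e; rewrite e mul0r ltxx in Mx.
have d00 : 0 < d x0.
  rewrite lt_neqAle dpos// andbT eq_sym; apply/eqP => e; move: Mx.
  by rewrite e expr0n /hdim addn2 /= mulr0 ltxx.
have d01 : d x0 <= 1 by rewrite /d; have := hnorm4_ge0 x0; lra.
set d0 := d x0 in d00 d01 Mx x0max *.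
pose a := theta * d0.
have a0 : 0 < a by rewrite mulr_gt0.
have a1 : a <= 1 by rewrite /a; nra.
have ad : 18 * a <= d0 by rewrite /a mulrA ler_piMl// ltW.
pose c := V x0 * CU / d0 ^+ 2.
have c0 : 0 <= c by apply: divr_ge0; [exact: mulr_ge0|exact: sqr_ge0].
(* 130 / 16 <= 9 in hnorm4_first_difference *)
have dlip k : hnorm k < a -> `|d (hmul x0 k) - d0| <= 9 * hnorm k.
  move=> ka; have k1 : hnorm k <= 1 by rewrite ltW// (lt_le_trans ka).
  have := hnorm4_first_difference x02 k1; rewrite /d0 /d => h.
  rewrite (_ : _ - _ = - (16^-1 * (hnorm4 (hmul x0 k) - hnorm4 x0))); last by ring.
  rewrite normrN normrM ger0_norm ?invr_ge0//; have := hnorm_ge0 k; lra.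
have Vk k : hnorm k < a -> let e := d (hmul x0 k) / d0 in
    [/\ V (hmul x0 k) <= V x0 * (1 - Q%:R * (e - 1) + CT * (e - 1) ^+ 2)
      & (e - 1) ^+ 2 <= 81 * hnorm k ^+ 2 / d0 ^+ 2].
  move=> ka e; have h := dlip k ka.
  have [h1 h2] := ler_normlP _ _ h.
  have e2 : 2^-1 <= e by rewrite /e ler_pdivlMr//; lra.
  have e0 : 0 < e by apply: lt_le_trans e2; rewrite invr_gt0.
  have eE : e - 1 = (d (hmul x0 k) - d0) / d0 by rewrite /e; field; rewrite gt_eqF.
  split; last first.
    rewrite eE expr_div_n ler_pM2r ?invr_gt0 ?exprn_gt0//.
    have -> : 81 * hnorm k ^+ 2 = (9 * hnorm k) ^+ 2 by ring.
    rewrite -(real_normK (num_real (d _ - d0))) ler_pXn2r ?nnegrE//.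
    by rewrite mulr_ge0 ?hnorm_ge0.
  have dk : 0 < d (hmul x0 k) by rewrite -(pmulr_lgt0 _ (_ : 0 < d0^-1)) ?invr_gt0.
  have := x0max _ (dneg _ dk).
  have -> : d (hmul x0 k) = e * d0 by rewrite /e divfK// gt_eqF.
  rewrite exprMn mulrA ler_pM2r ?exprn_gt0// => h3.
  apply: (@le_trans _ _ (V x0 * (e ^+ Q)^-1)).
    by rewrite ler_pdivlMr// exprn_gt0.
  by rewrite ler_pM2l//; exact: taylor.
have D2 k : hnorm k < a -> - (c * hnorm k ^+ 2) <= diff2 V x0 k.
  move=> ka; have k1 : hnorm k <= 1 by rewrite ltW// (lt_le_trans ka).
  have [h1 h2] := Vk k ka.
  have ka' : hnorm (hinv k) < a by rewrite hnormV.
  have [h3 h4] := Vk _ ka'; rewrite hnormV in h4.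
  set e1 := d (hmul x0 k) / d0 in h1 h2; set e2 := d (hmul x0 (hinv k)) / d0 in h3 h4.
  have h5 : 2 - e1 - e2 <= 8 * hnorm k ^+ 2 / d0 ^+ 2.
    have -> : 2 - e1 - e2 = (2 * d0 - d (hmul x0 k) - d (hmul x0 (hinv k))) / d0.
      by rewrite /e1 /e2; field; rewrite gt_eqF.
    have -> : 8 * hnorm k ^+ 2 / d0 ^+ 2 = 8 * hnorm k ^+ 2 / d0 / d0.
      by field; rewrite gt_eqF.
    rewrite ler_pM2r ?invr_gt0//.
    have := hnorm4_second_difference x02 k1 => h.
    apply: (@le_trans _ _ (8 * hnorm k ^+ 2)).
      by rewrite /d0 /d; have := sqr_ge0 (hnorm k); lra.
    by rewrite ler_pdivlMr// ler_piMr// mulr_ge0// sqr_ge0.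
  rewrite /diff2 /c; set w := hnorm k ^+ 2 / d0 ^+ 2.
  have -> : V x0 * CU / d0 ^+ 2 * hnorm k ^+ 2 = V x0 * (CU * w) by rewrite /w; ring.
  rewrite -mulrA -/w in h2; rewrite -mulrA -/w in h4; rewrite -mulrA -/w in h5.
  have q0 : 0 <= Q%:R :> R by [].
  have f1 : (1 - Q%:R * (e1 - 1) + CT * (e1 - 1) ^+ 2) +
            (1 - Q%:R * (e2 - 1) + CT * (e2 - 1) ^+ 2) <= 2 + CU * w.
    have g1 := ler_wpM2l q0 h5; have g2 := ler_wpM2l CT0 h2; have g3 := ler_wpM2l CT0 h4.
    by rewrite /CU; lra.
  have f2 := ler_wpM2l V0x0 f1; lra.
pose alpha := a `^ (- p).
have alpha0 : 0 < alpha by exact: powR_gt0.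
(* outside the ball of radius a only V_+ is kept; inside, kap is replaced by its
   minimum alpha, at the price of the lower bound D2 *)
have main k : 2 * alpha * V x0 * \1_(hb a) k <=
    kap s k * diff2 V x0 k + (alpha * (kap1 s k * (Vp (hmul x0 k) + Vp (hmul x0 (hinv k))))
    + c * knear s a k).
  have [ka|ka] := ltP (hnorm k) a; last first.
    have nk : k \in hb a = false by apply/negP; rewrite inE /hb /=; apply/negP; rewrite -leNgt.
    rewrite /knear indicE nk !mulr0 addr0.
    have a01 : 0 < a <= 1 by rewrite a0.
    have h1 := kap_le_kap1 s01 a01 ka.
    set Y := Vp (hmul x0 k) + Vp (hmul x0 (hinv k)).
    have Y0 : 0 <= Y by rewrite addr_ge0.
    have h2 : - Y <= diff2 V x0 k.
      rewrite /diff2 /Y (VpE (hmul x0 k)) (VpE (hmul x0 (hinv k))).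
      by have := Vm_ge0 (hmul x0 k); have := Vm_ge0 (hmul x0 (hinv k)); lra.
    have h3 := ler_wpM2l (kap_ge0 s k) h2; have h4 := ler_wpM2r Y0 h1.
    rewrite -/alpha in h4; lra.
  have k1 : hnorm k < 1 by apply: lt_le_trans a1.
  have ik : \1_(hb a) k = 1 :> R by rewrite indicE mem_set.
  rewrite /knear ik !mulr1 kap1_near// mul1r.
  have in3 y : hnorm y < 1 -> Vp (hmul x0 y) = V (hmul x0 y).
    move=> y1; rewrite (VpE (hmul x0 y)) Vm0 ?subr0//.
    rewrite (le_lt_trans (hnorm_triangle _ _))//.
    by have -> : (3 : R) = 2 + 1 by [ring]; apply: ler_ltD.
  rewrite !in3 ?hnormV//.
  suff h : alpha * diff2 V x0 k <= kap s k * diff2 V x0 k + c * (hnorm k ^+ 2 * kap s k).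
    by move: h; rewrite {1}/diff2; lra.
  have [->|k0] := eqVneq k 0.
    by rewrite /diff2 hinv0 hmul0 kap0// hnorm0 mul0r; have -> : 2 * V x0 - V x0 - V x0 = 0 by [ring]; rewrite expr0n /= !mul0r !mulr0 addr0.
  have kk : alpha <= kap s k.
    have hk : 0 < hnorm k.
      by rewrite lt_neqAle hnorm_ge0 andbT eq_sym; apply: contra k0 => /eqP/hnorm_eq0 ->.
    rewrite /alpha /kap !powRN lef_pV2 ?posrE; last 2 first.
    - exact: powR_gt0.
    - exact: powR_gt0.
    apply: powR_le_hexp => //; [exact: hnorm_ge0|exact: ltW].
  have h1 := D2 k ka; have kge := kap_ge0 s k.
  have [Dp|Dn] := leP 0 (diff2 V x0 k).
    have : 0 <= c * (hnorm k ^+ 2 * kap s k).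
      by apply: mulr_ge0 => //; apply: mulr_ge0 => //; exact: sqr_ge0.
    have := ler_wpM2r Dp kk; lra.
  have h2 := ler_wpM2l kge h1.
  have : alpha * diff2 V x0 k <= 0 by rewrite pmulr_rle0// ltW.
  lra.
have [ep ip] := RintV x0 mVp Vp_le.
have [ih eh] := integrable_indic_hb a0.
have iV0 := iV x02; have ikn := integrable_knear n s01 a0.
have i1 := integrable_scaler alpha ip; have i2 := integrable_scaler c ikn.
have i3 := integrable_addr i1 i2.
have := le_Rintegral measurableT (integrable_scaler (2 * alpha * V x0) ih) (integrable_addr iV0 i3) (fun k _ => main k).
rewrite (Rintegral_scaler (2 * alpha * V x0) ih) eh (Rintegral_addr iV0 i3) eV// add0r.
rewrite (Rintegral_addr i1 i2) (Rintegral_scaler alpha ip) (Rintegral_scaler c ikn) ep.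
rewrite (Rintegral_knear n s01 a0) -/A2 => fin.
have [h1 _] := Rintegral_kap1_translate s01 mVp Vp_le x02.
rewrite -/K3 -/J in h1.
set J1 := \int[leb]_k _ in h1 fin.
have ea : alpha = a `^ (- (2 * s)) * (a ^+ Q)^-1.
  rewrite /alpha -powR_mulrn ?(ltW a0)// -powRN -powRD ?(gt_eqF a0) ?implybT//.
  by congr powR; rewrite /hexp; ring.
have eb : a `^ (2 - 2 * s) = a `^ (- (2 * s)) * a ^+ 2.
  rewrite -powR_mulrn ?(ltW a0)// -powRD ?(gt_eqF a0) ?implybT//.
  by congr powR; ring.
set b := a `^ (- (2 * s)) in ea eb.
have b0 : 0 < b by exact: powR_gt0.
have aQ : 0 < a ^+ Q by rewrite exprn_gt0.
(* all terms carry the factor a^(-2 s), which cancels *)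
have fin2 : 2 * V x0 * hvol R n <= 2 * (a ^+ Q)^-1 * J1 + V x0 * (CU * theta ^+ 2 * A2).
  rewrite -(ler_pM2l b0).
  have -> : b * (2 * V x0 * hvol R n) = 2 * alpha * V x0 * (a ^+ Q * hvol R n).
    by rewrite ea; field; rewrite gt_eqF.
  apply: le_trans fin _; rewrite ea eb le_eqVlt; apply/orP; left; apply/eqP.
  by rewrite /c /a; field; rewrite !gt_eqF.
(* the error term is at most half of the left-hand side by the choice of theta *)
have fin3 : V x0 * hvol R n <= 2 * (a ^+ Q)^-1 * (K3 * J).
  have g1 := ler_wpM2l V0x0 th2.
  have aQi : 0 <= 2 * (a ^+ Q)^-1 by rewrite mulr_ge0// invr_ge0 ltW.
  have g2 := ler_wpM2l aQi h1; lra.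
have tQ : 0 < theta ^+ Q by rewrite exprn_gt0.
have dQ : 0 < d0 ^+ Q by rewrite exprn_gt0.
have fin4 : V x0 * d0 ^+ Q <= 2 * (theta ^+ Q)^-1 * K3 / hvol R n * J.
  rewrite (_ : _ * J = (2 * (theta ^+ Q)^-1 * K3 * J) / hvol R n); last by ring.
  rewrite ler_pdivlMr//.
  have := ler_wpM2r (ltW dQ) fin3.
  rewrite /a exprMn invfM (_ : 2 * ((theta ^+ Q)^-1 * (d0 ^+ Q)^-1) * (K3 * J) * d0 ^+ Q =
    2 * (theta ^+ Q)^-1 * K3 * J); first by lra.
  by field; rewrite !gt_eqF.
have fin5 := le_trans (x0max _ x2) fin4.
have h15 : (15 / 16) ^+ Q <= d x ^+ Q.
  by apply: lerXn2r => //; rewrite nnegrE ?dpos// divr_ge0.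
have := le_trans (ler_wpM2l (ltW Vx0) h15) fin5.
rewrite -ler_pdivlMr; last by rewrite exprn_gt0//; lra.
have -> : ((15 / 16) ^+ Q)^-1 = (16 / 15) ^+ Q :> R by rewrite -exprVn invf_div.
by move=> h; apply: le_trans h _; rewrite le_eqVlt; apply/orP; left; apply/eqP; ring.
Qed.

End pointwise_harnack.

(** Combines harnack_upper at x with harnack_lower at y. *)
Theorem pointwise_harnack (R : realType) (n : nat) (s : R) : 0 < s < 1 ->
  exists2 C : R, 0 < C & forall (V : heis R n -> R) (C0 : R),
    measurable_fun setT V -> (forall x, `|V x| <= C0) -> continuous V ->
    (forall x, hnorm x < 3 -> 0 <= V x) ->
    (forall x, hnorm x <= 2 -> (lebesgue_rV R (n + n + 1)).-integrable setT
      (EFin \o (fun k => kap s k * diff2 V x k))) ->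
    (forall x, hnorm x <= 2 ->
      \int[lebesgue_rV R (n + n + 1)]_k (kap s k * diff2 V x k) = 0) ->
    forall x y, hnorm x <= 1 -> hnorm y <= 1 ->
      V x <= C * (V y +
        \int[lebesgue_rV R (n + n + 1)]_z (kap1 s z * Num.max (- V z) 0)).
Proof.
move=> s01; have [CT CT0 hT] := exprV_taylor R (hdim n).
pose c1 := 3 `^ hexp n s * (8 * cnear n s + 10 * \int[lebesgue_rV R (n + n + 1)]_k kap1 (n := n) s k).
pose c2 := (3 `^ hexp n s) ^+ 2.
pose th : R := (18 + (8 * (hdim n)%:R + 162 * CT) * cnear n s / hvol R n)^-1.
pose c3 := (16 / 15) ^+ hdim n * (2 * (th ^+ hdim n)^-1 * 3 `^ hexp n s / hvol R n).
have A10 : 0 <= \int[lebesgue_rV R (n + n + 1)]_k kap1 (n := n) s k.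
  by apply: Rintegral_ge0 => k _; exact: kap1_ge0.
have A20 := cnear_ge0 n s.
have K0 : 0 <= 3 `^ hexp n s by exact: powR_ge0.
have v0 := hvol_gt0 R n.
have c10 : 0 <= c1 by rewrite mulr_ge0// addr_ge0// mulr_ge0.
have c20 : 0 <= c2 by exact: sqr_ge0.
have th0 : 0 <= th.
  rewrite invr_ge0 addr_ge0//; apply: divr_ge0; last exact: ltW.
  apply: mulr_ge0; last exact: A20.
  by apply: addr_ge0; apply: mulr_ge0; rewrite ?ler0n.
have c30 : 0 <= c3.
  apply: mulr_ge0; first by rewrite exprn_ge0// divr_ge0.
  by rewrite !mulr_ge0 ?invr_ge0 ?exprn_ge0 ?(ltW v0).
exists (c3 * (c1 + c2) + 1); first by rewrite ltr_wpDl// mulr_ge0// addr_ge0.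
move=> V C0 mV bV cV V0 iV eV x y x1 y1.
have h1 := harnack_upper s01 mV bV cV V0 iV eV CT0 hT x1.
have h2 := harnack_lower s01 mV bV cV V0 iV eV y1.
rewrite -/th -/c3 in h1; rewrite -/c1 -/c2 in h2.
set J := \int[_]_z (kap1 s z * Num.max (V z) 0) in h1 h2.
set T := \int[_]_z _ in h2 *.
have T0 : 0 <= T.
  by apply: Rintegral_ge0 => k _; rewrite mulr_ge0 ?kap1_ge0// le_max lexx orbT.
have Vy0 : 0 <= V y by apply: V0; apply: le_lt_trans y1 _; rewrite ltr1n.
apply: le_trans h1 _; apply: le_trans (ler_wpM2l c30 h2) _.
have := mulr_ge0 c30 (mulr_ge0 c10 T0); have := mulr_ge0 c30 (mulr_ge0 c20 Vy0); lra.
Qed.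

(** * Similarities and the energy *)

Section product_change.
Context d1 d2 (X : measurableType d1) (Y : measurableType d2) (R : realType).
Variables (mu : {measure set X -> \bar R}) (nu : {measure set Y -> \bar R}).
Variables (T : X -> Y) (J : R).
Hypotheses (mT : measurable_fun setT T) (J0 : 0 < J).
Hypothesis TJ : forall f : Y -> \bar R, measurable_fun setT f -> (forall y, 0 <= f y)%E ->
  (\int[nu]_y f y = J%:E * \int[mu]_x f (T x))%E.

Lemma integrable_change (f : Y -> \bar R) : nu.-integrable setT f ->
  mu.-integrable setT (f \o T).
Proof.
move=> /integrableP[mf fi]; apply/integrableP; split; first exact: measurableT_comp.
have mabs : measurable_fun setT (abse \o f) by exact: measurableT_comp.
have E := TJ mabs (fun=> abse_ge0 _).
rewrite /= in E fi *; rewrite E in fi.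
by case: (\int[_]_x _)%E fi => [r|//|] ;rewrite ?ltry ?gt0_muley ?lte_fin.
Qed.

(** The formula for nonnegative functions, applied to the positive and the
    negative part. *)
Lemma integral_change (f : Y -> \bar R) : nu.-integrable setT f ->
  (\int[nu]_y f y = J%:E * \int[mu]_x f (T x))%E.
Proof.
move=> fi; have fiT := integrable_change fi.
have /integrableP[mf _] := fi.
have Ep := TJ (measurable_funepos mf) (funepos_ge0 f).
have En := TJ (measurable_funeneg mf) (funeneg_ge0 f).
have -> : (\int[mu]_x f (T x) = \int[mu]_x f^\+ (T x) - \int[mu]_x f^\- (T x))%E.
  have := integralE mu setT (f \o T).
  under [X in (X - _)%E]eq_integral do rewrite funepos_comp.
  by under [X in (_ - X)%E]eq_integral do rewrite funeneg_comp.
rewrite [LHS]integralE Ep En; apply/esym/muleBr => //.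
apply: fin_num_adde_defl; rewrite fin_numN.
have := integrable_neg_fin_num measurableT fiT.
by under eq_integral do rewrite funeneg_comp.
Qed.

End product_change.

Section energy.
Variables (R : realType) (n : nat).
Local Notation H := (heis R n).
Local Notation leb := (lebesgue_rV R (n + n + 1)).
Local Notation Q := (hdim n).
Variables (xi0 : H) (r : R).
Hypothesis r0 : 0 < r.

Definition hsim (y : H) : H := hmul xi0 (hdil r y).

Lemma scales_hsim : scales_leb (r ^+ Q) hsim.
Proof.
rewrite -[r ^+ Q]mul1r; apply: (@scales_comp _ _ _ _ (hmul xi0) (hdil r)).
  exact: scales_hmull.
exact: scales_hdil.
Qed.

Lemma hsimM y k : hsim (hmul y k) = hmul (hsim y) (hdil r k).
Proof. by rewrite /hsim hdilM hmulA. Qed.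

(** Coordinates on pairs of points in which the kernel depends on the first one
    only: the increment k, and the base point y. *)
Definition hpairing (q : H * H) : H * H := (hsim (hmul q.2 q.1), hsim q.2).

Lemma measurable_hsim : measurable_fun setT hsim.
Proof. by have [_ ] := scales_hsim. Qed.

Lemma measurable_hpairing : measurable_fun setT hpairing.
Proof.
apply/measurable_fun_pairP; split.
  apply: (measurableT_comp measurable_hsim); apply: measurable_hmul.
    exact: measurable_snd.
  exact: measurable_fst.
exact: (measurableT_comp measurable_hsim measurable_snd).
Qed.

Lemma integral_hpairing (f : H * H -> \bar R) : measurable_fun setT f ->
  (forall q, 0 <= f q)%E ->
  (\int[(leb \x leb)%E]_q f q = (r ^+ Q * r ^+ Q)%:E * \int[(leb \x leb)%E]_q f (hpairing q))%E.
Proof.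
move=> mf f0.
have mfp : measurable_fun setT (f \o hpairing).
  exact: (measurableT_comp mf measurable_hpairing).
rewrite (fubini_tonelli2 _ mf f0) (fubini_tonelli2 _ mfp (fun q => f0 _)).
have mG := measurable_fun_fubini_tonelli_G (m1 := leb) _ mf f0.
have G0 y : (0 <= fubini_G leb f y)%E by apply: integral_ge0.
rewrite (ge0_integral_scales scales_hsim mG G0) EFinM -muleA; congr (_ * _)%E.
rewrite -ge0_integralZl_EFin ?exprn_ge0 ?(ltW r0)//; last 2 first.
- by move=> y _; apply: integral_ge0 => x _; exact: f0.
- exact: (measurable_fun_fubini_tonelli_G (m1 := leb) _ mfp (fun q => f0 _)).
apply: eq_integral => y _; rewrite /fubini_G.
have mfy : measurable_fun setT (fun x => f (x, hsim y)) by exact: measurable_fun_pair1.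
have sy : scales_leb (r ^+ Q) (fun k => hsim (hmul y k)).
  rewrite -[r ^+ Q]mulr1; apply: (@scales_comp _ _ _ _ hsim (hmul y)).
    exact: scales_hsim.
  exact: scales_hmull.
by rewrite (ge0_integral_scales sy mfy (fun x => f0 _)).
Qed.

End energy.

(** * Square-integrable functions and bumps *)

Lemma normM_le_sqr (R : realType) (a c : R) : `|a * c| <= a ^+ 2 + c ^+ 2.
Proof.
rewrite normrM -(real_normK (num_real a)) -(real_normK (num_real c)).
have := normr_ge0 a; have := normr_ge0 c; set x := `|a|; set y := `|c| => y0 x0.
have := sqr_ge0 (x - y); have := mulr_ge0 x0 y0; lra.
Qed.

Section square_integrable.
Context d (X : measurableType d) (R : realType) (mu : {measure set X -> \bar R}).
Implicit Types f g : X -> R.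

Definition square_integrable f := measurable_fun setT f /\ (\int[mu]_x (f x ^+ 2)%:E < +oo)%E.

Lemma Lfun2P f : f \in Lfun mu 2%:E <-> square_integrable f.
Proof.
have E : ('N[mu]_2%:E[EFin \o f] `^ 2 = \int[mu]_x (f x ^+ 2)%:E)%E.
  rewrite poweR_Lnorm//; apply: eq_integral => x _.
  by rewrite /= ?poweR_EFin powR_mulrn// real_normK// num_real.
split.
  move=> /andP[]; rewrite inE /= => mf; rewrite inE /= /finite_norm => fN.
  by split => //; rewrite -E; exact: poweR_lty.
move=> [mf fi]; apply/andP; split; first by rewrite inE.
rewrite inE /= /finite_norm; rewrite -E in fi.
by apply: lty_poweRy fi; rewrite pnatr_eq0.
Qed.

(** From |f g| <= f^2 + g^2. *)
Lemma integrable_mul_square f g : square_integrable f -> square_integrable g ->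
  mu.-integrable setT (EFin \o (fun x => f x * g x)).
Proof.
move=> [mf fi] [mg gi]; apply/integrableP; split.
  by apply/measurable_EFinP; exact: measurable_funM.
have msq (h : X -> R) : measurable_fun setT h -> measurable_fun setT (fun x => (h x ^+ 2)%:E).
  by move=> mh; apply/measurable_EFinP; exact: measurable_funX.
apply: (@le_lt_trans _ _ (\int[mu]_x ((f x ^+ 2)%:E + (g x ^+ 2)%:E))%E); last first.
  rewrite ge0_integralD//; try exact: msq; try by move=> x _; rewrite lee_fin sqr_ge0.
  by rewrite lte_add_pinfty.
apply: ge0_le_integral => //.
- by apply/measurable_EFinP; apply: measurableT_comp => //; exact: measurable_funM.
- by apply: emeasurable_funD; exact: msq.
by move=> x _; rewrite -EFinD lee_fin normM_le_sqr.
Qed.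

Lemma square_integrable_integrable f : square_integrable f ->
  mu.-integrable setT (EFin \o (fun x => f x ^+ 2)).
Proof. by move=> sf; exact: (integrable_mul_square sf sf). Qed.

End square_integrable.

Section mollification.
Variables (R : realType) (n : nat).
Local Notation H := (heis R n).
Local Notation leb := (lebesgue_rV R (n + n + 1)).
Local Notation Q := (hdim n).
Implicit Types x y k w : H.

Lemma hnorm4_quotient x y k : hnorm4 (hmul x (hinv (hmul y k))) =
  (hzsq (hmul x (hinv y)) - 2 * hdot (hmul x (hinv y)) k + hzsq k) ^+ 2 +
  (ht (hmul x (hinv y)) - (ht k + 2 * hsymp y k + 2 * hsymp x k)) ^+ 2.
Proof.
rewrite /hnorm4; congr (_ ^+ 2 + _ ^+ 2).
  rewrite hinvM hmulA.
  rewrite /hzsq /hdot !(hxM, hyM) /hinv !(hxN, hyN) !(dotrDl, dotrDr, dotrNl, dotrNr).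
  by rewrite (dotrC (hx k) (hx x)) (dotrC (hy k) (hy x)) (dotrC (hx k) (hx y)) (dotrC (hy k) (hy y)); ring.
rewrite !htM /hinv !htN htM.
rewrite /hsymp !(hxN, hyN, hxM, hyM, dotrDl, dotrDr, dotrNl, dotrNr).
rewrite ?(dotrC (hx k) (hy x)) ?(dotrC (hy k) (hx x)) ?(dotrC (hx k) (hy y)).
by rewrite ?(dotrC (hy k) (hx y)) ?(dotrC (hx y) (hy x)) ?(dotrC (hy y) (hx x)); ring.
Qed.

Definition quotient_lip (A : R) : R := 2 * (1 + 4 * A) * (1 + 4 * A + 8 * A ^+ 2).

(** Here k^-1 stands between x and y^-1, which costs the additional vertical
    shift 2 hsymp y k + 2 hsymp x k, of first order in k on bounded sets. *)
Lemma hnorm4_quotient_lipschitz A x y k : 1 <= A -> hnorm x <= A -> hnorm y <= A ->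
  hnorm k <= 1 ->
  `|hnorm4 (hmul x (hinv (hmul y k))) - hnorm4 (hmul x (hinv y))| <= quotient_lip A * hnorm k.
Proof.
move=> A1 xA yA k1; have k0 := hnorm_ge0 k.
rewrite hnorm4_quotient /hnorm4; set w := hmul x (hinv y).
have wA : hnorm w <= 2 * A.
  by rewrite (le_trans (hnorm_triangle _ _))// hnormV; lra.
have A0 : 0 <= A by lra.
have w2 : hnorm w ^+ 2 <= 4 * A ^+ 2.
  have -> : 4 * A ^+ 2 = (2 * A) ^+ 2 by ring.
  by rewrite ler_pXn2r ?nnegrE ?hnorm_ge0// mulr_ge0.
have kk : hnorm k ^+ 2 <= hnorm k by rewrite expr2 ler_piMl.
have symp_le z : `|hsymp z k| <= hnorm z * hnorm k /\ `|hdot z k| <= hnorm z * hnorm k.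
  have z0 := hnorm_ge0 z.
  have h : hdot z k ^+ 2 + hsymp z k ^+ 2 <= (hnorm z * hnorm k) ^+ 2.
    rewrite (le_trans (hdot_hsymp_le z k))// exprMn.
    by apply: ler_pM; rewrite ?hzsq_ge0 ?hzsq_le.
  split; rewrite -(@ler_pXn2r _ 2) ?nnegrE ?mulr_ge0// real_normK ?num_real//.
    by have := sqr_ge0 (hdot z k); lra.
  by have := sqr_ge0 (hsymp z k); lra.
have zA (z : H) B : hnorm z <= B -> hnorm z * hnorm k <= B * hnorm k by move=> ?; rewrite ler_wpM2r.
have [sx _] := symp_le x; have [sy _] := symp_le y; have [_ sw] := symp_le w.
have {}sx := le_trans sx (zA _ _ xA); have {}sy := le_trans sy (zA _ _ yA).
have {}sw := le_trans sw (zA _ _ wA).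
have a4 : hzsq w <= 4 * A ^+ 2 by rewrite (le_trans (hzsq_le w)).
have u4 : `|ht w| <= 4 * A ^+ 2 by rewrite (le_trans (ht_le w)).
have bk : hzsq k <= hnorm k by rewrite (le_trans (hzsq_le k)).
have tk : `|ht k| <= hnorm k by rewrite (le_trans (ht_le k)).
have [a0 b0] := (hzsq_ge0 w, hzsq_ge0 k).
set a := hzsq w in a4 a0 *; set b := hzsq k in bk b0 *; set u := ht w in u4 *.
set d := hdot w k in sw *; set v := ht k + 2 * hsymp y k + 2 * hsymp x k.
have hv : `|v| <= (1 + 4 * A) * hnorm k.
  have [t1 t2] := ler_normlP _ _ tk; have [x1 x2] := ler_normlP _ _ sx.
  have [y1 y2] := ler_normlP _ _ sy; rewrite /v; apply/ler_normlP; split; lra.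
have hk1 : (1 + 4 * A) * hnorm k <= 1 + 4 * A by rewrite ler_piMr//; lra.
have hb1 : `|b - 2 * d| <= (1 + 4 * A) * hnorm k.
  by have [d1 d2] := ler_normlP _ _ sw; apply/ler_normlP; split; lra.
have hb2 : `|2 * a + (b - 2 * d)| <= 1 + 4 * A + 8 * A ^+ 2.
  have [d1 d2] := ler_normlP _ _ hb1; apply/ler_normlP; split; lra.
have hv2 : `|v - 2 * u| <= 1 + 4 * A + 8 * A ^+ 2.
  have [d1 d2] := ler_normlP _ _ hv; have [u1 u2] := ler_normlP _ _ u4.
  by apply/ler_normlP; split; lra.
have -> : (a - 2 * d + b) ^+ 2 + (u - v) ^+ 2 - (a ^+ 2 + u ^+ 2) =
  (b - 2 * d) * (2 * a + (b - 2 * d)) + v * (v - 2 * u) by ring.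
have f1 := ler_pM (normr_ge0 _) (normr_ge0 _) hb1 hb2.
have f2 := ler_pM (normr_ge0 _) (normr_ge0 _) hv hv2.
rewrite (le_trans (ler_normD _ _))// !normrM /quotient_lip; lra.
Qed.

Variable eps : R.
Hypothesis eps01 : 0 < eps <= 1.

(** Smooth because |w|^4 is a polynomial and flat 0 is smooth; positive exactly
    where |w| < eps. *)
Definition hbump w : R := flat 0 (eps ^+ 4 - hnorm4 w).

Lemma bump_ge0 w : 0 <= hbump w. Proof. exact: flat_ge0. Qed.

Let eps_ge0 : 0 <= eps. Proof. by case/andP: eps01 => /ltW. Qed.

Lemma bump_eq0 w : eps <= hnorm w -> hbump w = 0.
Proof.
move=> h; apply: flat_le0; rewrite subr_le0 -hnorm_exp4.
by rewrite ler_pXn2r ?nnegrE ?hnorm_ge0.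
Qed.

Lemma bump_gt0 w : hnorm w < eps -> 0 < hbump w.
Proof. by rewrite hnorm_lt// => h; apply: flat_gt0; rewrite subr_gt0. Qed.

Lemma bumpV w : hbump (hinv w) = hbump w.
Proof. by rewrite /hbump hnorm4V. Qed.

Lemma measurable_flat (j : nat) : measurable_fun setT (flat j : R -> R).
Proof.
apply: continuous_measurable_fun => t.
exact: differentiable_continuous (differentiable_flat j t).
Qed.

Lemma measurable_bump d (X : measurableType d) (f : X -> H) : measurable_fun setT f ->
  measurable_fun setT (fun z => hbump (f z)).
Proof.
move=> mf; apply: (measurableT_comp (measurable_flat 0)).
by apply: measurable_funB => //; exact: measurable_hnorm4.
Qed.

Lemma bump_bounded : exists2 C : R, 0 < C & forall w, hbump w <= C.
Proof.
have [C C0 h] := flat_bounded R 0; exists C => // w.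
exact: le_trans (ler_norm _) (h _).
Qed.

Lemma bump_lipschitz A : 1 <= A -> exists2 C : R, 0 <= C & forall x y k,
  hnorm x <= A -> hnorm y <= A -> hnorm k <= 1 ->
  `|hbump (hmul x (hinv (hmul y k))) - hbump (hmul x (hinv y))| <= C * hnorm k.
Proof.
move=> A1; have [L L0 hL] := flat0_lipschitz R.
have q0 : 0 <= quotient_lip A.
  by rewrite /quotient_lip !mulr_ge0 ?addr_ge0 ?mulr_ge0 ?sqr_ge0//; lra.
exists (L * quotient_lip A); first by rewrite mulr_ge0// ltW.
move=> x y k xA yA k1; apply: le_trans (hL _ _) _.
rewrite -mulrA ler_wpM2l ?(ltW L0)//.
rewrite (_ : _ - _ = - (hnorm4 (hmul x (hinv (hmul y k))) - hnorm4 (hmul x (hinv y)))); last by ring.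
by rewrite normrN; exact: hnorm4_quotient_lipschitz.
Qed.

Lemma bump_support x y A : hnorm x + eps <= A -> A <= hnorm y -> hbump (hmul x (hinv y)) = 0.
Proof.
move=> xA Ay; apply: bump_eq0.
have := hnorm_triangle (hinv x) (hmul x (hinv y)).
by rewrite hmulKl !hnormV; lra.
Qed.

Lemma scales_quotient x : scales_leb 1 (fun y => hmul x (hinv y)).
Proof.
rewrite -[1 : R]mulr1; apply: (@scales_comp _ _ _ _ (hmul x) (@hinv R n)).
  exact: scales_hmull.
exact: scales_hinv.
Qed.

Lemma square_integrable_hb (f : H -> R) C A : measurable_fun setT f -> 0 < A ->
  (forall y, `|f y| <= C) -> (forall y, A <= hnorm y -> f y = 0) -> square_integrable leb f.
Proof.
move=> mf A0 fC f0; split => //.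
have C0 : 0 <= C by apply: le_trans (fC 0).
have mf2 : measurable_fun setT (fun y => f y ^+ 2) by exact: measurable_funX.
have mA := @measurable_hb R n A.
have h := @integral_bounded_hb R n (fun y => f y ^+ 2) (hb A) (C ^+ 2) A mf2
  (fun y => sqr_ge0 _) mA (@subset_refl _ _) A0.
apply: le_lt_trans (ltry (C ^+ 2 * (A ^+ Q * hvol R n))).
have {}h := h _ (sqr_ge0 C); apply: le_trans (h _); last first.
  by move=> y _; rewrite -real_normK ?num_real// ler_pXn2r ?nnegrE.
rewrite [leRHS]integral_indicM le_eqVlt; apply/orP; left; apply/eqP.
apply: eq_integral => y _; congr EFin; rewrite indicE.
have [yA|yA] := ltP (hnorm y) A; first by rewrite mem_set ?mulr1.
by rewrite f0// expr0n mul0r.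
Qed.

Lemma square_integrable_bump x : square_integrable leb (fun y => hbump (hmul x (hinv y))).
Proof.
have [C C0 hC] := bump_bounded.
apply: (@square_integrable_hb _ C (hnorm x + eps)).
- apply: measurable_bump; apply: (@measurable_hmul _ _ _ _ (cst x)) => //.
  exact: (@measurable_hinv _ _ _ _ id).
- by have := hnorm_ge0 x; case/andP: eps01; lra.
- by move=> y; rewrite ger0_norm ?bump_ge0.
- by move=> y; exact: bump_support.
Qed.

End mollification.

(** * Left mollification *)

Lemma mulrBB (R : realType) (a b c d : R) :
  (a - b) * (c - d) = (a * c + b * d) - (a * d + b * c).
Proof. by ring. Qed.

Lemma double_subr (R : realType) (a b c : R) : a + a - (b + c) = 2 * a - b - c.
Proof. by ring. Qed.

Section moll.
Variables (R : realType) (n : nat).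
Local Notation H := (heis R n).
Local Notation leb := (lebesgue_rV R (n + n + 1)).
Implicit Types x y k w : H.

Lemma Rintegral_scales_int (T : H -> H) f : scales_leb 1 T ->
  leb.-integrable setT (EFin \o f) -> \int[leb]_x f (T x) = \int[leb]_x f x.
Proof.
move=> sT fi; rewrite /Rintegral; congr fine; have [J0 mT _] := sT.
have := integral_change mT J0 (fun g mg g0 => ge0_integral_scales sT mg g0) fi.
by rewrite mul1e.
Qed.

Lemma square_integrable_hmulr (f : H -> R) k : square_integrable leb f ->
  square_integrable leb (fun y => f (hmul y k)).
Proof.
move=> sf; have [mf _] := sf; have sT := scales_hmulr k; have [_ mT _] := sT.
split; first exact: (measurableT_comp mf mT).
have fi := integrable_scales sT (square_integrable_integrable sf).
have := integrable_lty measurableT fi; exact: id.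
Qed.

Variables (U : H -> R) (eps : R).
Hypotheses (sU : square_integrable leb U) (eps01 : 0 < eps <= 1).

Local Notation b := (@hbump R n eps).

(** An average of the left translates U(w^-1 x) of U, since w = x y^-1 means y =
    w^-1 x. *)
Definition moll x : R := \int[leb]_y (U y * b (hmul x (hinv y))).

Lemma integrable_moll x : leb.-integrable setT (EFin \o (fun y => U y * b (hmul x (hinv y)))).
Proof. exact: (integrable_mul_square sU (square_integrable_bump eps01 x)). Qed.

Lemma bump_quotientC x y : b (hmul x (hinv y)) = b (hmul y (hinv x)).
Proof. by rewrite -bumpV hinvM hinvK. Qed.

Lemma moll_bounded x : `|moll x| <=
  \int[leb]_y (U y ^+ 2) + \int[leb]_y (b y ^+ 2).
Proof.
have iU := square_integrable_integrable sU.
have ib := square_integrable_integrable (square_integrable_bump eps01 x).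
have im := integrable_moll x.
apply: le_trans (le_normr_Rintegral measurableT im) _.
have mb : measurable_fun setT (fun y : H => b y ^+ 2).
  by apply: measurable_funX; exact: (@measurable_bump _ _ _ _ _ id).
have eb : \int[leb]_y (b (hmul x (hinv y)) ^+ 2) = \int[leb]_y (b y ^+ 2).
  exact: (Rintegral_scales1 (scales_quotient x) mb (fun y => sqr_ge0 _)).
apply: (@le_trans _ _ (\int[leb]_y (U y ^+ 2 + b (hmul x (hinv y)) ^+ 2))); last first.
  by rewrite (Rintegral_addr iU ib) eb.
apply: (@le_Rintegral _ _ _ _ _ (fun y => `|U y * b (hmul x (hinv y))|)
  (fun y => U y ^+ 2 + b (hmul x (hinv y)) ^+ 2) measurableT).
- exact: (integrable_norm im).
- exact: (integrable_addr iU ib).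
by move=> y _; exact: normM_le_sqr.
Qed.

(** The Lipschitz bound of the bump is only integrated over a ball that contains
    the supports, where U is integrable. *)
Lemma moll_lipschitz x : exists2 C : R, 0 <= C & forall k, hnorm k <= 1 ->
  `|moll (hmul x k) - moll x| <= C * hnorm k.
Proof.
set A := hnorm x + 3; have A1 : 1 <= A by have := hnorm_ge0 x; rewrite /A; lra.
have e1 : eps <= 1 by case/andP: eps01.
have [C C0 hC] := bump_lipschitz n eps A1.
have sI : square_integrable leb (\1_(hb A) : H -> R).
  apply: (@square_integrable_hb _ _ _ 1 A).
  - exact: measurable_indic (@measurable_hb R n A).
  - by lra.
  - by move=> y; rewrite indicE ger0_norm// lern1 leq_b1.
  - by move=> y yA; rewrite indicE memNset// /hb/=; apply/negP; rewrite -leNgt.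
have iUI := integrable_mul_square sU sI.
have inorm : leb.-integrable setT (EFin \o (fun y => `|U y * \1_(hb A) y|)).
  exact: (integrable_norm iUI).
exists (C * \int[leb]_y `|U y * \1_(hb A) y|).
  by rewrite mulr_ge0//; apply: Rintegral_ge0.
move=> k k1; rewrite /moll.
have i1 := integrable_moll (hmul x k); have i2 := integrable_moll x.
have -> : \int[leb]_y (U y * b (hmul (hmul x k) (hinv y))) - \int[leb]_y (U y * b (hmul x (hinv y)))
  = \int[leb]_y (U y * b (hmul (hmul x k) (hinv y)) - U y * b (hmul x (hinv y))).
  exact/esym/(RintegralB measurableT i1 i2).
have i3 := integrableB measurableT i1 i2.
apply: le_trans (le_normr_Rintegral measurableT i3) _.
have -> : C * \int[leb]_y `|U y * \1_(hb A) y| * hnorm k =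
  (C * hnorm k) * \int[leb]_y `|U y * \1_(hb A) y| by rewrite mulrAC.
apply: (@le_trans _ _ (\int[leb]_y ((C * hnorm k) * `|U y * \1_(hb A) y|))); last first.
  by rewrite (Rintegral_scaler (C * hnorm k) inorm).
apply: (@le_Rintegral _ _ _ _ _
  (fun y => `|U y * b (hmul (hmul x k) (hinv y)) - U y * b (hmul x (hinv y))|)
  (fun y => (C * hnorm k) * `|U y * \1_(hb A) y|) measurableT).
- exact: (integrable_norm i3).
- exact: (integrable_scaler (C * hnorm k) inorm).
move=> y _.
rewrite -mulrBr !normrM mulrCA ler_wpM2l// indicE.
have [yA|yA] := ltP (hnorm y) A; last first.
  have xk := hnorm_triangle x k.
  rewrite !(@bump_support _ _ _ eps01 _ _ A)// ?subrr ?normr0 ?mulr_ge0 ?hnorm_ge0//.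
    by rewrite /A; lra.
  by rewrite /A; lra.
rewrite mem_set// normr1 mulr1 (bump_quotientC (hmul x k)) (bump_quotientC x).
apply: hC => //; first exact: ltW.
by rewrite /A; lra.
Qed.

Lemma continuous_moll : continuous moll.
Proof.
move=> x; apply/(@cvgrPdist_lt _ _ _ (nbhs x) (nbhs_filter x)) => e e0.
have [C C0 hC] := moll_lipschitz x.
pose del : R := Num.min 1 (e / (C + 1)).
have d0 : 0 < del by rewrite lt_min ltr01 divr_gt0// ltr_wpDl.
have d40 : 0 < del ^+ 4 by rewrite exprn_gt0.
have := @continuous_hnorm4 R n (hinv x) x.
move=> /(@cvgrPdist_lt _ _ _ (nbhs x) (nbhs_filter x)) /(_ _ d40); rewrite hmulV.
have -> : hnorm4 (0 : H) = 0 by rewrite -hnorm_exp4 hnorm0 expr0n.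
move=> h; apply: (@filterS _ (nbhs x) (nbhs_filter x) _ _ _ h) => z /= hz'.
have : hnorm (hmul (hinv x) z) < del.
  rewrite hnorm_lt ?(ltW d0)//; move: hz'.
  by rewrite sub0r normrN; apply: le_lt_trans; exact: ler_norm.
rewrite lt_min => /andP[k1 k2].
rewrite distrC -{1}(hmulVKl x z) (le_lt_trans (hC _ (ltW k1)))//.
have k0 := hnorm_ge0 (hmul (hinv x) z).
rewrite ltr_pdivlMr in k2; last by rewrite ltr_wpDl.
by apply: le_lt_trans k2; rewrite mulrC ler_wpM2l//; lra.
Qed.

(** Stated for nonnegative W, to which Tonelli applies; the two parts of U are
    treated separately. *)
Lemma measurable_integral_bump (W : H -> R) : measurable_fun setT W -> (forall x, 0 <= W x) ->
  measurable_fun setT (fun x => \int[leb]_y (W y * b (hmul x (hinv y)))%:E)%E.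
Proof.
move=> mW W0; pose f (q : H * H) := (W q.2 * b (hmul q.1 (hinv q.2)))%:E.
apply: (@measurable_fun_fubini_tonelli_F _ _ _ _ _ leb f).
  apply/measurable_EFinP; apply: measurable_funM.
    exact: (measurableT_comp mW measurable_snd).
  apply: measurable_bump; apply: measurable_hmul; first exact: measurable_fst.
  by apply: measurable_hinv; exact: measurable_snd.
by move=> q; rewrite lee_fin mulr_ge0// bump_ge0.
Qed.

Let measurable_Rintegral_bump (W : H -> R) : measurable_fun setT W -> (forall x, 0 <= W x) ->
  measurable_fun setT (fun x => \int[leb]_y (W y * b (hmul x (hinv y)))).
Proof.
move=> mW W0; apply: (@measurableT_comp _ _ _ _ _ _ fine) => //.
exact: measurable_integral_bump.
Qed.

Lemma square_integrable_pos : square_integrable leb (fun x => Num.max (U x) 0).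
Proof.
have [mU iU] := sU; split; first exact: measurable_maxr.
apply: le_lt_trans iU; apply: ge0_le_integral => //.
- by move=> x _; rewrite lee_fin sqr_ge0.
- by apply/measurable_EFinP; apply: measurable_funX; exact: measurable_maxr.
- by apply/measurable_EFinP; exact: measurable_funX.
move=> x _; rewrite lee_fin; case: (leP (U x) 0) => h //.
by rewrite expr0n sqr_ge0.
Qed.

Lemma square_integrable_neg : square_integrable leb (fun x => Num.max (- U x) 0).
Proof.
have [mU iU] := sU.
have mN : measurable_fun setT (fun x => Num.max (- U x) 0).
  by apply: measurable_maxr => //; exact: measurable_funN.
split=> //; apply: le_lt_trans iU; apply: ge0_le_integral => //.
- by move=> x _; rewrite lee_fin sqr_ge0.
- by apply/measurable_EFinP; apply: measurable_funX.
- by apply/measurable_EFinP; exact: measurable_funX.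
move=> x _; rewrite lee_fin; case: (leP (- U x) 0) => h; rewrite ?sqrrN//.
by rewrite expr0n sqr_ge0.
Qed.

Lemma moll_posneg x : moll x =
  \int[leb]_y (Num.max (U y) 0 * b (hmul x (hinv y))) -
  \int[leb]_y (Num.max (- U y) 0 * b (hmul x (hinv y))).
Proof.
have i1 := integrable_mul_square square_integrable_pos (square_integrable_bump eps01 x).
have i2 := integrable_mul_square square_integrable_neg (square_integrable_bump eps01 x).
rewrite -(RintegralB measurableT i1 i2); apply: eq_Rintegral => y _.
rewrite -mulrBl; congr (_ * _).
by case: (leP (U y) 0); case: (leP (- U y) 0); lra.
Qed.

Lemma measurable_moll : measurable_fun setT moll.
Proof.
rewrite (funext moll_posneg); apply: measurable_funB; apply: measurable_Rintegral_bump.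
- by have [] := square_integrable_pos.
- by move=> x; rewrite le_max lexx orbT.
- by have [] := square_integrable_neg.
- by move=> x; rewrite le_max lexx orbT.
Qed.

(** Of the four terms of the product, two give V x by right invariance, and the
    two mixed ones give V at x k and at x k^-1. *)
Lemma energy_inner x k :
  leb.-integrable setT (EFin \o (fun y =>
    (U (hmul y k) - U y) * (b (hmul x (hinv (hmul y k))) - b (hmul x (hinv y))))) /\
  \int[leb]_y ((U (hmul y k) - U y) *
    (b (hmul x (hinv (hmul y k))) - b (hmul x (hinv y)))) = diff2 moll x k.
Proof.
have sb (z : H) := square_integrable_bump eps01 z.
have sUk := square_integrable_hmulr k sU.
have sbk := square_integrable_hmulr k (sb x).
have i1 := integrable_mul_square sUk sbk.
have i2 := integrable_mul_square sUk (sb x).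
have i3 := integrable_mul_square sU sbk.
have i4 := integrable_moll x.
pose f1 y := U (hmul y k) * b (hmul x (hinv (hmul y k))).
pose f2 y := U (hmul y k) * b (hmul x (hinv y)).
pose f3 y := U y * b (hmul x (hinv (hmul y k))).
pose f4 y := U y * b (hmul x (hinv y)).
have i14 : leb.-integrable setT (EFin \o (fun y => f1 y + f4 y)).
  exact: (@integrable_addr _ _ f1 f4 i1 i4).
have i23 : leb.-integrable setT (EFin \o (fun y => f2 y + f3 y)).
  exact: (@integrable_addr _ _ f2 f3 i2 i3).
have fE : (fun y => (U (hmul y k) - U y) * (b (hmul x (hinv (hmul y k))) - b (hmul x (hinv y)))) =
  (fun y => (f1 y + f4 y) - (f2 y + f3 y)).
  by apply/funext => y; exact: mulrBB.
rewrite fE; split; first exact: (integrableB measurableT i14 i23).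
apply: (etrans (RintegralB measurableT i14 i23)).
have e1 : \int[leb]_y f1 y = moll x.
  exact: (Rintegral_scales_int (scales_hmulr k) i4).
have e2 : \int[leb]_y f2 y = moll (hmul x k).
  have h := Rintegral_scales_int (scales_hmulr k) (integrable_moll (hmul x k)).
  apply: etrans _ h; apply: eq_Rintegral => y _.
  by rewrite /f2 hinvM hmulA hmulKr.
have e3 : \int[leb]_y f3 y = moll (hmul x (hinv k)).
  by apply: eq_Rintegral => y _; rewrite /f3 hinvM hmulA.
have E1 : \int[leb]_y (f1 y + f4 y) = moll x + moll x.
  exact: (etrans (@Rintegral_addr _ _ f1 f4 i1 i4) (f_equal2 +%R e1 erefl)).
have E2 : \int[leb]_y (f2 y + f3 y) = moll (hmul x k) + moll (hmul x (hinv k)).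
  exact: (etrans (@Rintegral_addr _ _ f2 f3 i2 i3) (f_equal2 +%R e2 e3)).
exact: (etrans (f_equal2 (fun a c => a - c) E1 E2) (double_subr _ _ _)).
Qed.

End moll.

(** * Test functions *)

Section test_functions.
Variables (R : realType) (n : nat) (s : R).
Hypothesis s01 : 0 < s < 1.
Local Notation H := (heis R n).
Local Notation leb := (lebesgue_rV R (n + n + 1)).
Local Notation Q := (hdim n).
Local Notation p := (hexp n s).
Variables (xi0 : H) (r eps : R) (x : H).
Hypotheses (r0 : 0 < r) (eps01 : 0 < eps <= 1) (x2 : hnorm x <= 2).

Definition hsim_inv (y : H) : H := hdil r^-1 (hmul (hinv xi0) y).

Lemma hsimK y : hsim_inv (hsim xi0 r y) = y.
Proof. by rewrite /hsim_inv /hsim hmulKl hdilA mulVf ?gt_eqF// hdil1. Qed.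

Lemma hsim_invK y : hsim xi0 r (hsim_inv y) = y.
Proof. by rewrite /hsim_inv /hsim hdilA mulfV ?gt_eqF// hdil1 hmulVKl. Qed.

(** The function y |-> b(x y^-1), seen from the original coordinates. *)
Definition test_fun (y : H) : R := hbump eps (hmul x (hinv (hsim_inv y))).

Local Notation psi y := (hbump eps (hmul x (hinv y))).

Lemma elementary_map_hsim_inv : elementary_map hsim_inv.
Proof.
apply: elementary_hdil; apply: elementary_hmul; first exact: elementary_map_cst.
exact: elementary_map_id.
Qed.

Lemma elementary_test_fun : elementary test_fun.
Proof.
apply: elementary_flat; apply: elementary_add; first exact: (elementary_cst (eps ^+ 4)).
apply/elementary_opp/elementary_hnorm4/elementary_hmul; first exact: elementary_map_cst.
apply: elementary_hinv; exact: elementary_map_hsim_inv.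
Qed.

Let e1 : eps <= 1. Proof. by case/andP: eps01. Qed.

Lemma psi_far (y : H) : 3 <= hnorm y -> psi y = 0.
Proof.
move=> y3; apply: (@bump_support _ _ _ eps01 x y 3) => //.
by rewrite (le_trans (lerD x2 e1))//; lra.
Qed.

Lemma hnorm_hsim (y : H) : hnorm (hmul (hinv xi0) (hsim xi0 r y)) = r * hnorm y.
Proof. by rewrite /hsim hmulKl hnorm_hdil// ltW. Qed.

(** For |x| <= 2 and eps <= 1 the support lies in |y| <= 3, hence inside the
    image of the ball of radius 6. *)
Lemma Cc_infty_test_fun (Omega : set H) : hball xi0 (6 * r) `<=` Omega ->
  Cc_infty Omega test_fun.
Proof.
move=> sub.
pose K := [set y : H | hnorm (hsim_inv y) <= 3].
have cK : closed K.
  rewrite (_ : K = [set y | hnorm4 (hsim_inv y) <= 3 ^+ 4]); last first.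
    by apply/seteqP; split => y; rewrite /K /= hnorm_le.
  apply: closed_hnorm4_le; apply: elementary_continuous.
  by apply: elementary_hnorm4; exact: elementary_map_hsim_inv.
have suppK : closure [set y | test_fun y != 0] `<=` K.
  rewrite [X in _ `<=` X](closure_id K).1//; apply: closureS => y /=.
  apply: contraNT => yK; rewrite /test_fun psi_far//.
  by move: yK; rewrite -ltNge => /ltW.
have Kball : K `<=` hball xi0 (6 * r).
  move=> y; rewrite /K /= => yK; rewrite /hball /= -(hsim_invK y) hnorm_hsim mulrC.
  by rewrite ltr_pM2r// (le_lt_trans yK)// ltr_nat.
have kK : compact K.
  apply: bounded_closed_compact => //.
  apply: (@bounded_coord_set _ _ _ ((hnorm xi0 + 6 * r + 1) ^+ 2)) => y i /Kball; rewrite /hball /= => yK.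
  have h0 := hnorm_ge0 xi0; have r0' := r0.
  apply: hcoord_le; first by lra.
  have := hnorm_triangle xi0 (hmul (hinv xi0) y); rewrite hmulVKl; lra.
split.
- by move=> vs y; apply: elementary_smooth; exact: elementary_test_fun.
- by apply: (subclosed_compact _ kK suppK); exact: closed_closure.
- by move=> y /suppK /Kball /sub.
Qed.

Lemma measurable_test_fun : measurable_fun setT test_fun.
Proof.
apply: measurable_bump; apply: (@measurable_hmul _ _ _ _ (cst x)) => //.
apply: measurable_hinv; apply: measurable_hdil.
by apply: (@measurable_hmul _ _ _ _ (cst _) id).
Qed.

Lemma square_integrable_hsim (u : H -> R) : measurable_fun setT u ->
  square_integrable leb u <-> square_integrable leb (fun y => u (hsim xi0 r y)).
Proof.
move=> mu; have sS := scales_hsim xi0 r0; have [J0 mS _] := sS.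
have muS : measurable_fun setT (fun y => u (hsim xi0 r y)) by exact: measurableT_comp.
have mu2 : measurable_fun setT (fun y => (u y ^+ 2)%:E).
  by apply/measurable_EFinP; exact: measurable_funX.
have E := ge0_integral_scales sS mu2 (fun y => sqr_ge0 _).
rewrite /square_integrable E; split => -[_ h]; split => //.
  by case: (\int[_]_x _)%E h => [a|//|//]; rewrite ?ltry// gt0_muley ?lte_fin.
by rewrite lte_mul_pinfty// lee_fin ltW.
Qed.

(** Left invariance removes y, and homogeneity gives the power of r. *)
Lemma hkernel_hpairing (q : H * H) :
  (hkernel s (hpairing xi0 r q).1 (hpairing xi0 r q).2)^-1 = r `^ (- p) * kap s q.1.
Proof.
rewrite /hkernel /hpairing /= hsimM hmulKl.
by rewrite hnorm_hdil ?(ltW r0)// -powRN powRM ?hnorm_ge0 ?(ltW r0).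
Qed.

Lemma measurable_hkernelV : measurable_fun setT (fun q : H * H => (hkernel s q.1 q.2)^-1).
Proof.
rewrite /hkernel; under eq_fun do rewrite -powRN.
apply: (measurableT_comp (measurable_powR _)); apply: measurable_hnorm_comp.
apply: measurable_hmul; last exact: measurable_fst.
by apply: measurable_hinv; exact: measurable_snd.
Qed.

Lemma hkernelV_ge0 (q : H * H) : 0 <= (hkernel s q.1 q.2)^-1.
Proof. by rewrite invr_ge0 powR_ge0. Qed.

Lemma measurable_pair_diff (f : H -> R) : measurable_fun setT f ->
  measurable_fun setT (fun q : H * H => f q.1 - f q.2).
Proof.
move=> mf; apply: measurable_funB; apply: (measurableT_comp mf).
  exact: measurable_fst.
exact: measurable_snd.
Qed.

Local Opaque hbump hmul.

(** For |k| < 1 the increments are O(|k|) and supported in a fixed ball; for |k|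
    >= 1 their squares are bounded by the squares of the two terms. *)
Lemma psi_increment_le : exists2 C : R, 0 <= C & forall k : H,
   (\int[leb]_y ((psi (hmul y k) - psi y) ^+ 2 * kap s k)%:E <=
    (C * (knear s 1 k + kap1 s k))%:E)%E.
Proof.
have ge15 : 1 <= 5 :> R by rewrite ler1n.
have [C C0 hC] := bump_lipschitz n eps ge15.
have sb := square_integrable_bump eps01 x.
have mp : measurable_fun setT (fun y => psi y) by have [] := sb.
have mpk (k : H) : measurable_fun setT (fun y => psi (hmul y k)).
  by have [] := square_integrable_hmulr k sb.
pose I2 := \int[leb]_y (psi y ^+ 2).
have I20 : 0 <= I2 by apply: Rintegral_ge0 => y _; exact: sqr_ge0.
have I2E : (\int[leb]_y (psi y ^+ 2)%:E = I2%:E)%E.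
  rewrite /I2 /Rintegral fineK//; have i2 := square_integrable_integrable sb.
  exact: (integrable_fin_num measurableT i2).
pose V5 := 5 ^+ Q * hvol R n.
have V50 : 0 <= V5 by rewrite mulr_ge0 ?exprn_ge0// ltW// hvol_gt0.
exists (C ^+ 2 * V5 + 2 * I2).
  by apply: addr_ge0; apply: mulr_ge0 => //; exact: sqr_ge0.
move=> k; have kk := kap_ge0 s k; have k1k := kap1_ge0 s k; have kn := knear_ge0 s 1 k.
have mf : measurable_fun setT (fun y => (psi (hmul y k) - psi y) ^+ 2).
  exact: (measurable_funX 2 (measurable_funB (mpk k) mp)).
have E : (\int[leb]_y ((psi (hmul y k) - psi y) ^+ 2 * kap s k)%:E =
   (kap s k)%:E * \int[leb]_y ((psi (hmul y k) - psi y) ^+ 2)%:E)%E.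
  rewrite -ge0_integralZl_EFin//.
  - by apply: eq_integral => y _; rewrite -EFinM mulrC.
  - by move=> y _; rewrite lee_fin sqr_ge0.
  - exact/measurable_EFinP.
rewrite E; have [k1|k1] := leP 1 (hnorm k).
  have mp2 : measurable_fun setT (fun y => (psi y ^+ 2)%:E).
    by apply/measurable_EFinP; exact: (measurable_funX 2 mp).
  have mpk2 : measurable_fun setT (fun y => (psi (hmul y k) ^+ 2)%:E).
    by apply/measurable_EFinP; exact: (measurable_funX 2 (mpk k)).
  have le2 : (\int[leb]_y ((psi (hmul y k) - psi y) ^+ 2)%:E <= (2 * I2)%:E)%E.
    apply: (@le_trans _ _ (\int[leb]_y ((psi (hmul y k) ^+ 2)%:E + (psi y ^+ 2)%:E))%E).
      apply: ge0_le_integral => //.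
      - by move=> y _; rewrite lee_fin sqr_ge0.
      - exact/measurable_EFinP.
      - exact: (emeasurable_funD mpk2 mp2).
      move=> y _; rewrite -EFinD lee_fin.
      have := bump_ge0 eps (hmul x (hinv y)).
      have := bump_ge0 eps (hmul x (hinv (hmul y k))).
      set a := hbump eps _; set b := hbump eps _ => a0 b0.
      by have := mulr_ge0 a0 b0; rewrite sqrrB; lra.
    have Et := ge0_integral_scales (scales_hmulr k) mp2 (fun y => sqr_ge0 _).
    rewrite mul1e in Et.
    have s1 : (\int[leb]_y (psi (hmul y k) ^+ 2)%:E <= I2%:E)%E.
      exact: (eq_ind _ (fun z => (z <= I2%:E)%E) (eq_ind _ (fun z => (z <= I2%:E)%E) (lexx _) _ (esym I2E)) _ Et).
    have s2 : (\int[leb]_y (psi y ^+ 2)%:E <= I2%:E)%E.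
      exact: (eq_ind _ (fun z => (z <= I2%:E)%E) (lexx _) _ (esym I2E)).
    have D : (\int[leb]_y ((psi (hmul y k) ^+ 2)%:E + (psi y ^+ 2)%:E) =
       \int[leb]_y (psi (hmul y k) ^+ 2)%:E + \int[leb]_y (psi y ^+ 2)%:E)%E.
      have p1 y : setT y -> (0 <= (psi (hmul y k) ^+ 2)%:E)%E by rewrite lee_fin sqr_ge0.
      have p2 y : setT y -> (0 <= (psi y ^+ 2)%:E)%E by rewrite lee_fin sqr_ge0.
      exact: (@ge0_integralD _ _ _ leb setT measurableT _ _ p1 mpk2 p2 mp2).
    have -> : (2 * I2)%:E = (I2%:E + I2%:E)%E by rewrite -EFinD mulr_natl mulr2n.
    exact: (eq_ind _ (fun z => (z <= I2%:E + I2%:E)%E) (leeD s1 s2) _ (esym D)).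
  apply: le_trans (lee_wpmul2l _ le2) _; first by rewrite lee_fin.
  rewrite -EFinM lee_fin -kap1_far//.
  have f1 := mulr_ge0 I20 kn.
  have f2 : 0 <= C ^+ 2 * V5 * (knear s 1 k + kap1 s k).
    by apply: mulr_ge0; [apply: mulr_ge0 => //; exact: sqr_ge0|exact: addr_ge0].
  by lra.
have le5 : (\int[leb]_y ((psi (hmul y k) - psi y) ^+ 2)%:E <= (C ^+ 2 * hnorm k ^+ 2 * V5)%:E)%E.
  have h5 : 0 < 5 :> R by [].
  have c0 : 0 <= C ^+ 2 * hnorm k ^+ 2 by rewrite -exprMn sqr_ge0.
  have := @integral_bounded_hb R n (fun y => (psi (hmul y k) - psi y) ^+ 2) (hb 5)
    (C ^+ 2 * hnorm k ^+ 2) 5 mf (fun y => sqr_ge0 _) (@measurable_hb R n 5) (@subset_refl _ _) h5.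
  move=> /(_ _ c0) h; apply: le_trans (h _); last first.
    move=> y; rewrite /hb /= => /ltW y5; rewrite -exprMn.
    rewrite -real_normK ?num_real// ler_pXn2r ?nnegrE ?mulr_ge0 ?hnorm_ge0//.
    by apply: hC => //; [rewrite (le_trans x2)// ler_nat|exact: ltW].
  rewrite [leRHS]integral_indicM le_eqVlt; apply/orP; left; apply/eqP.
  apply: eq_integral => y _; congr EFin; rewrite indicE.
  have [y5|y5] := ltP (hnorm y) 5; first by rewrite mem_set ?mulr1.
  have yk : 3 <= hnorm (hmul y k).
    have := hnorm_triangle (hmul y k) (hinv k); rewrite hmulKr hnormV; lra.
  have y3 : 3 <= hnorm y by apply: le_trans y5; rewrite ler_nat.
  by rewrite (psi_far yk) (psi_far y3) subrr expr0n mul0r.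
apply: le_trans (lee_wpmul2l _ le5) _; first by rewrite lee_fin.
have knE : knear s 1 k = hnorm k ^+ 2 * kap s k.
  by rewrite /knear indicE mem_set ?mulr1.
rewrite -EFinM lee_fin knE.
have f1 := mulr_ge0 (mulr_ge0 (sqr_ge0 C) V50) k1k.
have f2 : 0 <= 2 * I2 * (knear s 1 k + kap1 s k).
  by apply: mulr_ge0; [exact: mulr_ge0|exact: addr_ge0].
by rewrite knE in f2; lra.
Qed.

End test_functions.

(** * From the weak to a pointwise equation *)

Section weak_to_pointwise.
Variables (R : realType) (n : nat) (s : R).
Hypothesis s01 : 0 < s < 1.
Local Notation H := (heis R n).
Local Notation leb := (lebesgue_rV R (n + n + 1)).
Local Notation Q := (hdim n).
Local Notation p := (hexp n s).
Variables (xi0 : H) (r eps : R).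
Hypotheses (r0 : 0 < r) (eps01 : 0 < eps <= 1).
Local Notation psi x y := (hbump eps (hmul x (hinv y))).
Local Notation Psi x := (test_fun xi0 r eps x).

Local Opaque hbump hmul.

Lemma test_fun_hpairing x (q : H * H) :
  Psi x (hpairing xi0 r q).1 - Psi x (hpairing xi0 r q).2 =
  psi x (hmul q.2 q.1) - psi x q.2.
Proof. by rewrite /test_fun /hpairing !hsimK. Qed.

(** In the coordinates (k, y), integrating in y first leaves the integrable
    function knear + kap1 of k. *)
Lemma gagliardo2_test_fun x : hnorm x <= 2 -> (gagliardo2 s (Psi x) < +oo)%E.
Proof.
move=> x2; have [C C0 hC] := psi_increment_le s eps01 x2.
pose f (q : H * H) := ((Psi x q.1 - Psi x q.2) ^+ 2 / hkernel s q.1 q.2)%:E.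
have mPsi := measurable_test_fun xi0 r eps x.
have mf : measurable_fun setT f.
  apply/measurable_EFinP; apply: measurable_funM; last exact: measurable_hkernelV.
  by apply: measurable_funX; exact: measurable_pair_diff.
have fE q : f (hpairing xi0 r q) =
    ((psi x (hmul q.2 q.1) - psi x q.2) ^+ 2 * (r `^ (- p) * kap s q.1))%:E.
  exact: (congr1 EFin (f_equal2 (fun a b => a ^+ 2 * b)
    (test_fun_hpairing x q) (hkernel_hpairing s xi0 r0 q))).
have f0 q : (0 <= f q)%E by rewrite lee_fin mulr_ge0 ?sqr_ge0 ?hkernelV_ge0.
have E := integral_hpairing xi0 r0 mf f0.
rewrite /gagliardo2; apply: (@le_lt_trans _ _ (\int[(leb \x leb)%E]_q f q)%E); first by [].
rewrite E; apply: lte_mul_pinfty; rewrite ?lee_fin ?mulr_ge0 ?exprn_ge0 ?(ltW r0)//.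
have mfp : measurable_fun setT (f \o hpairing xi0 r).
  exact: (measurableT_comp mf (measurable_hpairing xi0 r0)).
have F := fubini_tonelli1 (m1 := leb) (m2 := leb) _ mfp (fun q => f0 _).
apply: (@le_lt_trans _ _ (\int[leb]_k fubini_F leb (f \o hpairing xi0 r) k)%E).
  by rewrite -F.
have ik : leb.-integrable setT (EFin \o (fun k : H => (r `^ (- p) * C) * (knear s 1 k + kap1 s k))).
  apply: integrable_scaler.
  exact: (integrable_addr (integrable_knear n s01 ltr01) (integrable_kap1 n s01)).
apply: le_lt_trans (integrable_lty measurableT ik).
have mF := measurable_fun_fubini_tonelli_F (m2 := leb) _ mfp (fun q => f0 _).
have mk : measurable_fun setT (fun k : H => (EFin \o (fun k : H => (r `^ (- p) * C) * (knear s 1 k + kap1 s k))) k).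
  by have /integrableP[] := ik.
apply: ge0_le_integral; [exact: measurableT| |exact: mF|exact: mk|].
  by move=> k _; apply: integral_ge0 => y _; exact: f0.
move=> k _; rewrite /fubini_F.
have mpsi : measurable_fun setT (fun y => psi x y) by have [] := square_integrable_bump eps01 x.
have mpk : measurable_fun setT (fun y => psi x (hmul y k)).
  by have [] := square_integrable_hmulr k (square_integrable_bump eps01 x).
rewrite (eq_integral (fun y => (r `^ (- p))%:E * ((psi x (hmul y k) - psi x y) ^+ 2 * kap s k)%:E)%E); last first.
  move=> y _; rewrite -EFinM -[LHS]/(f (hpairing xi0 r (k, y))) fE.
  exact: (congr1 EFin (mulrCA _ _ _)).
rewrite ge0_integralZl_EFin ?powR_ge0//; last 2 first.
- by move=> y _; rewrite lee_fin mulr_ge0 ?sqr_ge0 ?kap_ge0.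
- apply/measurable_EFinP; apply: measurable_funM; last exact: measurable_cst.
  exact: (measurable_funX 2 (measurable_funB mpk mpsi)).
rewrite /= -mulrA [(r `^ _ * _)%:E]EFinM; apply: lee_wpmul2l; last exact: hC.
by rewrite lee_fin powR_ge0.
Qed.

Lemma Hs_test_fun x : hnorm x <= 2 -> Hs s (Psi x).
Proof.
move=> x2; split; last exact: gagliardo2_test_fun.
apply/Lfun2P; apply/(square_integrable_hsim xi0 r0); first exact: measurable_test_fun.
have E : (fun y => psi x y) = (fun y => Psi x (hsim xi0 r y)).
  by apply/funext => y; rewrite /test_fun hsimK.
exact: (eq_ind _ (square_integrable leb) (square_integrable_bump eps01 x) _ E).
Qed.

Lemma W0_test_fun (Omega : set H) x : hball xi0 (6 * r) `<=` Omega -> hnorm x <= 2 ->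
  W0 s Omega (Psi x).
Proof.
move=> sub x2; split; first exact: Hs_test_fun.
move=> e e0; exists (Psi x); first exact: Cc_infty_test_fun.
rewrite /Hs_norm.
have -> : Psi x \- Psi x = cst 0 by apply/funext => y /=; rewrite subrr.
have -> : gagliardo2 s (cst 0 : H -> R) = 0%E.
  by rewrite /gagliardo2; apply: integral0_eq => q _; rewrite /= subrr expr0n mul0r.
have -> : (EFin \o (cst 0 : H -> R)) = cst 0%E by [].
by rewrite Lnorm0// expe2 mule0 adde0 poweR0r ?lte_fin// invr_eq0.
Qed.

Variables (Omega : set H) (g u : H -> R).
Hypotheses (sub : hball xi0 (6 * r) `<=` Omega) (wu : weak_solution s Omega g u).

Let hsu : Hs s u. Proof. by have [[]] := wu. Qed.
Let squ : square_integrable leb u. Proof. by apply/Lfun2P; have [] := hsu. Qed.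

Definition rescaled y := u (hsim xi0 r y).

Lemma square_integrable_rescaled : square_integrable leb rescaled.
Proof. exact: (proj1 (square_integrable_hsim xi0 r0 (proj1 squ)) squ). Qed.

(** The test function is nonnegative and both inequalities apply. *)
Lemma energy_test_fun x : hnorm x <= 2 -> energy_form s u (Psi x) = 0%E.
Proof.
move=> x2; have [[_ _ hsub] [_ _ hsup]] := wu.
have w := W0_test_fun sub x2.
have P0 : \forall y \ae leb, 0 <= Psi x y by apply: aeW => y; exact: bump_ge0.
by apply/eqP; rewrite eq_le hsub//= hsup.
Qed.

(** The square root of the kernel: the integrand of the energy is a product of
    two square-integrable functions, so it is absolutely integrable and Fubini
    applies. *)
Let rk (q : H * H) : R := hnorm (hmul (hinv q.2) q.1) `^ (- (p / 2)).

Let rkE q : rk q ^+ 2 = (hkernel s q.1 q.2)^-1.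
Proof.
rewrite /rk /hkernel -powR_mulrn ?powR_ge0// -powRrM -powRN; congr powR.
by rewrite /hexp; field.
Qed.

Let square_integrable_pair f : Hs s f ->
  square_integrable (leb \x leb)%E (fun q : H * H => (f q.1 - f q.2) * rk q).
Proof.
move=> [/Lfun2P[mf _] gf].
have mrk : measurable_fun setT rk.
  apply: (measurableT_comp (measurable_powR _)); apply: measurable_hnorm_comp.
  apply: measurable_hmul; last exact: measurable_fst.
  by apply: measurable_hinv; exact: measurable_snd.
split; first by apply: measurable_funM => //; exact: measurable_pair_diff.
apply: le_lt_trans gf; rewrite /gagliardo2 le_eqVlt; apply/orP; left; apply/eqP.
by apply: eq_integral => q _; rewrite exprMn rkE.
Qed.

Let F x (q : H * H) := ((u q.1 - u q.2) * (Psi x q.1 - Psi x q.2) / hkernel s q.1 q.2)%:E.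

Let integrable_F x : hnorm x <= 2 -> (leb \x leb)%E.-integrable setT (F x).
Proof.
move=> x2.
have h := integrable_mul_square (square_integrable_pair hsu) (square_integrable_pair (Hs_test_fun x2)).
rewrite (_ : F x = (EFin \o (fun q => (u q.1 - u q.2) * rk q * ((Psi x q.1 - Psi x q.2) * rk q))))//.
apply/funext => q; rewrite /F /= -rkE; congr EFin.
by move: (u _ - u _) (Psi x _ - _) (rk q) => a b c; ring.
Qed.

Local Notation V := (moll rescaled eps).

Let F_hpairing x q : F x (hpairing xi0 r q) =
  ((rescaled (hmul q.2 q.1) - rescaled q.2) * (psi x (hmul q.2 q.1) - psi x q.2) *
   (r `^ (- p) * kap s q.1))%:E.
Proof.
exact: (congr1 EFin (f_equal2 (fun a b => (u (hsim xi0 r (hmul q.2 q.1)) - u (hsim xi0 r q.2)) * a * b)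
    (test_fun_hpairing x q) (hkernel_hpairing s xi0 r0 q))).
Qed.

Let fubini_F_eq x k : fubini_F leb (F x \o hpairing xi0 r) k =
  ((r `^ (- p)) * (kap s k * diff2 V x k))%:E.
Proof.
have [i e] := energy_inner square_integrable_rescaled eps01 x k.
pose f3 y := (rescaled (hmul y k) - rescaled y) * (psi x (hmul y k) - psi x y).
rewrite /fubini_F (eq_integral (fun y => (r `^ (- p) * kap s k)%:E * (f3 y)%:E)%E); last first.
  move=> y _; rewrite -EFinM -[LHS]/(F x (hpairing xi0 r (k, y))) F_hpairing.
  exact: (congr1 EFin (mulrC _ _)).
have E : (\int[leb]_y (f3 y)%:E)%E = (diff2 V x k)%:E.
  by rewrite -e /Rintegral fineK//; exact: (integrable_fin_num measurableT i).
apply: (etrans (integralZl measurableT i _)).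
by rewrite mulrA [RHS]EFinM; exact: (congr1 _ E).
Qed.

(** In the coordinates (k, y) the inner integral of the energy is a multiple of
    kap k times the second increment of the mollification, so that the vanishing
    of the energy is the pointwise equation. Integrability of the second
    increments against the singular kernel is obtained along the way, from
    Fubini. *)
Lemma moll_harmonic x : hnorm x <= 2 ->
  leb.-integrable setT (EFin \o (fun k => kap s k * diff2 V x k)) /\
  \int[leb]_k (kap s k * diff2 V x k) = 0.
Proof.
move=> x2; have iF := integrable_F x2.
have mp := measurable_hpairing xi0 r0.
have J0 : 0 < r ^+ Q * r ^+ Q by rewrite mulr_gt0// exprn_gt0.
have tj f mf f0 := @integral_hpairing _ _ xi0 _ r0 f mf f0.
have iFp := integrable_change mp J0 tj iF.
have E := integral_change mp J0 tj iF.
have E0 : (\int[(leb \x leb)%E]_q F x q = 0)%E by exact: energy_test_fun x2.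
have Ep : (\int[(leb \x leb)%E]_q F x (hpairing xi0 r q) = 0)%E.
  have Jn : ((r ^+ Q * r ^+ Q)%:E == 0 :> \bar R)%E = false by rewrite eqe (gt_eqF J0).
  have /esym/eqP := etrans (esym E0) E; rewrite mule_eq0 Jn orFb; exact: eqP.
have rp : 0 < r `^ (- p) by exact: powR_gt0.
have iG := integrable_fubini_F iFp.
pose G k := kap s k * diff2 V x k.
have fE : fubini_F leb (F x \o hpairing xi0 r) = (fun k => (r `^ (- p))%:E * (G k)%:E)%E.
  by apply/funext => k; rewrite fubini_F_eq EFinM.
have iK : leb.-integrable setT (EFin \o G).
  rewrite fE in iG; have := integrableZl measurableT (r `^ (- p))^-1 iG.
  rewrite (_ : (fun k => _) = EFin \o G)//.
  by apply/funext => k /=; rewrite -!EFinM mulrA mulVf ?gt_eqF// mul1r.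
split => //.
have Z : ((r `^ (- p))%:E * \int[leb]_k (G k)%:E = 0)%E.
  have h := etrans (integral12_prod_meas1 iFp) Ep.
  apply: etrans _ h; rewrite fE; exact/esym/(integralZl measurableT iK).
have rn : ((r `^ (- p))%:E == 0 :> \bar R)%E = false by rewrite eqe (gt_eqF rp).
move: Z => /eqP; rewrite mule_eq0 rn orFb => /eqP h.
exact: (congr1 fine h).
Qed.

End weak_to_pointwise.

(** * Continuity of translations in measure *)

Section translation_continuity.
Variables (R : realType) (n : nat).
Local Notation H := (heis R n).
Local Notation leb := (lebesgue_rV R (n + n + 1)).
Implicit Types (A B : set H) (h x y : H).

(** Localized to a ball, because the defect of an unbounded set may have
    infinite measure; the radius leaves room for the translates of subsets of
    the unit ball. *)
Definition translation_defect h A : set H :=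
  hb 5 `&` ((hmul h @^-1` A `\` A) `|` (A `\` hmul h @^-1` A)).
Local Notation defect := translation_defect.

Definition translation_continuous A := measurable A /\
  forall eta : R, 0 < eta -> exists2 eps : R, 0 < eps &
    forall h, hnorm h < eps -> (leb (defect h A) <= eta%:E)%E.

Lemma measurable_translate h A : measurable A -> measurable (hmul h @^-1` A).
Proof.
by move=> mA; rewrite -[X in measurable X]setTI; exact: (measurable_hmull h).
Qed.

Lemma leb_translate h A : measurable A -> leb (hmul h @^-1` A) = leb A.
Proof. by move=> mA; have [_ _ /(_ A mA)] := scales_hmull h; rewrite mul1e. Qed.

Lemma measurable_defect h A : measurable A -> measurable (defect h A).
Proof.
move=> mA; have mhA := measurable_translate h mA.
apply: measurableI; first exact: (@measurable_hb R n 5).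
by apply: measurableU; exact: measurableD.
Qed.

Lemma translation_continuousC A :
  translation_continuous A -> translation_continuous (~` A).
Proof.
move=> [mA tA]; split; first exact: measurableC.
move=> eta eta0; have [eps eps0 h] := tA _ eta0; exists eps => // x xe.
suff -> : defect x (~` A) = defect x A by exact: h.
apply/seteqP; split => y [y5] [[p q]|[p q]]; split => //.
- by right; split; [exact: contrapT|].
- by left; split; [exact: contrapT|].
- by right; split; [|move=> nq; exact: nq].
- by left; split; [|move=> nq; exact: nq].
Qed.

Lemma translation_continuousU A B : translation_continuous A ->
  translation_continuous B -> translation_continuous (A `|` B).
Proof.
move=> [mA tA] [mB tB]; split; first exact: measurableU.
move=> eta eta0; have eta2 : 0 < eta / 2 by lra.
have [e1 e10 h1] := tA _ eta2; have [e2 e20 h2] := tB _ eta2.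
exists (Num.min e1 e2); first by rewrite lt_min e10.
move=> h; rewrite lt_min => /andP[/h1 k1 /h2 k2].
have sub : defect h (A `|` B) `<=` defect h A `|` defect h B.
  move=> y [y5] [[[p|p] q]|[[p|p] q]].
  - by left; split => //; left; split => // yA; apply: q; left.
  - by right; split => //; left; split => // yA; apply: q; right.
  - by left; split => //; right; split => // yA; apply: q; left.
  - by right; split => //; right; split => // yA; apply: q; right.
have mAB : measurable (A `|` B) by exact: measurableU.
apply: (@le_trans _ _ (leb (defect h A `|` defect h B))).
  apply: le_measure => //; rewrite inE; first exact: measurable_defect.
  by apply: measurableU; exact: measurable_defect.
apply: le_trans (measureU2 _ _ _) _; try exact: measurable_defect.
by rewrite (splitr eta) EFinD; exact: leeD.
Qed.

Lemma translation_continuous0 : translation_continuous set0.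
Proof.
split=> // eta eta0; exists 1 => // h _.
rewrite (_ : defect h set0 = set0) ?measure0 ?lee_fin 1?ltW//.
by apply/seteqP; split => // y [_] [[]|[]].
Qed.

Lemma translation_continuous_bigsetU (F : (set H)^nat) N :
  (forall i, translation_continuous (F i)) ->
  translation_continuous (\big[setU/set0]_(i < N) F i).
Proof.
move=> tF; elim: N => [|N IH]; first by rewrite big_ord0; exact: translation_continuous0.
by rewrite big_ord_recr; exact: translation_continuousU.
Qed.

(** Up to a set of small measure in the ball of radius 6, a countable union is a
    finite one; left invariance transports the small set. *)
Lemma translation_continuous_bigcup (F : (set H)^nat) :
  (forall i, translation_continuous (F i)) ->
  translation_continuous (\bigcup_i F i).
Proof.
move=> tF; have mF i : measurable (F i) by case: (tF i).
have mU : measurable (\bigcup_i F i) by exact: bigcupT_measurable.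
split=> // eta eta0.
pose A N := \big[setU/set0]_(i < N) F i.
have tA N : translation_continuous (A N) by exact: translation_continuous_bigsetU.
have mA N : measurable (A N) by case: (tA N).
have AS N : A N `<=` \bigcup_i F i.
  by rewrite -bigcup_bigsetU_bigcup; case: N => [|N] y yA; [rewrite /A big_ord0 in yA|exists N].
pose E N := hb 6 `&` (\bigcup_i F i `\` A N).
have mE N : measurable (E N).
  by apply: measurableI; [exact: (@measurable_hb R n 6)|exact: measurableD].
have E0 : \bigcap_N E N = set0.
  apply/seteqP; split => // y Ey; have [_ [+ _]] := Ey 0%N I.
  rewrite -bigcup_bigsetU_bigcup => -[N _ AN].
  by have [_ [_]] := Ey N.+1 I; apply.
have : leb (E N) @[N --> \oo] --> leb (\bigcap_N E N).
  apply: nonincreasing_cvg_mu => //.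
  - apply: (@le_lt_trans _ _ (leb (hb 6))); last by rewrite leb_hb// ltry.
    by apply: le_measure; rewrite ?inE//; [exact: (@measurable_hb R n 6)|move=> y []].
  - by rewrite E0.
  - move=> i j ij; apply/subsetPset => y [y6 [yU nA]]; split => //; split => // yA.
    by apply: nA; exact: (subset_bigsetU ij).
rewrite E0 measure0 => /fine_cvgP[finE cvE].
have eta4 : 0 < eta / 4 by lra.
have /cvgrPdist_lt /(_ _ eta4) := cvE => hE.
near \oo => N.
have lE : (leb (E N) <= (eta / 4)%:E)%E.
  have fE : leb (E N) \is a fin_num by near: N.
  rewrite -(fineK fE) lee_fin ltW//.
  have : `|0 - fine (leb (E N))| < eta / 4 by near: N; exact: hE.
  by rewrite sub0r normrN; apply: le_lt_trans; exact: ler_norm.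
have eta2 : 0 < eta / 2 by lra.
have [eps eps0 heps] := (tA N).2 _ eta2.
exists (Num.min eps 1); first by rewrite lt_min eps0 ltr01.
move=> h; rewrite lt_min => /andP[/heps he h1].
have sub : defect h (\bigcup_i F i) `<=`
    defect h (A N) `|` (E N `|` hmul h @^-1` E N).
  move=> y [y5] [[p q]|[p q]].
  - have [hA|hA] := pselect (A N (hmul h y)).
      left; split => //; left; split => // yA; apply: q; exact: AS yA.
    right; right; split => //; rewrite /hb /=.
    by apply: le_lt_trans (hnorm_triangle _ _) _; move: y5 h1; rewrite /hb/=; lra.
  - have [hA|hA] := pselect (A N y); last first.
      by right; left; split => //; apply: lt_trans y5 _; rewrite ltr_nat.
    left; split => //; right; split => // yA; apply: q; exact: AS yA.
have mhE := measurable_translate h (mE N).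
have mD := measurable_defect h (mA N).
have lhE : (leb (hmul h @^-1` E N) <= (eta / 4)%:E)%E by rewrite leb_translate.
apply: (@le_trans _ _ (leb (defect h (A N) `|` (E N `|` hmul h @^-1` E N)))).
  apply: le_measure => //; rewrite inE; first exact: measurable_defect.
  by apply: measurableU => //; exact: measurableU.
apply: le_trans (measureU2 _ _ _) _ => //; first exact: measurableU.
have -> : eta = eta / 2 + (eta / 4 + eta / 4) by lra.
rewrite EFinD; apply: leeD; first exact: he.
apply: le_trans (measureU2 _ _ _) _ => //.
by rewrite EFinD; exact: (leeD lE lhE).
Unshelve. all: by end_near.
Qed.

(** The group law perturbs the vertical coordinate by 2 hsymp h y, whence the
    restriction to a bounded set of y. *)
Lemma hmul_coord_near h y i : hnorm h <= 1 -> hnorm y <= 5 ->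
  `|hmul h y ord0 i - y ord0 i| <= 11 * hnorm h.
Proof.
move=> h1 y5; have h0 := hnorm_ge0 h.
have [j ->|j ->] := split_ordP i; last first.
  have -> : hmul h y ord0 (rshift (n + n) j) = ht (hmul h y) by rewrite /ht [RHS]mxE (ord1 j).
  have -> : y ord0 (rshift (n + n) j) = ht y by rewrite /ht [RHS]mxE (ord1 j).
  rewrite htM (_ : _ - _ = ht h + 2 * hsymp h y); last by lra.
  have th := ht_le h.
  have sh : `|hsymp h y| <= hnorm h * 5.
    rewrite -(@ler_pXn2r _ 2) ?nnegrE ?mulr_ge0// real_normK ?num_real// exprMn.
    have q1 := hzsq_le h; have q2 := hzsq_le y.
    have q3 := hdot_hsymp_le h y; have q4 := sqr_ge0 (hdot h y).
    apply: (@le_trans _ _ (hzsq h * hzsq y)); first by lra.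
    apply: ler_pM; rewrite ?hzsq_ge0// (le_trans q2)//.
    by rewrite ler_pXn2r ?nnegrE ?hnorm_ge0.
  have := ler_normD (ht h) (2 * hsymp h y); rewrite normrM (ger0_norm (_ : 0 <= 2))// => t1.
  have : hnorm h ^+ 2 <= hnorm h by rewrite expr2 ler_piMr.
  by lra.
have -> : hmul h y ord0 (lshift 1 j) = hz (hmul h y) ord0 j by rewrite /hz [RHS]mxE.
have -> : y ord0 (lshift 1 j) = hz y ord0 j by rewrite /hz [RHS]mxE.
have -> : hz (hmul h y) ord0 j - hz y ord0 j = hz h ord0 j.
  by rewrite -[hz (hmul h y)]hsubmxK -[hz y]hsubmxK -[hz h]hsubmxK;
     rewrite -/(hx _) -/(hy _) -/(hx y) -/(hy y) -/(hx h) -/(hy h) hxM hyM;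
     rewrite -add_row_mx mxE addrK.
rewrite (@le_trans _ _ (hnorm h))//; last by lra.
rewrite -(@ler_pXn2r _ 2) ?nnegrE// real_normK ?num_real//.
by rewrite (le_trans (dotr_coord _ _))// dotr_hz (hzsq_le h).
Qed.

(** A half-space differs from its translate, inside the ball of radius 5, by a
    subset of a thin slab of a fixed cube. *)
Lemma translation_continuous_ray i (a : R) :
  translation_continuous [set y : H | a < y ord0 i].
Proof.
have mA : measurable [set y : H | a < y ord0 i].
  rewrite -[X in measurable X]setTI.
  apply: (@measurable_fun_ltr _ _ _ setT (cst a) (fun y : H => y ord0 i)) => //.
  exact: measurable_rV_coord.
split => // eta eta0.
(* the measure of a face of the cube of half-side 25 = 5^2, see hcoord_le *)
pose K : R := \prod_(j < n + n + 1 | j != i) 50.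
have K0 : 0 <= K by apply: prodr_ge0.
exists (Num.min 1 (eta / (22 * (K + 1)))).
  by rewrite lt_min ltr01 divr_gt0// mulr_gt0//; lra.
move=> h; rewrite lt_min => /andP[h1 he].
have d0 := hnorm_ge0 h; set d := 11 * hnorm h.
have dE : 0 <= d by rewrite /d; lra.
pose I j : set R := if j == i then `[a - d, a + d]%classic else `[(-25), 25]%classic.
have mI j : measurable (I j) by rewrite /I; case: ifP => _; exact: measurable_itv.
have sub : defect h [set y : H | a < y ord0 i] `<=` [set v | forall j, I j (v ord0 j)].
  move=> y [y5 yd] j; rewrite /I; case: eqP => [->|_]; last first.
    have := @hcoord_le R n y 5 j _ (ltW y5); rewrite (_ : 5 ^+ 2 = 25) -?natrX// ler_norml.
    by rewrite /= in_itv /=; apply; lra.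
  have := @hmul_coord_near h y i (ltW h1) (ltW y5); rewrite ler_norml -/d => /andP[q1 q2].
  rewrite /= in_itv /=; case: yd => -[/= p /negP q]; move: q; rewrite -leNgt => q;
    apply/andP; split; lra.
apply: (@le_trans _ _ (leb [set v | forall j, I j (v ord0 j)])).
  apply: le_measure; rewrite ?inE//; [exact: measurable_defect|exact: measurable_rV_box].
rewrite lebesgue_rV_box//.
rewrite (eq_bigr (fun j => (if j == i then 2 * d else 50)%:E)); last first.
  move=> j _; rewrite /I; case: eqP => _; rewrite lebesgue_measure_itv/= lte_fin.
    by case: ifP => [_|/negbT]; [rewrite -EFinD; congr EFin; lra|
      rewrite -leNgt => dd; congr EFin; lra].
  by rewrite ifT; [rewrite -EFinD; congr EFin; lra|lra].
rewrite prodEFin lee_fin (bigD1 i)//= eqxx.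
rewrite (eq_bigr (fun=> 50)) => [|j /negbTE ->//]; rewrite -/K.
move: he; rewrite ltr_pdivlMr ?mulr_gt0//; last by lra.
have : 0 <= hnorm h by []. rewrite /d; nra.
Qed.

Lemma translation_continuous_sigma_algebra :
  sigma_algebra setT translation_continuous.
Proof.
split; first exact: translation_continuous0.
  by move=> A tA; rewrite setTD; exact: translation_continuousC.
exact: translation_continuous_bigcup.
Qed.

(** The sets whose translates converge to them form a sigma-algebra that
    contains the half-spaces. *)
Lemma measurable_translation_continuous A :
  measurable A -> translation_continuous A.
Proof.
apply: smallest_sub; first exact: translation_continuous_sigma_algebra.
rewrite -bigcup_seq; apply: bigcup_sub => i _ _ [B mB <-]; rewrite setTI.
move: B mB; rewrite -[measurable]/((@ocitv R).-sigma.-measurable) RGenOInfty.measurableE.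
apply: smallest_sub; last first.
  move=> _ [a ->]; rewrite (_ : _ @^-1` _ = [set y : H | a < y ord0 i]).
    exact: translation_continuous_ray.
  by apply/seteqP; split => y /=; rewrite in_itv /= andbT.
split; first exact: translation_continuous0.
  by move=> B tB; rewrite setTD; exact: translation_continuousC.
by move=> F tF; exact: (translation_continuous_bigcup tF).
Qed.

End translation_continuity.

(** * Recovering essential bounds from mollifications *)

Section smoothed_sets.
Variables (R : realType) (n : nat).
Local Notation H := (heis R n).
Local Notation leb := (lebesgue_rV R (n + n + 1)).
Variable eps : R.
Hypothesis eps01 : 0 < eps <= 1.
Local Notation b := (@hbump R n eps).

Local Opaque hbump hmul.

Definition bump_mass : R := \int[leb]_y b y.
Local Notation c := bump_mass.

Let mb : measurable_fun setT b.
Proof. exact: (@measurable_bump R n eps _ _ id). Qed.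

Lemma integral_bump_lty : (\int[leb]_y (b y)%:E < +oo)%E.
Proof.
have [C C0 hC] := @bump_bounded R n eps.
have := @integral_bounded_hb R n b (hb 1) C 1 mb (fun k => bump_ge0 _ _) (@measurable_hb R n 1)
  (@subset_refl _ _) ltr01 (fun k _ => hC k) (ltW C0).
rewrite integral_indicM => h; apply: le_lt_trans (ltry _); apply: le_trans h.
apply: ge0_le_integral => //.
- by move=> y _; rewrite lee_fin bump_ge0.
- exact/measurable_EFinP.
- apply/measurable_EFinP; apply: measurable_funM => //.
  by apply: measurable_indic; exact: (@measurable_hb R n 1).
move=> y _; rewrite lee_fin indicE.
have [y1|y1] := ltP (hnorm y) 1; first by rewrite mem_set// mulr1.
rewrite bump_eq0// ?mul0r//; apply: le_trans y1; by case/andP: eps01.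
Qed.

Lemma integral_bump : (\int[leb]_y (b y)%:E = c%:E)%E.
Proof.
rewrite /bump_mass /Rintegral fineK// ge0_fin_numE ?integral_bump_lty//.
by apply: integral_ge0 => y _; rewrite lee_fin bump_ge0.
Qed.

(** The bump is positive on a ball of positive measure. *)
Lemma bump_mass_gt0 : 0 < c.
Proof.
have c0 : 0 <= c by rewrite -lee_fin -integral_bump; apply: integral_ge0 => y _; rewrite lee_fin bump_ge0.
rewrite lt_neqAle c0 andbT eq_sym; apply/eqP => cE.
have e0 : 0 < eps by case/andP: eps01.
have mE : measurable_fun setT (EFin \o b) by exact/measurable_EFinP.
have : (\int[leb]_(x in setT) `|(EFin \o b) x| = 0)%E.
  rewrite -[RHS]/(0%R%:E) -cE -integral_bump; apply: eq_integral => y _.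
  by rewrite /= ger0_norm ?bump_ge0.
move=> h.
have {}h := (ae_eq_integral_abs leb measurableT mE).1 h.
case: h => N [mN N0 hN].
have : (leb (hb eps) <= leb N)%E.
  apply: le_measure; rewrite ?inE//; first exact: (@measurable_hb R n eps).
  move=> y ye; apply: hN => /= /(_ I)/eqP; rewrite eqe => /eqP b0.
  by have := bump_gt0 eps01 ye; rewrite b0 ltxx.
by rewrite N0 leb_hb// lee_fin leNgt mulr_gt0 ?exprn_gt0 ?hvol_gt0.
Qed.

Lemma integral_bump_quotient x : (\int[leb]_y (b (hmul x (hinv y)))%:E = c%:E)%E.
Proof.
rewrite -integral_bump.
have mE : measurable_fun setT (EFin \o b) by exact/measurable_EFinP.
have b0 y : (0 <= (EFin \o b) y)%E by rewrite lee_fin bump_ge0.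
by rewrite [RHS](ge0_integral_scales (scales_quotient x) mE b0) mul1e.
Qed.

Lemma integral_bump_quotientl y : (\int[leb]_x (b (hmul x (hinv y)))%:E = c%:E)%E.
Proof.
rewrite -integral_bump.
have mE : measurable_fun setT (EFin \o b) by exact/measurable_EFinP.
have b0 x : (0 <= (EFin \o b) x)%E by rewrite lee_fin bump_ge0.
by rewrite [RHS](ge0_integral_scales (scales_hmulr (hinv y)) mE b0) mul1e.
Qed.

Variable A : set H.
Hypotheses (mA : measurable A) (A1 : A `<=` hb 1).

(** By duality, averaging mollifications over A amounts to testing against this
    function, see integral_smoothed_indic. *)
Definition smoothed_indic y : \bar R := (\int[leb]_h (\1_A (hmul h y) * b h)%:E)%E.
Local Notation Phi := smoothed_indic.

Let mhy : measurable_fun setT (fun q : H * H => hmul q.1 q.2).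
Proof. by apply: measurable_hmul; [exact: measurable_fst|exact: measurable_snd]. Qed.

Let mindic : measurable_fun setT (\1_A : H -> R).
Proof. exact: measurable_indic. Qed.

Let mPhi y : measurable_fun setT (fun h => (\1_A (hmul h y) * b h)%:E).
Proof.
apply/measurable_EFinP; apply: measurable_funM => //; apply: (measurableT_comp mindic).
exact: (@measurable_hmul _ _ _ _ id (cst y)).
Qed.

Lemma smoothed_indic_ge0 y : (0 <= Phi y)%E.
Proof. by apply: integral_ge0 => h _; rewrite lee_fin mulr_ge0 ?bump_ge0. Qed.

Lemma measurable_smoothed_indic : measurable_fun setT Phi.
Proof.
pose f (q : H * H) := (\1_A (hmul q.2 q.1) * b q.2)%:E.
apply: (@measurable_fun_fubini_tonelli_F _ _ _ _ _ leb f).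
  apply/measurable_EFinP; apply: measurable_funM.
    apply: (measurableT_comp mindic).
    by apply: measurable_hmul; [exact: measurable_snd|exact: measurable_fst].
  exact: (measurableT_comp mb measurable_snd).
by move=> q; rewrite lee_fin mulr_ge0 ?bump_ge0.
Qed.

Lemma smoothed_indic_le y : (Phi y <= c%:E)%E.
Proof.
rewrite -integral_bump; apply: ge0_le_integral => //.
- by move=> h _; rewrite lee_fin mulr_ge0 ?bump_ge0.
- exact/measurable_EFinP.
by move=> h _; rewrite lee_fin ler_piMl ?bump_ge0// indicE; case: (_ \in _).
Qed.

Lemma smoothed_indic_eq0 y : 2 <= hnorm y -> Phi y = 0%E.
Proof.
move=> y2; apply: integral0_eq => h _; congr EFin; rewrite indicE.
have [hA|_] := boolP (_ \in A); last by rewrite mul0r.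
rewrite mul1r; apply: (bump_eq0 eps01); move: hA; rewrite inE => /A1; rewrite /hb /= => hy1.
have := hnorm_triangle (hinv h) (hmul h y); rewrite hmulKl hnormV.
by case/andP: eps01; lra.
Qed.

(** Tonelli: averaging the mollification of P over A is integrating P against
    the smoothed indicator of A. *)
Lemma integral_smoothed_indic (P : H -> R) : measurable_fun setT P -> (forall y, 0 <= P y) ->
  (\int[leb]_(x in A) \int[leb]_y (P y * b (hmul x (hinv y)))%:E =
   \int[leb]_y ((P y)%:E * Phi y))%E.
Proof.
move=> mP P0.
pose f (q : H * H) := (\1_A q.1 * (P q.2 * b (hmul q.1 (hinv q.2))))%:E.
have mf : measurable_fun setT f.
  apply/measurable_EFinP; apply: measurable_funM.
    exact: (measurableT_comp mindic measurable_fst).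
  apply: measurable_funM; first exact: (measurableT_comp mP measurable_snd).
  apply: measurable_bump; apply: measurable_hmul; first exact: measurable_fst.
  by apply: measurable_hinv; exact: measurable_snd.
have f0 q : (0 <= f q)%E by rewrite lee_fin !mulr_ge0 ?bump_ge0.
have F := fubini_tonelli (m1 := leb) (m2 := leb) _ mf f0.
transitivity (\int[leb]_x \int[leb]_y f (x, y))%E.
  rewrite integral_mkcond; apply: eq_integral => x _; rewrite patchE /f /= indicE.
  case: ifPn => _; first by apply: eq_integral => y _; rewrite mul1r.
  by apply/esym; apply: integral0_eq => y _; rewrite mul0r.
apply: (eq_trans F).
apply: eq_integral => y _.
have mg : measurable_fun setT (fun x => f (x, y)).
  exact: (measurableT_comp mf (pair2_measurable y)).
have E := ge0_integral_scales (scales_hmulr y) mg (fun x => f0 _).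
apply: (eq_trans E).
rewrite mul1e; have Z := ge0_integralZl_EFin leb measurableT _ (mPhi y) (P0 y).
rewrite -Z => [|h _]; last by rewrite lee_fin mulr_ge0 ?bump_ge0.
apply: eq_integral => h _; rewrite /f /= hmulKr -EFinM; exact: (congr1 EFin (mulrCA _ _ _)).
Qed.

Lemma integral_smoothed : (\int[leb]_y Phi y = c%:E * leb A)%E.
Proof.
have E := @integral_smoothed_indic (cst 1) (measurable_cst _) (fun _ => ler01).
have E1 : (\int[leb]_y Phi y = \int[leb]_y ((cst 1 y)%:E * Phi y))%E.
  by apply: eq_integral => y _; rewrite mul1e.
apply: (eq_trans E1); apply: (eq_trans (esym E)).
rewrite -(integral_cst leb mA); apply: eq_integral => x _.
apply: eq_trans (integral_bump_quotient x).
by apply: eq_integral => y _; rewrite mul1r.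
Qed.

(** The mass that leaves A is an average over |h| < eps of the measures of h^-1
    A \ A. *)
Lemma integral_smoothed_setC (eta : R) : 0 <= eta ->
  (forall h : H, hnorm h < eps -> (leb (hmul h @^-1` A `\` A) <= eta%:E)%E) ->
  (\int[leb]_(y in ~` A) Phi y <= (c * eta)%:E)%E.
Proof.
move=> eta0 heta.
pose f (q : H * H) := (b q.1 * \1_(hmul q.1 @^-1` A `\` A) q.2)%:E.
have fE q : f q = (b q.1 * (\1_A (hmul q.1 q.2) * \1_(~` A) q.2))%:E.
  by rewrite /f setDE indicI /= !indicE.
have mf : measurable_fun setT f.
  rewrite (funext fE); apply/measurable_EFinP; apply: measurable_funM.
    exact: (measurableT_comp mb measurable_fst).
  apply: measurable_funM; first exact: (measurableT_comp mindic mhy).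
  apply: (measurableT_comp _ measurable_snd); apply: measurable_indic; exact: measurableC.
have f0 q : (0 <= f q)%E by rewrite lee_fin !mulr_ge0 ?bump_ge0.
have F := fubini_tonelli (m1 := leb) (m2 := leb) _ mf f0.
have -> : (\int[leb]_(y in ~` A) Phi y = \int[leb]_y \int[leb]_h f (h, y))%E.
  rewrite integral_mkcond; apply: eq_integral => y _; rewrite patchE.
  case: ifPn => yA; last first.
    apply/esym; apply: integral0_eq => h _; rewrite fE /= [X in _ * (_ * X)]indicE.
    by rewrite (negbTE yA) !mulr0.
  apply: eq_integral => h _; rewrite fE /= [X in _ = (_ * (_ * X))%:E]indicE yA mulr1.
  by rewrite mulrC.
rewrite -F.
apply: (@le_trans _ _ (\int[leb]_h (b h * eta)%:E)%E); last first.
  have mbE : measurable_fun setT (EFin \o b) by exact/measurable_EFinP.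
  have b0 h : setT h -> (0 <= (EFin \o b) h)%E by rewrite lee_fin bump_ge0.
  have Z := ge0_integralZl_EFin leb measurableT b0 mbE eta0.
  rewrite (eq_integral (fun h => eta%:E * (EFin \o b) h)%E) => [|h _].
    by rewrite Z integral_bump -EFinM mulrC.
  by rewrite -EFinM; exact: (congr1 EFin (mulrC _ _)).
apply: ge0_le_integral; [exact: measurableT| | | |].
- by move=> h _; apply: integral_ge0 => y _; exact: f0.
- exact: (measurable_fun_fubini_tonelli_F (m2 := leb) _ mf f0).
- by apply/measurable_EFinP; exact: measurable_funM.
move=> h _.
have mhA : measurable (hmul h @^-1` A `\` A).
  by apply: measurableD; [exact: measurable_translate|exact: mA].
have mi : measurable_fun setT (EFin \o (\1_(hmul h @^-1` A `\` A) : H -> R)).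
  by apply/measurable_EFinP; exact: measurable_indic.
have i0 y : setT y -> (0 <= (EFin \o (\1_(hmul h @^-1` A `\` A) : H -> R)) y :> \bar R)%E by rewrite lee_fin.
have Z := ge0_integralZl_EFin leb measurableT i0 mi (bump_ge0 eps h).
apply: (eq_ind_r (fun t => (t <= _)%E) _ Z).
have I := integral_indic leb measurableT mhA; rewrite setIT in I.
apply: (eq_ind_r (fun t => ((b h)%:E * t <= _)%E) _ I); rewrite EFinM.
have [he|he] := ltP (hnorm h) eps.
  by apply: lee_wpmul2l; [rewrite lee_fin bump_ge0|exact: heta].
by rewrite (bump_eq0 eps01 he) !mul0e.
Qed.

End smoothed_sets.

Section superlevel.
Variables (R : realType) (n : nat).
Local Notation H := (heis R n).
Local Notation leb := (lebesgue_rV R (n + n + 1)).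

Local Opaque hbump hmul.

Section one_scale.
Variables (W : H -> R) (A : set H) (G delta eta lam eps : R).
Hypotheses (mW : measurable_fun setT W)
  (iW : (\int[leb]_(y in hb 3) (W y ^+ 2)%:E <= G%:E)%E)
  (mA : measurable A) (A1 : A `<=` hb 1) (delta0 : 0 < delta)
  (WA : forall y, A y -> delta <= W y) (lam0 : 0 < lam) (eta0 : 0 <= eta)
  (eps01 : 0 < eps <= 1)
  (heta : forall h : H, hnorm h < eps -> (leb (hmul h @^-1` A `\` A) <= eta%:E)%E).
Local Notation b := (@hbump R n eps).
Local Notation c := (@bump_mass R n eps).
Local Notation Phi := (smoothed_indic eps A).
Let Wp y := Num.max (W y) 0.
Let Wm y := Num.max (- W y) 0.

Let mWp : measurable_fun setT Wp. Proof. exact: measurable_maxr. Qed.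
Let mWm : measurable_fun setT Wm.
Proof. by apply: measurable_maxr => //; exact: measurable_funN. Qed.
Let Wp0 y : 0 <= Wp y. Proof. by rewrite le_max lexx orbT. Qed.
Let Wm0 y : 0 <= Wm y. Proof. by rewrite le_max lexx orbT. Qed.

Let mPhi : measurable_fun setT Phi.
Proof. exact: measurable_smoothed_indic. Qed.

Let Phi0 y : (0 <= Phi y)%E. Proof. exact: smoothed_indic_ge0. Qed.

Let c0 : 0 < c. Proof. exact: bump_mass_gt0. Qed.

Lemma smoothed_indic_lower : (delta%:E * \int[leb]_(y in A) Phi y <=
  \int[leb]_y ((Wp y)%:E * Phi y))%E.
Proof.
rewrite -ge0_integralZl_EFin ?(ltW delta0)//; last exact: measurable_funTS.
rewrite integral_mkcond; apply: ge0_le_integral.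
- exact: measurableT.
- by move=> y _; rewrite patchE; case: ifP => // _; rewrite mule_ge0// lee_fin ltW.
- apply/(measurable_restrictT _ mA); apply: emeasurable_funM; first exact: measurable_cst.
  exact: measurable_funTS.
- by apply: emeasurable_funM => //; exact/measurable_EFinP.
move=> y _; rewrite patchE; case: ifPn => [|_]; last by rewrite mule_ge0// lee_fin.
rewrite inE => yA; apply: lee_wpmul2r => //; rewrite lee_fin /Wp le_max WA//.
Qed.

(** Off A, the negative part of W is split at height lam: below it, the smoothed
    indicator has small mass; above it, W is at most W^2 / lam. *)
Lemma smoothed_indic_upper : (\int[leb]_y ((Wm y)%:E * Phi y) <=
  (lam * (c * eta) + c / lam * G)%:E)%E.
Proof.
pose g y : \bar R := (lam%:E * (Phi \_ (~` A)) y + (c / lam)%:E * ((fun y => (W y ^+ 2)%:E) \_ (hb 3)) y)%E.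
have m3 := @measurable_hb R n 3.
have mW2 : measurable_fun setT (fun y => (W y ^+ 2)%:E).
  by apply/measurable_EFinP; exact: measurable_funX.
have mg1 : measurable_fun setT (fun y => lam%:E * (Phi \_ (~` A)) y)%E.
  apply: emeasurable_funM; first exact: measurable_cst.
  by apply/(measurable_restrictT _ (measurableC mA)); exact: measurable_funTS.
have mg2 : measurable_fun setT (fun y => (c / lam)%:E * ((fun y => (W y ^+ 2)%:E) \_ (hb 3)) y)%E.
  apply: emeasurable_funM; first exact: measurable_cst.
  by apply/(measurable_restrictT _ m3); exact: measurable_funTS.
have r1 y : (0 <= (Phi \_ (~` A)) y)%E by rewrite patchE; case: ifP.
have r2 y : (0 <= ((fun y => (W y ^+ 2)%:E) \_ (hb 3)) y)%E.
  by rewrite patchE; case: ifP => // _; rewrite lee_fin sqr_ge0.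
have cl : 0 <= c / lam by rewrite divr_ge0// ltW.
have g1 y : (0 <= lam%:E * (Phi \_ (~` A)) y)%E by rewrite mule_ge0// lee_fin ltW.
have g2 y : (0 <= (c / lam)%:E * ((fun y => (W y ^+ 2)%:E) \_ (hb 3)) y)%E.
  by rewrite mule_ge0.
apply: (@le_trans _ _ (\int[leb]_y g y)%E).
  apply: ge0_le_integral; [exact: measurableT| | | |].
  - by move=> y _; rewrite mule_ge0// lee_fin.
  - by apply: emeasurable_funM => //; exact/measurable_EFinP.
  - exact: emeasurable_funD.
  move=> y _; rewrite /g !patchE.
  have [yA|yA] := pselect (A y).
    have -> : Wm y = 0.
      by apply: max_idPr; rewrite oppr_le0 (le_trans (ltW delta0))// WA.
    by rewrite mul0e adde_ge0// ?mule_ge0 ?lee_fin ?(ltW lam0)//;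
      case: ifP => // _; rewrite lee_fin sqr_ge0.
  rewrite ifT; last by rewrite inE.
  have [y3|y3] := ltP (hnorm y) 3; last first.
    rewrite (smoothed_indic_eq0 eps01 A1); last by rewrite (le_trans _ y3)// ler_nat.
    by rewrite !mule0 add0e mule_ge0//; case: ifP => // _; rewrite lee_fin sqr_ge0.
  rewrite ifT; last by rewrite inE.
  have le : (Phi y <= c%:E)%E by exact: smoothed_indic_le.
  have fin : Phi y \is a fin_num by rewrite ge0_fin_numE// (le_lt_trans le)// ltry.
  have := Phi0 y; rewrite -(fineK fin) in le *; move: le.
  move: (fine (Phi y)) => p; rewrite -!EFinM -EFinD !lee_fin => pc p0.
  have h : Wm y <= lam + W y ^+ 2 / lam.
    rewrite -(ler_pM2r lam0) mulrDl divfK ?gt_eqF//.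
    have : Wm y ^+ 2 <= W y ^+ 2.
      rewrite -[W y ^+ 2]real_normK ?num_real// ler_pXn2r ?nnegrE//.
      by rewrite ge_max normr_ge0 -normrN ler_norm.
    by have := sqr_ge0 (Wm y - lam); have := sqr_ge0 lam; have := mulr_ge0 (Wm0 y) (ltW lam0); nra.
  have k0 : 0 <= W y ^+ 2 / lam by rewrite divr_ge0 ?sqr_ge0// ltW.
  rewrite (_ : c / lam * W y ^+ 2 = c * (W y ^+ 2 / lam)); last by ring.
  have h1 := ler_wpM2r p0 h; apply: le_trans h1 _.
  by rewrite mulrDl lerD2l mulrC ler_wpM2r.
rewrite ge0_integralD// ge0_integralZl_EFin// ?(ltW lam0)//; last first.
  by apply/(measurable_restrictT _ (measurableC mA)); exact: measurable_funTS.
rewrite ge0_integralZl_EFin//; last first.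
  by apply/(measurable_restrictT _ m3); exact: measurable_funTS.
rewrite -!integral_mkcond EFinD !EFinM; apply: leeD.
  by rewrite lee_pmul2l ?lte_fin// -EFinM; exact: integral_smoothed_setC.
by apply: lee_wpmul2l.
Qed.

(** If no point of A had a positive mollified value, the average over A would be
    nonpositive; but it is at least delta times the mass that stays in A, minus
    the contribution of the negative part. *)
Lemma superlevel_average : (forall x, A x ->
    (\int[leb]_y (Wp y * b (hmul x (hinv y)))%:E <= \int[leb]_y (Wm y * b (hmul x (hinv y)))%:E)%E) ->
  delta * (fine (leb A) - eta) <= lam * eta + G / lam.
Proof.
move=> h.
have i1 : (\int[leb]_y ((Wp y)%:E * Phi y) <= \int[leb]_y ((Wm y)%:E * Phi y))%E.
  have Ep := @integral_smoothed_indic R n eps A mA _ mWp Wp0.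
  have Em := @integral_smoothed_indic R n eps A mA _ mWm Wm0.
  apply: (eq_ind _ (fun t => (t <= _)%E) _ _ Ep).
  apply: (eq_ind _ (fun t => (_ <= t)%E) _ _ Em).
  apply: ge0_le_integral; [exact: mA| | | |exact: h].
  - by move=> x _; apply: integral_ge0 => y _; rewrite lee_fin mulr_ge0 ?bump_ge0.
  - by apply: measurable_funTS; exact: (@measurable_integral_bump R n eps Wp mWp Wp0).
  - by apply: measurable_funTS; exact: (@measurable_integral_bump R n eps Wm mWm Wm0).
have i2 := le_trans smoothed_indic_lower (le_trans i1 smoothed_indic_upper).
have i3 := integral_smoothed_setC eps01 mA eta0 heta.
have fA : leb A \is a fin_num.
  rewrite ge0_fin_numE//; apply: le_lt_trans (hb1_lty R n).
  by apply: le_measure; rewrite ?inE//; exact: (@measurable_hb R n 1).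
have := integral_smoothed eps01 mA.
have -> : (\int[leb]_y Phi y = \int[leb]_(y in A) Phi y + \int[leb]_(y in ~` A) Phi y)%E.
  rewrite -(setUv A) ge0_integral_setU//; first exact: measurableC.
  - by rewrite setUv.
  - by apply/disj_setPCl.
have q1 := @integral_ge0 _ _ _ leb A Phi (fun y _ => Phi0 y).
have q2 := @integral_ge0 _ _ _ leb (~` A) Phi (fun y _ => Phi0 y).
move: q1 q2 i2 i3; rewrite -(fineK fA).
case: (\int[leb]_(y in A) Phi y)%E => [a| |] //; case: (\int[leb]_(y in ~` A) Phi y)%E => [a'| |] //.
  rewrite -!EFinM !lee_fin => _ _ d1 d2 [d3].
  have d4 : delta * (c * (fine (leb A) - eta)) <= delta * a by rewrite ler_pM2l//; lra.
  rewrite -(ler_pM2l c0); apply: le_trans (_ : _ <= delta * a) _; first by rewrite mulrCA.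
  apply: le_trans d1 _; rewrite le_eqVlt; apply/orP; left; apply/eqP; ring.
Qed.

End one_scale.

(** Were the conclusion to fail, superlevel_average would contradict the choice
    of lam, large in terms of the L^2 norm of W, and then of eta, small in terms
    of lam. *)
Lemma moll_superlevel (W : H -> R) (A : set H) (delta : R) :
  measurable_fun setT W -> (\int[leb]_(y in hb 3) (W y ^+ 2)%:E < +oo)%E ->
  measurable A -> A `<=` hb 1 -> (0 < leb A)%E ->
  0 < delta -> (forall y, A y -> delta <= W y) ->
  exists2 e0 : R, 0 < e0 & forall eps, 0 < eps <= 1 -> eps <= e0 ->
    exists2 x, A x & (\int[leb]_y (Num.max (- W y) 0 * hbump eps (hmul x (hinv y)))%:E <
                     \int[leb]_y (Num.max (W y) 0 * hbump eps (hmul x (hinv y)))%:E)%E.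
Proof.
move=> mW iW mA A1 Apos d0 WA.
pose G := fine (\int[leb]_(y in hb 3) (W y ^+ 2)%:E)%E.
have W20 : (0 <= \int[leb]_(y in hb 3) (W y ^+ 2)%:E)%E.
  by apply: integral_ge0 => y _; rewrite lee_fin sqr_ge0.
have hG : (\int[leb]_(y in hb 3) (W y ^+ 2)%:E <= G%:E)%E by rewrite /G fineK// ge0_fin_numE.
have G0 : 0 <= G by rewrite fine_ge0.
set m := fine (leb A).
have m0 : 0 < m.
  rewrite fine_gt0// Apos /=; apply: le_lt_trans (hb1_lty R n).
  by apply: le_measure; rewrite ?inE//; exact: (@measurable_hb R n 1).
have dm : 0 < delta * m by rewrite mulr_gt0.
(* delta m / 4 bounds both G / lam and lam eta, while delta (m - eta) >= 3 delta m / 4 *)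
pose lam := 4 * G / (delta * m) + 1.
have lam0 : 0 < lam by rewrite ltr_wpDl// divr_ge0 ?(ltW dm)// mulr_ge0.
pose eta := Num.min (m / 4) (delta * m / (4 * lam)).
have eta0 : 0 < eta by rewrite lt_min !divr_gt0// mulr_gt0.
have [e0 e00 he] := (measurable_translation_continuous mA).2 _ eta0.
exists e0 => // eps eps01 epse; apply: contrapT => hne.
have hle x : A x ->
    (\int[leb]_y (Num.max (W y) 0 * hbump eps (hmul x (hinv y)))%:E <=
     \int[leb]_y (Num.max (- W y) 0 * hbump eps (hmul x (hinv y)))%:E)%E.
  by move=> Ax; rewrite leNgt; apply/negP => hlt; apply: hne; exists x.
have heta h : hnorm h < eps -> (leb (hmul h @^-1` A `\` A) <= eta%:E)%E.
  move=> hh; apply: le_trans (he h (lt_le_trans hh epse)).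
  apply: le_measure; rewrite ?inE//; last 2 first.
    exact: measurable_defect.
  - move=> y [yA nyA]; split; last by left.
    have := hnorm_triangle (hinv h) (hmul h y); rewrite hmulKl hnormV.
    by have := A1 _ yA; rewrite /hb /=; case/andP: eps01; lra.
  by apply: measurableD => //; exact: measurable_translate.
have := superlevel_average mW hG mA A1 d0 WA lam0 (ltW eta0) eps01 heta hle; rewrite -/m.
have l1 : lam * eta <= delta * m / 4.
  apply: (@le_trans _ _ (lam * (delta * m / (4 * lam)))).
    by rewrite ler_pM2l// /eta ge_min lexx orbT.
  rewrite le_eqVlt; apply/orP; left; apply/eqP; field; exact: lt0r_neq0.
have l2 : G / lam <= delta * m / 4.
  rewrite ler_pdivrMr// /lam mulrDr mulr1.
  have -> : delta * m / 4 * (4 * G / (delta * m)) = G by field; rewrite !gt_eqF.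
  by rewrite lerDl divr_ge0// ltW.
have l3 : eta <= m / 4 by rewrite /eta ge_min lexx.
have l4 : delta * eta <= delta * (m / 4) by rewrite ler_pM2l.
rewrite mulrBr; move: l1 l2 l4 dm; move: (lam * eta) (G / lam) (delta * eta).
by rewrite mulrA; move: (delta * m) => t u v w; lra.
Qed.

End superlevel.

Section mollification_limit.
Variables (R : realType) (n : nat).
Local Notation H := (heis R n).
Local Notation leb := (lebesgue_rV R (n + n + 1)).

Local Opaque hbump hmul.

Lemma Rintegral_gt0 d (X : measurableType d) (mu : {measure set X -> \bar R}) (f : X -> R) :
  mu.-integrable setT (EFin \o f) ->
  (\int[mu]_x (Num.max (- f x) 0)%:E < \int[mu]_x (Num.max (f x) 0)%:E)%E ->
  0 < \int[mu]_x f x.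
Proof.
move=> fi h; have fn : (\int[mu]_x (f x)%:E)%E \is a fin_num by exact: (integrable_fin_num measurableT fi).
suff : (0 < \int[mu]_x (f x)%:E)%E.
  by move=> h0; rewrite -lte_fin /Rintegral fineK.
rewrite integralE.
have -> : (\int[mu]_x ((fun x => (f x)%:E)^\+ x) = \int[mu]_x (Num.max (f x) 0)%:E)%E.
  by apply: eq_integral => x _; rewrite funeposE EFin_max.
have -> : (\int[mu]_x ((fun x => (f x)%:E)^\- x) = \int[mu]_x (Num.max (- f x) 0)%:E)%E.
  by apply: eq_integral => x _; rewrite funenegE -EFinN EFin_max.
rewrite sube_gt0//.
Qed.

Variable U : H -> R.
Hypothesis sU : square_integrable leb U.

Lemma integral_sqr_sub_lty (a : R) : (\int[leb]_(y in hb 3) ((U y - a) ^+ 2)%:E < +oo)%E.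
Proof.
have [mU iU] := sU; have m3 := @measurable_hb R n 3.
have mU2 : measurable_fun setT (fun y => U y ^+ 2) by exact: measurable_funX.
apply: (@le_lt_trans _ _ (\int[leb]_(y in hb 3) ((2 * U y ^+ 2)%:E + (2 * a ^+ 2)%:E))%E).
  apply: ge0_le_integral; [exact: m3| | | |].
  - by move=> y _; rewrite lee_fin sqr_ge0.
  - apply/measurable_EFinP; apply: measurable_funTS; apply: measurable_funX.
    exact: measurable_funB.
  - apply/measurable_EFinP; apply: measurable_funTS; apply: measurable_funD => //.
    exact: measurable_funM.
  move=> y _; rewrite -EFinD lee_fin.
  have := sqr_ge0 (U y + a); move: (U y) => t; nra.
rewrite ge0_integralD//; last 3 first.
- by move=> y _; rewrite lee_fin mulr_ge0 ?sqr_ge0.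
- by apply/measurable_EFinP; apply: measurable_funTS; exact: measurable_funM.
- by move=> y _; rewrite lee_fin mulr_ge0 ?sqr_ge0.
have -> : (\int[leb]_(y in hb 3) (2 * a ^+ 2)%:E = (2 * a ^+ 2 * (3 ^+ hdim n * hvol R n))%:E)%E.
  by rewrite integral_cst// [RHS]EFinM -leb_hb.
rewrite lte_add_pinfty ?ltry//.
rewrite (eq_integral (fun y => 2%:E * (U y ^+ 2)%:E)%E) => [|y _]; last by rewrite EFinM.
rewrite ge0_integralZl_EFin//; last 2 first.
- by move=> y _; rewrite lee_fin sqr_ge0.
- by apply/measurable_EFinP; exact: measurable_funTS.
rewrite lte_mul_pinfty//; apply: le_lt_trans iU.
by apply: ge0_subset_integral => //; [exact/measurable_EFinP|move=> y _; rewrite lee_fin sqr_ge0].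
Qed.

Section one_scale.
Variable eps : R.
Hypothesis eps01 : 0 < eps <= 1.
Local Notation b := (@hbump R n eps).
Local Notation c := (@bump_mass R n eps).

Lemma integrable_bump_quotient x :
  leb.-integrable setT (EFin \o (fun y => b (hmul x (hinv y)))).
Proof.
have [mp _] := square_integrable_bump eps01 x.
apply/integrableP; split; first exact/measurable_EFinP.
rewrite (eq_integral (fun y => (b (hmul x (hinv y)))%:E)) => [|y _].
  by rewrite integral_bump_quotient// ltry.
by rewrite /= ger0_norm ?bump_ge0.
Qed.

Lemma Rintegral_bump_quotient x : \int[leb]_y b (hmul x (hinv y)) = c.
Proof. by rewrite /Rintegral integral_bump_quotient. Qed.

Lemma max_mulr (t p : R) : 0 <= p -> Num.max (t * p) 0 = Num.max t 0 * p.
Proof. by move=> p0; rewrite maxr_pMl// mul0r. Qed.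

(** A mollification of k U + a is k moll U + a c. *)
Lemma moll_affine_gt0 (k a : R) x :
  (\int[leb]_y (Num.max (- (k * U y + a)) 0 * b (hmul x (hinv y)))%:E <
   \int[leb]_y (Num.max (k * U y + a) 0 * b (hmul x (hinv y)))%:E)%E ->
  0 < k * moll U eps x + a * c.
Proof.
move=> h.
have i1 := integrable_scaler k (integrable_moll sU eps01 x).
have i2 := integrable_scaler a (integrable_bump_quotient x).
have i3 := integrable_addr i1 i2.
have E : \int[leb]_y (k * (U y * b (hmul x (hinv y))) + a * b (hmul x (hinv y))) =
    k * moll U eps x + a * c.
  apply: (eq_trans (Rintegral_addr i1 i2)); apply: f_equal2.
    exact: (Rintegral_scaler k (integrable_moll sU eps01 x)).
  apply: (eq_trans (Rintegral_scaler a (integrable_bump_quotient x))).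
  exact: (congr1 (fun t => a * t) (Rintegral_bump_quotient x)).
apply: (eq_ind _ (fun t => 0 < t) _ _ E); apply: Rintegral_gt0; first exact: i3.
have D (t p : R) : k * (t * p) + a * p = (k * t + a) * p by ring.
apply: le_lt_trans (lt_le_trans h _); rewrite le_eqVlt; apply/orP; left; apply/eqP;
  apply: eq_integral => y _; apply: (congr1 EFin).
- apply: (eq_trans (congr1 (fun t => Num.max (- t) 0) (D _ _))).
  by rewrite -mulNr max_mulr ?bump_ge0.
- apply: esym; apply: (eq_trans (congr1 (fun t => Num.max t 0) (D _ _))).
  by rewrite max_mulr ?bump_ge0.
Qed.

(** For |x| < 3 the bump centred at x only sees points where U is nonnegative. *)
Lemma moll_ge0 x : (\forall y \ae leb, hnorm y < 6 -> 0 <= U y) -> hnorm x < 3 ->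
  0 <= moll U eps x.
Proof.
move=> U0 x3; rewrite (moll_posneg sU eps01 x).
have [mU _] := sU; have [mp _] := square_integrable_bump eps01 x.
suff -> : \int[leb]_y (Num.max (- U y) 0 * b (hmul x (hinv y))) = 0.
  rewrite subr0; apply: Rintegral_ge0 => y _.
  by rewrite mulr_ge0 ?bump_ge0// le_max lexx orbT.
rewrite /Rintegral (ge0_ae_eq_integral (g := cst 0%E)); [by rewrite integral0| | | | | |] => //.
- apply/measurable_EFinP; apply: measurable_funM => //.
  by apply: measurable_maxr => //; exact: measurable_funN.
- by move=> y _; rewrite lee_fin mulr_ge0 ?bump_ge0// le_max lexx orbT.
apply: filterS U0 => y Uy _; apply: (congr1 EFin).
have [y6|y6] := ltP (hnorm y) 6.
  by rewrite max_r ?mul0r// oppr_le0 Uy.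
by rewrite (bump_support eps01 (A := 6)) ?mulr0//; case/andP: eps01; lra.
Qed.

Variable s : R.
Hypothesis s01 : 0 < s < 1.

Lemma square_integrable_kap1 : square_integrable leb (kap1 s : H -> R).
Proof.
have mk := @measurable_kap1 R n s; split => //.
apply: le_lt_trans (integrable_lty measurableT (integrable_kap1 n s01)).
apply: ge0_le_integral; [exact: measurableT| | | |].
- by move=> y _; rewrite lee_fin sqr_ge0.
- by apply/measurable_EFinP; exact: measurable_funX.
- exact/measurable_EFinP.
by move=> y _; rewrite lee_fin expr2 ler_piMr ?kap1_ge0 ?kap1_le1.
Qed.

Lemma integrable_kap1_neg :
  leb.-integrable setT (EFin \o (fun y => kap1 s y * Num.max (- U y) 0)).
Proof. exact: (integrable_mul_square square_integrable_kap1 (square_integrable_neg sU)). Qed.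

Lemma moll_neg_le z : Num.max (- moll U eps z) 0 <=
  \int[leb]_y (Num.max (- U y) 0 * b (hmul z (hinv y))).
Proof.
have h t y : 0 <= Num.max t 0 * b (hmul z (hinv y)).
  by rewrite mulr_ge0 ?bump_ge0// le_max lexx orbT.
rewrite ge_max; apply/andP; split; last by apply: Rintegral_ge0 => y _; exact: h.
rewrite (moll_posneg sU eps01 z) opprB lerBlDr lerDl.
by apply: Rintegral_ge0 => y _; exact: h.
Qed.

Lemma scaled_le (k k' v w P : R) : 0 <= v -> 0 <= w -> (0 < w -> k <= P * k') ->
  k * (v * w) <= P * (k' * v) * w.
Proof.
move=> v0; rewrite le_eqVlt => /orP[/eqP <-|w0 h]; first by rewrite !mulr0.
by rewrite !mulrA ler_wpM2r ?(ltW w0)// ler_wpM2r// h.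
Qed.

(** Mollification at a scale at most 1 moves points by at most 1, which changes
    the truncated kernel by a bounded factor. *)
Lemma moll_neg_tail : \int[leb]_z (kap1 s z * Num.max (- moll U eps z) 0) <=
  3 `^ hexp n s * c * \int[leb]_y (kap1 s y * Num.max (- U y) 0).
Proof.
have [mU _] := sU; pose Um y := Num.max (- U y) 0.
have Um0 y : 0 <= Um y by rewrite /Um le_max lexx orbT.
have mUm : measurable_fun setT Um by apply: measurable_maxr => //; exact: measurable_funN.
have mk := @measurable_kap1 R n s.
have c0 := ltW (bump_mass_gt0 n eps01).
have p0 : 0 <= 3 `^ hexp n s :> R by exact: powR_ge0.
have g0 z : (0 <= (kap1 s z * Num.max (- moll U eps z) 0)%:E)%E.
  by rewrite lee_fin mulr_ge0 ?kap1_ge0// le_max lexx orbT.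
have mg : measurable_fun setT (fun z => (kap1 s z * Num.max (- moll U eps z) 0)%:E).
  apply/measurable_EFinP; apply: measurable_funM; first exact: mk.
  apply: measurable_maxr; last exact: measurable_cst.
  by apply: measurable_funN; exact: measurable_moll.
have iT := integrable_kap1_neg; set T := \int[leb]_y (kap1 s y * Num.max (- U y) 0).
have k10 y : setT y -> (0 <= (kap1 s y * Um y)%:E)%E by rewrite lee_fin mulr_ge0 ?kap1_ge0.
have mk1 : measurable_fun setT (fun y => (kap1 s y * Um y)%:E).
  by apply/measurable_EFinP; apply: measurable_funM; [exact: mk|exact: mUm].
have pc0 : 0 <= 3 `^ hexp n s * c by rewrite mulr_ge0.
have ET : (\int[leb]_y (kap1 s y * Um y)%:E = T%:E)%E.
  exact: (esym (fineK (integrable_fin_num measurableT iT))).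
suff : (\int[leb]_z (kap1 s z * Num.max (- moll U eps z) 0)%:E <= (3 `^ hexp n s * c * T)%:E)%E.
  rewrite /Rintegral => h; rewrite -lee_fin fineK// ge0_fin_numE.
    exact: le_lt_trans h (ltry _).
  by apply: integral_ge0 => z _; exact: g0.
pose f (q : H * H) := (kap1 s q.1 * (Um q.2 * b (hmul q.1 (hinv q.2))))%:E.
have mf : measurable_fun setT f.
  apply/measurable_EFinP; apply: measurable_funM; first exact: (measurableT_comp mk measurable_fst).
  apply: measurable_funM; first exact: (measurableT_comp mUm measurable_snd).
  apply: measurable_bump; apply: measurable_hmul; first exact: measurable_fst.
  by apply: measurable_hinv; exact: measurable_snd.
have f0 q : (0 <= f q)%E by rewrite lee_fin !mulr_ge0 ?bump_ge0 ?kap1_ge0.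
have F := fubini_tonelli (m1 := leb) (m2 := leb) _ mf f0.
apply: (@le_trans _ _ (\int[leb]_z \int[leb]_y f (z, y))%E).
  apply: ge0_le_integral; [exact: measurableT| | | |].
  - by move=> z _; exact: g0.
  - exact: mg.
  - exact: (measurable_fun_fubini_tonelli_F (m2 := leb) _ mf f0).
  move=> z _.
  have mp : measurable_fun setT (fun y => (Um y * b (hmul z (hinv y)))%:E).
    apply/measurable_EFinP; apply: measurable_funM; first exact: mUm.
    by have [] := square_integrable_bump eps01 z.
  have Z := ge0_integralZl_EFin leb measurableT _ mp (kap1_ge0 s z).
  apply: (@le_trans _ _ ((kap1 s z)%:E * \int[leb]_y (Um y * b (hmul z (hinv y)))%:E)%E); last first.
    rewrite -Z => [|y _]; last by rewrite lee_fin mulr_ge0 ?bump_ge0.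
    rewrite le_eqVlt; apply/orP; left; apply/eqP; apply: eq_integral => y _.
    by rewrite -EFinM.
  rewrite EFinM; apply: lee_wpmul2l; first by rewrite lee_fin kap1_ge0.
  have iz := integrable_mul_square (square_integrable_neg sU) (square_integrable_bump eps01 z).
  have fz := integrable_fin_num measurableT iz.
  rewrite -(fineK fz); exact: moll_neg_le.
have Z2 := ge0_integralZl_EFin leb measurableT k10 mk1 pc0.
apply: (@le_trans _ _ (\int[leb]_y ((3 `^ hexp n s * c)%:E * (kap1 s y * Um y)%:E))%E); last first.
  by rewrite Z2 ET EFinM.
apply: (eq_ind_r (fun t => (t <= _)%E) _ F).
apply: ge0_le_integral; [exact: measurableT| | | |].
- by move=> y _; apply: integral_ge0 => z _; exact: f0.
- exact: (measurable_fun_fubini_tonelli_G (m1 := leb) _ mf f0).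
- by apply: emeasurable_funM; [exact: measurable_cst|exact: mk1].
move=> y _.
have mb : measurable_fun setT (fun z => (b (hmul z (hinv y)))%:E).
  apply/measurable_EFinP; apply: measurable_bump.
  exact: (@measurable_hmul _ _ _ _ id (cst (hinv y))).
pose C := 3 `^ hexp n s * (kap1 s y * Um y).
have C0 : 0 <= C by rewrite !mulr_ge0 ?kap1_ge0.
have Z := ge0_integralZl_EFin leb measurableT _ mb C0.
apply: (@le_trans _ _ (C%:E * \int[leb]_z (b (hmul z (hinv y)))%:E)%E); last first.
  rewrite (le_eqVlt); apply/orP; left; apply/eqP.
  apply: (eq_trans (congr1 (fun t => (C%:E * t)%E) (integral_bump_quotientl eps01 y))).
  apply: (eq_trans (esym (EFinM _ _))); apply: (eq_trans _ (EFinM _ _)).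
  by apply: (congr1 EFin); exact: mulrAC.
rewrite -Z => [|z _]; last by rewrite lee_fin bump_ge0.
apply: ge0_le_integral; [exact: measurableT| | | |].
- by move=> z _; exact: f0.
- exact: (measurableT_comp mf (pair2_measurable y)).
- by apply: emeasurable_funM; [exact: measurable_cst|exact: mb].
move=> z _; rewrite -EFinM lee_fin /C /=.
apply: scaled_le; [exact: Um0|exact: bump_ge0|move=> B0; apply: kap1_compare; first exact: s01].
have h : hnorm (hmul z (hinv y)) < eps.
  by rewrite ltNge; apply/negP => h; move: B0; rewrite (bump_eq0 eps01 h) ltxx.
have E : hmul (hinv (hmul z (hinv y))) z = y by rewrite hinvM hinvK hmulVKr.
have := hnorm_triangle (hinv (hmul z (hinv y))) z.
by rewrite E hnormV; case/andP: eps01; lra.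
Qed.

End one_scale.

End mollification_limit.

(** * Rescaling *)

Section rescaling_estimates.
Variables (R : realType) (n : nat).
Local Notation H := (heis R n).
Local Notation leb := (lebesgue_rV R (n + n + 1)).
Local Notation Q := (hdim n).

Local Opaque hbump hmul.

Lemma square_integrable_mull (U : H -> R) k : square_integrable leb U ->
  square_integrable leb (fun y => k * U y).
Proof.
move=> [mU iU]; split; first exact: measurable_funM.
rewrite (eq_integral (fun y => (k ^+ 2)%:E * (U y ^+ 2)%:E)%E) => [|y _]; last by rewrite exprMn EFinM.
rewrite ge0_integralZl_EFin ?sqr_ge0//; last 2 first.
- by move=> y _; rewrite lee_fin sqr_ge0.
- by apply/measurable_EFinP; exact: measurable_funX.
by rewrite lte_mul_pinfty// lee_fin sqr_ge0.
Qed.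

(** A strict bound on a set of positive measure survives mollification at some
    point of the set, after normalization by the mass of the bump. The cases k =
    1 and k = -1 serve the essential supremum and the essential infimum. *)
Lemma moll_affine_superlevel (U : H -> R) (A : set H) (k a delta : R) :
  square_integrable leb U -> measurable A -> A `<=` hb 1 -> (0 < leb A)%E ->
  0 < delta -> (forall y, A y -> delta <= k * U y + a) ->
  exists2 e0 : R, 0 < e0 & forall eps, 0 < eps <= 1 -> eps <= e0 ->
    exists2 x, A x & 0 < k * moll U eps x + a * @bump_mass R n eps.
Proof.
move=> sU mA A1 A0 d0 hA; have [mU _] := sU.
have mW : measurable_fun setT (fun y => k * U y + a).
  by apply: measurable_funD => //; exact: measurable_funM.
have iW : (\int[leb]_(y in hb 3) ((k * U y + a) ^+ 2)%:E < +oo)%E.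
  have := integral_sqr_sub_lty (square_integrable_mull k sU) (- a).
  by rewrite (eq_integral (fun y => ((k * U y + a) ^+ 2)%:E)) => // y _; rewrite opprK.
have [e0 e00 h] := moll_superlevel mW iW mA A1 A0 d0 hA.
exists e0 => // eps eps01 he; have [x Ax hx] := h eps eps01 he.
by exists x => //; exact: (moll_affine_gt0 sU eps01 hx).
Qed.

Lemma ae_scales (J : R) (T : H -> H) (P : H -> Prop) : scales_leb J T ->
  (\forall x \ae leb, P x) -> \forall x \ae leb, P (T x).
Proof.
move=> [J0 mT hT] [N [mN N0 hN]]; exists (T @^-1` N); split.
- by rewrite -[X in measurable X]setTI; exact: mT.
- by have /eqP := hT N mN; rewrite N0 mule_eq0 eqe gt_eqF//= => /eqP.
- by move=> x nPx; exact: (hN (T x)).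
Qed.

(** The point of the vertical axis at distance rho from the centre lies in the
    larger ball only. *)
Lemma hball_subset_le (xi0 : H) (r rho : R) : 0 < r -> 0 < rho ->
  hball xi0 r `<=` hball xi0 rho -> r <= rho.
Proof.
move=> r0 rho0 sub; rewrite leNgt; apply/negP => lt.
pose x : H := hpoint 0 0 (rho ^+ 2).
have nx : hnorm4 x = rho ^+ 4.
  rewrite /hnorm4 /x /hzsq /hdot hx_hpoint hy_hpoint ht_hpoint !dotr0 addr0 expr0n add0r.
  by rewrite -exprM.
have xr : hball xi0 r (hmul xi0 x).
  by rewrite /hball /= hmulKl hnorm_lt ?(ltW r0)// nx ltrXn2r// ?nnegrE ?ltW.
by have := sub _ xr; rewrite /hball /= hmulKl hnorm_lt ?(ltW rho0)// nx ltxx.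
Qed.

Section rescaled_solution.
Variables (xi0 : H) (r rho : R) (u : H -> R).
Hypotheses (r0 : 0 < r) (mu : measurable_fun setT u).
Local Notation U := (rescaled xi0 r u).
Local Notation S := (hsim xi0 r).

Let mS : measurable_fun setT S. Proof. exact: measurable_hsim. Qed.

Let mU : measurable_fun setT U. Proof. exact: (measurableT_comp mu mS). Qed.

Lemma preimage_hsim_hball : S @^-1` hball xi0 r = hb 1.
Proof.
by apply/seteqP; split => y; rewrite /hball /hb /= hnorm_hsim// gtr_pMr.
Qed.

Lemma leb_level_gt0 (E : set H) : measurable E -> (0 < leb (E `&` hball xi0 r))%E ->
  (0 < leb ((S @^-1` E) `&` hb 1))%E.
Proof.
move=> mE; rewrite -preimage_hsim_hball -preimage_setI.
have [J0 _ h] := scales_hsim xi0 r0.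
have mI : measurable (E `&` hball xi0 r).
  by apply: measurableI; [exact: mE|exact: measurable_hball].
by move=> E0; have := h _ mI => hI; rewrite -hI in E0; move: E0; rewrite pmule_rgt0 ?lte_fin.
Qed.

Lemma leb_superlevel_gt0 (a : R) : (a%:E < ess_sup_hball u xi0 r)%E ->
  (0 < leb ([set y | (a < U y)%R] `&` hb 1))%E.
Proof.
move=> h; have mE : measurable [set x | a < u x].
  by rewrite -[X in measurable X]setTI; exact: measurable_fun_ltr.
apply: (leb_level_gt0 mE).
rewrite lt0e measure_ge0 andbT; apply/eqP => E0.
move: h; rewrite ltNge => /negP; apply; apply/ess_supP.
exists [set x | a < u x]; split => // x /=.
by rewrite lee_fin => /negP; rewrite -ltNge.
Qed.

Lemma leb_sublevel_gt0 (a : R) : (ess_inf_hball u xi0 r < a%:E)%E ->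
  (0 < leb ([set y | (U y < a)%R] `&` hb 1))%E.
Proof.
move=> h; have mE : measurable [set x | u x < a].
  by rewrite -[X in measurable X]setTI; exact: measurable_fun_ltr.
apply: (leb_level_gt0 mE).
rewrite lt0e measure_ge0 andbT; apply/eqP => E0.
move: h; rewrite ltNge => /negP; apply; apply/ess_infP.
exists [set x | u x < a]; split => // x /=.
by rewrite lee_fin => /negP; rewrite -ltNge.
Qed.

Hypotheses (rho6 : 6 * r <= rho)
  (u0 : \forall xi \ae leb, hball xi0 rho xi -> 0 <= u xi).

Lemma rescaled_ge0 : \forall y \ae leb, r * hnorm y < rho -> 0 <= U y.
Proof.
apply: filterS (ae_scales (scales_hsim xi0 r0) u0) => y + yr; apply.
by rewrite /hball /= hnorm_hsim.
Qed.

(** The tail is scale invariant; outside the image of B_rho the kernel agrees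
    with its truncation because rho / r >= 1, and inside it the negative part
    vanishes. *)
Lemma Tail_rescaled (s : R) :
  (((r / rho) `^ (2 * s))%:E * Tail s (u^\-)%R xi0 rho =
   \int[leb]_y (kap1 s y * Num.max (- U y) 0)%:E)%E.
Proof.
have rho0 : 0 < rho by apply: lt_le_trans rho6; rewrite mulr_gt0.
pose f (eta : H) := (`|(u^\-)%R eta| * hnorm (hmul (hinv eta) xi0) `^ (- Q%:R - 2 * s))%:E.
have mB := measurable_hball xi0 rho.
have mf : measurable_fun setT f.
  apply/measurable_EFinP; apply: measurable_funM.
    apply: (measurableT_comp (@normr_measurable _ _)) => //.
    by apply: measurable_maxr => //; exact: measurable_funN.
  apply: (measurableT_comp (measurable_powR _)).
  apply: (measurableT_comp (@measurable_hnorm R n)); apply: measurable_hmul => //.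
  exact: (@measurable_hinv _ _ _ _ id).
have f0 eta : (0 <= f eta)%E by rewrite lee_fin mulr_ge0 ?powR_ge0.
have mfB : measurable_fun setT (f \_ (~` hball xi0 rho)).
  by apply/(measurable_restrictT _ (measurableC mB)); exact: measurable_funTS.
have fB0 eta : (0 <= (f \_ (~` hball xi0 rho)) eta)%E by rewrite patchE; case: ifP.
have E : (Tail s (u^\-)%R xi0 rho = (rho `^ (2 * s))%:E *
    ((r ^+ Q)%:E * \int[leb]_y (f \_ (~` hball xi0 rho)) (S y)))%E.
  rewrite /Tail; apply: (congr1 (fun t => (_ * t)%E)).
  apply: (eq_trans _ (ge0_integral_scales (scales_hsim xi0 r0) mfB fB0)).
  rewrite [LHS]integral_mkcond; reflexivity.
pose g y := (kap1 s y * Num.max (- U y) 0)%:E.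
have g0 y : (0 <= g y)%E by rewrite lee_fin mulr_ge0 ?kap1_ge0// le_max lexx orbT.
have mg : measurable_fun setT g.
  apply/measurable_EFinP; apply: measurable_funM; first exact: measurable_kap1.
  by apply: measurable_maxr => //; exact: measurable_funN.
have rp0 : 0 <= r `^ (- hexp n s) by exact: powR_ge0.
have I : (\int[leb]_y (f \_ (~` hball xi0 rho)) (S y) =
          (r `^ (- hexp n s))%:E * \int[leb]_y g y)%E.
  have Z := ge0_integralZl_EFin leb measurableT (fun y _ => g0 y) mg rp0.
  apply: (eq_trans _ Z).
  have m1 : measurable_fun setT (fun y => (f \_ (~` hball xi0 rho)) (S y)).
    exact: (measurableT_comp mfB mS).
  have m2 : measurable_fun setT (fun y => (r `^ (- hexp n s))%:E * g y)%E.
    by apply: emeasurable_funM; [exact: measurable_cst|exact: mg].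
  apply: ge0_ae_eq_integral; [exact: measurableT|exact: m1|exact: m2| | |].
  - by move=> y _; exact: fB0.
  - by move=> y _; apply: mule_ge0; [rewrite lee_fin|exact: g0].
  apply: filterS rescaled_ge0 => y Uy _; rewrite patchE.
  have [yr|yr] := ltP (r * hnorm y) rho.
    rewrite ifF; last first.
      by apply/negbTE; rewrite notin_setE => /=; apply; rewrite /hball /= hnorm_hsim.
    by rewrite /g max_r ?mulr0 ?mule0// oppr_le0 Uy.
  rewrite ifT; last by rewrite inE /= /hball /= hnorm_hsim//; apply/negP; rewrite -leNgt.
  have y1 : 1 <= hnorm y by rewrite -(ler_pM2l r0) mulr1; apply: le_trans yr; have := r0; have := rho6; lra.
  rewrite /f /g (kap1_far s y1) /kap -EFinM.
  have -> : hnorm (hmul (hinv (S y)) xi0) = r * hnorm y.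
    by rewrite -(hnorm_hsim xi0 r0) -[RHS]hnormV hinvM hinvK.
  rewrite powRM ?hnorm_ge0 ?(ltW r0)// /hexp opprD.
  have -> : `|(u^\-)%R (S y)| = Num.max (- U y) 0 by rewrite ger0_norm ?funrneg_ge0.
  by apply: (congr1 EFin); rewrite mulrC mulrA.
rewrite E I !muleA -!EFinM.
suff -> : (r / rho) `^ (2 * s) * rho `^ (2 * s) * r ^+ Q * r `^ (- hexp n s) = 1.
  by rewrite mul1e.
rewrite -powRM ?divr_ge0 ?(ltW r0) ?(ltW rho0)// divfK ?gt_eqF//.
rewrite -powR_mulrn ?(ltW r0)// -!powRD ?(gt_eqF r0) ?implybT//.
by rewrite /hexp (_ : _ + _ + _ = 0) ?powRr0//; ring.
Qed.

End rescaled_solution.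

End rescaling_estimates.

(** * The Harnack inequality *)

Section conclusion.
Variables (R : realType) (n : nat).
Local Notation H := (heis R n).
Local Notation leb := (lebesgue_rV R (n + n + 1)).

(** Let m be the mass of the bump. The pointwise inequality is applied to a
    mollification, at a point where it exceeds nearly a m and at one where it is
    less than nearly b m; the factor m cancels. *)
Lemma rescaled_harnack (s : R) : 0 < s < 1 -> exists2 C : R, 0 < C &
  forall (Omega : set H) (g u : H -> R) (xi0 : H) (r a b : R),
    0 < r -> hball xi0 (6 * r) `<=` Omega -> weak_solution s Omega g u ->
    (\forall y \ae leb, hnorm y < 6 -> 0 <= rescaled xi0 r u y) ->
    (a%:E < ess_sup_hball u xi0 r)%E -> (ess_inf_hball u xi0 r < b%:E)%E ->
    a <= C * (b + 3 `^ hexp n s * \int[leb]_y (kap1 s y * Num.max (- rescaled xi0 r u y) 0)).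
Proof.
move=> s01; have [C C0 hC] := pointwise_harnack n s01; exists C => //.
move=> Omega g u xi0 r a b r0 sub wu U0 ha hb'.
have sU := square_integrable_rescaled xi0 r0 wu.
have [[[/Lfun2P[mu _] _] _ _] _] := wu.
pose U := rescaled xi0 r u; set T := \int[leb]_y (kap1 s y * Num.max (- rescaled xi0 r u y) 0).
have [mU _] := sU.
have mA : measurable ([set y | a < U y] `&` hb 1).
  apply: measurableI; last exact: (@measurable_hb R n 1).
  by rewrite -[X in measurable X]setTI; exact: measurable_fun_ltr.
have mB : measurable ([set y | U y < b] `&` hb 1).
  apply: measurableI; last exact: (@measurable_hb R n 1).
  by rewrite -[X in measurable X]setTI; exact: measurable_fun_ltr.
apply/ler_addgt0Pr => d d0.
have K0 : 0 < C + 1 by rewrite addr_gt0.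
(* the error made at x is e, and the one made at y is C e; together they make d *)
pose e := d / (C + 1); have e0 : 0 < e by rewrite divr_gt0.
have [e1 e10 h1] := @moll_affine_superlevel R n U _ 1 (e - a) e sU mA (@subIsetr _ _ _)
  (leb_superlevel_gt0 r0 mu ha) e0 (fun y Ay => ltac:(case: Ay => /= Ay _; lra)).
have [e2 e20 h2] := @moll_affine_superlevel R n U _ (-1) (b + e) e sU mB (@subIsetr _ _ _)
  (leb_sublevel_gt0 r0 mu hb') e0 (fun y Ay => ltac:(case: Ay => /= Ay _; lra)).
pose eps := Num.min 1 (Num.min e1 e2).
have eps01 : 0 < eps <= 1 by rewrite /eps !lt_min ltr01 e10 e20 ge_min lexx.
have [x [_ x1] hx] := h1 eps eps01 ltac:(by rewrite /eps !ge_min lexx orbT).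
have [y [_ y1] hy] := h2 eps eps01 ltac:(by rewrite /eps !ge_min lexx !orbT).
have mh z (z2 : hnorm z <= 2) := moll_harmonic s01 r0 eps01 sub wu z2.
have hV := hC _ _ (measurable_moll sU eps01) (moll_bounded sU eps01) (continuous_moll sU eps01)
  (fun z z3 => moll_ge0 sU eps01 U0 z3) (fun z z2 => (mh z z2).1) (fun z z2 => (mh z z2).2)
  x y (ltW x1) (ltW y1).
have hT := moll_neg_tail sU eps01 s01; rewrite -/T in hT.
have c0 := bump_mass_gt0 n eps01.
move: hx hy hV hT c0; rewrite -/U mul1r mulN1r.
set c := bump_mass _ _; set Te := \int[leb]_z _.
move: (moll U eps x) (moll U eps y) Te c (3 `^ hexp n s) T => V V' Te c p T hx hy hV hT c0.
rewrite -(ler_pM2r c0).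
have h3 : C * (V' + Te) <= C * ((b + e) * c + p * c * T).
  by rewrite ler_pM2l//; apply: lerD => //; lra.
have de : e * c * (C + 1) = d * c by rewrite /e; field; exact: lt0r_neq0.
have -> : (C * (b + p * T) + d) * c = C * ((b + e) * c + p * c * T) + e * c.
  by rewrite mulrDl -de; ring.
lra.
Qed.

End conclusion.

Theorem theorem1p4 (R : realType) (n : nat) (s : R) :
  (0 < n)%N -> 0 < s < 1 ->
  exists c : R, 0 < c /\
    forall (Omega : set (heis R n)) (g u : heis R n -> R)
      (xi0 : heis R n) (rho r : R),
      bounded_domain Omega ->
      Hs s g -> weak_solution s Omega g u ->
      0 < rho -> hball xi0 rho `<=` Omega ->
      (\forall xi \ae lebesgue_rV R (n + n + 1),
         hball xi0 rho xi -> 0 <= u xi) ->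
      0 < r -> hball xi0 (6 * r) `<=` hball xi0 rho ->
      (ess_sup_hball u xi0 r <=
         c%:E * ess_inf_hball u xi0 r +
         (c * (1 - s) * (r / rho) `^ (2 * s))%:E * Tail s (u^\-)%R xi0 rho)%E.
Proof.
move=> _ s01; have [C C0 hC] := rescaled_harnack n s01.
have s1 : 0 < 1 - s by case/andP: s01; rewrite subr_gt0.
pose p : R := 3 `^ hexp n s; have p0 : 0 <= p by exact: powR_ge0.
(* c bounds C, and c (1 - s) bounds C p *)
pose c := C * (1 + p) / (1 - s).
have c0 : 0 < c by rewrite divr_gt0// mulr_gt0// ltr_pwDl.
have cs : c * (1 - s) = C * (1 + p) by rewrite /c divfK// gt_eqF.
exists c; split => // Omega g u xi0 rho r _ _ wu rho0 sub u0 r0 sub6.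
have rho6 : 6 * r <= rho by apply: hball_subset_le sub6; rewrite ?mulr_gt0.
have [[[/Lfun2P[mu _] _] _ _] _] := wu.
have sU := square_integrable_rescaled xi0 r0 wu.
pose T := \int[lebesgue_rV R (n + n + 1)]_y (kap1 s y * Num.max (- rescaled xi0 r u y) 0).
have T0 : 0 <= T.
  by apply: Rintegral_ge0 => y _; rewrite mulr_ge0 ?kap1_ge0// le_max lexx orbT.
have U0 : \forall y \ae lebesgue_rV R (n + n + 1), hnorm y < 6 -> 0 <= rescaled xi0 r u y.
  apply: filterS (rescaled_ge0 r0 u0) => y h y6; apply: h.
  by apply: lt_le_trans rho6; rewrite mulrC ltr_pM2r.
have ET : (((r / rho) `^ (2 * s))%:E * Tail s (u^\-)%R xi0 rho = T%:E)%E.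
  apply: (eq_trans (Tail_rescaled r0 mu rho6 u0 s)).
  by apply: esym; apply: fineK; exact: (integrable_fin_num measurableT (integrable_kap1_neg sU s01)).
have -> : ((c * (1 - s) * (r / rho) `^ (2 * s))%:E * Tail s (u^\-)%R xi0 rho =
    (C * (1 + p) * T)%:E)%E by rewrite EFinM -muleA ET -EFinM cs.
have i0 : (0 <= ess_inf_hball u xi0 r)%E.
  apply/ess_infP; case: u0 => N [mN N0 hN].
  have mE : measurable [set x | u x < 0].
    by rewrite -[X in measurable X]setTI; exact: measurable_fun_ltr.
  have mB := measurable_hball xi0 r.
  exists [set x | u x < 0]; split => //; last by move=> x /=; rewrite lee_fin => /negP; rewrite -ltNge.
  apply/eqP; rewrite eq_le measure_ge0 andbT -N0.
  apply: le_measure; rewrite ?inE//; first exact: measurableI.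
  move=> x [/= ux xr]; apply: hN => /= h; move: ux; rewrite ltNge => /negP; apply; apply: h.
  by move: xr; rewrite /hball /= => xr; apply: lt_le_trans xr _; lra.
have iE : (ess_inf_hball u xi0 r < +oo)%E \/ ess_inf_hball u xi0 r = +oo%E.
  by case: (ess_inf_hball u xi0 r) => [t| |]; [left; rewrite ltry|right|left].
case: iE => [iE|->]; last by rewrite gt0_muley ?lte_fin// addye// leey.
have fE : ess_inf_hball u xi0 r \is a fin_num by rewrite ge0_fin_numE.
have hI := fineK fE; set e := fine _ in hI; rewrite -hI lee_fin in i0; rewrite -hI.
rewrite -EFinM -EFinD leNgt; apply/negP => hlt.
have [a ha1 ha2] : exists2 a : R, c * e + C * (1 + p) * T < a & (a%:E < ess_sup_hball u xi0 r)%E.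
  move: hlt; case: (ess_sup_hball u xi0 r) => [t| |//]; last first.
    by exists (c * e + C * (1 + p) * T + 1); [rewrite ltrDl|exact: ltry].
  by rewrite lte_fin => h; exists ((c * e + C * (1 + p) * T + t) / 2); rewrite ?lte_fin; lra.
set K := c * e + C * (1 + p) * T in ha1.
(* half of the gap a - K is spent on exceeding the infimum *)
have hb : (ess_inf_hball u xi0 r < (e + (a - K) / (2 * C))%:E)%E.
  by rewrite -hI lte_fin ltrDl divr_gt0 ?mulr_gt0 ?subr_gt0.
have sub6' : hball xi0 (6 * r) `<=` Omega by move=> x /sub6/sub.
have := hC Omega g u xi0 r a _ r0 sub6' wu U0 ha2 hb; rewrite -/T -/p.
have -> : C * (e + (a - K) / (2 * C) + p * T) = C * e + C * p * T + (a - K) / 2.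
  by field; exact: lt0r_neq0.
have Cc : C * e <= c * e.
  rewrite ler_wpM2r// /c ler_pdivlMr// ler_pM2l//.
  by case/andP: s01 => s0 _; lra.
have CT : 0 <= C * T by rewrite mulr_ge0// ltW.
have KE : K = c * e + C * T + C * p * T by rewrite /K; ring.
move: Cc CT KE ha1; clear hb; move: (C * e) (C * T) (C * p * T) (c * e) K; clear; move=> *; lra.
Qed.
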